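(* (Littlewood–Richardson rule for Young noncommutative Schur functions.) Let $\alpha,\beta$ be compositions. Then in $\mathsf{NSym}$ $$\mathscr{S}_\alpha^*\mathscr{S}_\beta^*=\sum_\gamma OC_{\alpha\beta}^\gamma\,\mathscr{S}_\gamma^*,$$ where the sum is over compositions $\gamma$ and $$OC_{\alpha\beta}^\gamma=\sum_{\substack{S\in\mathrm{SYT}(\tilde\gamma/\tilde\alpha),\ \mathrm{sh}(\rho_\alpha^{-1}(S))=\gamma/\!/\alpha\\ \mathrm{rect}(S)=\rho(U_\beta)}}(-1)^{\mathrm{inv}((T_{\tilde\alpha})_S)+\mathrm{inv}(\rho(U_\beta))}.$$ Equivalently, for every composition $\gamma$, $$\Delta'(\mathscr{S}_\gamma)=\sum_{\alpha,\beta}OC_{\alpha\beta}^\gamma\,\mathscr{S}_\alpha\otimes\mathscr{S}_\beta.$$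
   Context: **$\mathsf{OQSym}$ and $\mathsf{NSym}$.** Let $k$ be a commutative ring with unity and $A_{-1}=k\langle\langle x_1,x_2,\dots\rangle\rangle/(x_ix_j+x_jx_i,\ i>j)$. For a composition $\alpha$, $M_\alpha=\sum_{i_1<\cdots<i_r}x_{i_1}^{\alpha_1}\cdots x_{i_r}^{\alpha_r}$; $F_\alpha=\sum_\beta M_\beta$ over all refinements $\beta$ of $\alpha$. $\mathsf{OQSym}$ is the subalgebra of $A_{-1}$ with basis $\{M_\alpha\}$, with coproduct $\Delta'(M_\alpha)=\sum_{\beta\gamma=\alpha}M_\beta\otimes M_\gamma$ (concatenation). $\mathsf{NSym}$ is the free associative $k$-algebra on $H_1,H_2,\dots$, with $H_\alpha=H_{\alpha_1}\cdots H_{\alpha_r}$, paired with $\mathsf{OQSym}$ by $\langle M_\alpha,H_\beta\rangle=\delta_{\alpha,\beta}$. **Composition poset.** $\mathcal L$ is the poset on compositions in which $(\alpha_1,\dots,\alpha_r)$ is covered by $(\alpha_1,\dots,\alpha_r,1)$ and by $(\alpha_1,\dots,\alpha_k+1,\dots,\alpha_r)$ whenever $\alpha_i\ne\alpha_k$ for all $i>k$. The order is written $\lessdot$. The diagram of $\alpha$ has $\alpha_i$ left-justified boxes in row $i$ (rows from the top). If $\beta\lessdot\alpha$ (in the order of $\mathcal L$, $\beta=\alpha$ allowed), $\alpha/\!/\beta=\{(i,j)\in\alpha,(i,j)\notin\beta\}$. **Tableaux.** A semistandard Young composition tableau (SSYCT) $\tau$ of shape $\mathrm{sh}(\tau)=\alpha/\!/\beta$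 is a filling $\tau:\alpha/\!/\beta\to\mathbb Z^+$ with rows weakly increasing left to right; first-column entries strictly increasing top to bottom; and (triple rule) if $i>j$, $(j,k+1)\in\alpha/\!/\beta$ and either $(i,k)\in\beta$ or $\tau(i,k)\le\tau(j,k+1)$, then either $(i,k+1)\in\beta$ or both $(i,k+1)\in\alpha/\!/\beta$ and $\tau(i,k+1)<\tau(j,k+1)$. It is standard (SYCT) if bijective onto $[|\alpha/\!/\beta|]$. For $\tau\in\mathrm{SYCT}$ with $n$ boxes, $c(\tau)$ is the composition of $n$ with descent set (set of proper partial sums) $\{m\in[n-1]:m+1\text{ weakly left of }m\text{ in }\tau\}$. $\mathrm{inv}^c(\tau)$ is the number of pairs of boxes with $j<j'$ and $\tau(i,j)>\tau(i',j')$. $U_\alpha$ is the SYCT of shape $\alpha$ whose row $i$ contains $\alpha_1+\cdots+\alpha_{i-1}+1,\dots,\alpha_1+\cdots+\alpha_i$. $\tilde\alpha$ is the partition obtained by sorting the parts of $\alpha$. Mason's bijection $\rho_\alpha$ maps SSYCT with base (inner) shape $\alpha$ to semistandard Young tableaux with inner shape $\tilde\alpha$, by writing the entries of each column in increasing order and top-justifying these columns on $\tilde\alpha$; $\rho=\rho_\emptyset$. Its inverse is: if the first column of the base shape has $i$ boxes, put the first-column entries in increasing order in rows $i+1,i+2,\dots$; then, for columns $2,3,\dots$ in turn, place the entries in increasing order, each in the row of largest index (with that column position free) such that the box immediately to the left is either filled with a weakly smaller entry or belongs to the base shape. For a Young tableau $T$, $\mathrm{inv}(T)$ is the number of pairs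 of boxes with $i<i'$, $T(i,j)\ge T(i',j')$. $T_\lambda$ is the standard tableau of shape $\lambda$ filled row by row. $\mathrm{rect}(S)$ is the jeu de taquin rectification of a skew standard tableau $S$. For $S\in\mathrm{SYT}(\nu/\lambda)$, $(T_\lambda)_S$ is the standard tableau of shape $\nu$ obtained by adding $|\lambda|$ to entries of $S$ and filling $\lambda$ with $T_\lambda$. **Bases.** $NE(\lambda)$ is the number of pairs of boxes of $\lambda$ with $i>i'$, $j<j'$. $\mathscr{S}_\alpha=(-1)^{NE(\tilde\alpha)}\sum_{\tau\in\mathrm{SYCT}(\alpha)}(-1)^{\mathrm{inv}^c(\tau)}F_{c(\tau)}$ is the odd quasisymmetric Schur function; $\{\mathscr{S}_\alpha\}$ is a basis of $\mathsf{OQSym}$ and $\{\mathscr{S}^*_\alpha\}\subset\mathsf{NSym}$ is the dual basis, $\langle\mathscr{S}_\alpha,\mathscr{S}^*_\beta\rangle=\delta_{\alpha,\beta}$. The sum defining $OC_{\alpha\beta}^\gamma$ is zero if there is no such $S$ (in particular unless $\alpha\lessdot\gamma$ or $\alpha=\gamma$). *)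

(* Defs.v *)
From HB Require Import structures.
From mathcomp Require Import all_boot all_order all_algebra.
From mathcomp Require Import finmap.
From mathcomp Require Export monalg.

Set Implicit Arguments.
Unset Strict Implicit.
Unset Printing Implicit Defensive.

Import GRing.Theory.

Record part := Part { part_val :> nat; _ : 0 < part_val }.

HB.instance Definition _ := [isSub for part_val].
HB.instance Definition _ := [Countable of part by <:].

Notation composition := (seq part).

Definition nats (a : composition) : seq nat := [seq part_val p | p <- a].
Definition weight (a : composition) : nat := sumn (nats a).

(* The underlying partition \tilde\alpha. *)
Definition sorted_parts (a : composition) : seq nat := sort geq (nats a).

Definition part1 : part := @Part 1 isT.
Definition partS (p : part) : part := @Part p.+1 isT.

(* A composition of n.+1 either starts with the part 1 or comes from a nonempty
   composition of n by increasing its first part. *)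
Definition next_compositions (a : composition) : seq composition :=
  (part1 :: a) :: (if a is p :: a' then [:: partS p :: a'] else [::]).

Fixpoint compositions (n : nat) : seq composition :=
  if n is m.+1 then flatten [seq next_compositions a | a <- compositions m]
  else [:: [::]].

Lemma nats_inj : injective nats.
Proof. exact: inj_map val_inj. Qed.

Lemma mem_compositions n a : (a \in compositions n) = (weight a == n).
Proof.
elim: n a => [|n IHn] a.
  by case: a => [|[[|p] hp] a] //; rewrite inE eqE.
apply/flatten_mapP/eqP => [[b]|].
  rewrite IHn => /eqP <-; rewrite inE => /orP[/eqP->|] //.
  by case: b => [|p b] //; rewrite inE => /eqP->.
case: a => [|[[|[|p]] hp] a] // [wa].
  exists a; first by rewrite IHn; apply/eqP.
  by rewrite inE; apply/orP; left; apply/eqP; congr (_ :: _); apply: val_inj.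
exists (@Part p.+1 isT :: a); first by rewrite IHn; apply/eqP.
by rewrite !inE; apply/orP; right; apply/eqP; congr (_ :: _); apply: val_inj.
Qed.

Lemma compositions_uniq n : uniq (compositions n).
Proof.
elim: n => // n; rewrite [compositions n.+1]/=.
elim: (compositions n) => // a s IHs /= /andP[a_s /IHs fu].
set fl := flatten _ in fu *.
have mem1 b : part1 :: b \in fl -> b \in s.
  case/flatten_mapP=> c cs; rewrite inE => /orP[/eqP[->] //|].
  by case: c cs => // p c _; rewrite inE => /eqP[]; case: p => [[]].
have memS p b : partS p :: b \in fl -> p :: b \in s.
  case/flatten_mapP=> c cs; rewrite inE => /orP[/eqP[]|].
    by case: p => [[]].
  case: c cs => // q c cs; rewrite inE => /eqP[pq ->].
  by have -> : p = q by apply: val_inj.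
have a_fl : part1 :: a \notin fl by apply: contraNN a_s => /mem1.
case: a a_s a_fl => [|p a] a_s a_fl /=; first by rewrite a_fl.
rewrite inE negb_or a_fl fu !andbT; apply/andP; split.
  by apply/negP => /eqP[]; case: p {a_s a_fl} => [[]].
by apply: contraNN a_s => /memS.
Qed.

(* Partial sums, the total included. *)
Definition partial_sums (a : composition) : seq nat := scanl addn 0 (nats a).

Definition refines (b a : composition) : bool :=
  (weight b == weight a) && all (mem (partial_sums b)) (partial_sums a).

(* D: the increasing list of proper partial sums.  For n = 0 the difference 0
   is discarded by [insub]. *)
Definition composition_of_set (n : nat) (D : seq nat) : composition :=
  pmap insub (pairmap (fun x y => y - x) 0 (rcons D n)).

(* The poset L: [Lcovers a] lists the elements covering a; [Lle] is the
   (reflexive) order, whose rank function is the weight. *)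
Definition Lcovers (a : seq nat) : seq (seq nat) :=
  rcons a 1 ::
  [seq incr_nth a k | k <- iota 0 (size a) & nth 0 a k \notin drop k.+1 a].

Definition Lle (b a : seq nat) : bool :=
  a \in iter (sumn a - sumn b) (fun s => flatten [seq Lcovers c | c <- s]) [:: b].

(* Boxes are pairs (row, column), both counted from 0, rows from the top. *)
Definition in_diagram (s : seq nat) (b : nat * nat) : bool := b.2 < nth 0 s b.1.

Definition cells (s : seq nat) : seq (nat * nat) :=
  [seq (i, j) | i <- iota 0 (size s), j <- iota 0 (nth 0 s i)].

(* A filling of a (possibly skew) shape is the list of its rows.  Entries are
   positive; the boxes of the inner shape are stored as well and hold 0, so
   that [shape] gives the outer shape. *)
Definition tableau := seq (seq nat).

Definition entry (T : tableau) (b : nat * nat) : nat := nth 0 (nth [::] T b.1) b.2.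

Definition boxes (T : tableau) : seq (nat * nat) :=
  [seq b <- cells (shape T) | entry T b != 0].

Definition ncols (T : tableau) : nat := foldr maxn 0 (shape T).

Definition count_pairs (P : rel (nat * nat)) (B : seq (nat * nat)) : nat :=
  count (fun bb => P bb.1 bb.2) [seq (b, b') | b <- B, b' <- B].

Definition NE (s : seq nat) : nat :=
  count_pairs (fun b b' => (b'.1 < b.1) && (b.2 < b'.2)) (cells s).

Definition inv_tab (T : tableau) : nat :=
  count_pairs (fun b b' => (b.1 < b'.1) && (entry T b' <= entry T b)) (boxes T).

Definition inv_comp (T : tableau) : nat :=
  count_pairs (fun b b' => (b.2 < b'.2) && (entry T b' < entry T b)) (boxes T).

(* U_\alpha and T_\lambda. *)
Definition row_filling (s : seq nat) : tableau := reshape s (iota 1 (sumn s)).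

Definition standard_fillings (outer inner : seq nat) : seq tableau :=
  [seq [seq nseq (nth 0 inner i) 0 ++
            nth [::] (reshape [seq nth 0 outer i - nth 0 inner i
                              | i <- iota 0 (size outer)] p) i
       | i <- iota 0 (size outer)]
  | p <- permutations (iota 1 (sumn outer - sumn inner))].

(* The semistandard filling rules for a filling T of shape (shape T) // b. *)
Definition is_ssyct (b : seq nat) (T : tableau) : bool :=
  let skew x := in_diagram (shape T) x && ~~ in_diagram b x in
  [&& all (in_diagram (shape T)) (cells b),
      all (fun x => (entry T x == 0) == in_diagram b x) (cells (shape T)),
      all (sorted leq) T,
      sorted ltn [seq entry T (i, 0) | i <- iota 0 (size T) & skew (i, 0)] &
      all (fun i => all (fun j => all (fun k =>
        [&& j < i, skew (j, k.+1) &
            in_diagram b (i, k) ||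
            (skew (i, k) && (entry T (i, k) <= entry T (j, k.+1)))]
        ==>
        (in_diagram b (i, k.+1) ||
         (skew (i, k.+1) && (entry T (i, k.+1) < entry T (j, k.+1)))))
      (iota 0 (ncols T))) (iota 0 (size T))) (iota 0 (size T))].

Definition SYCT (a : composition) : seq tableau :=
  [seq T <- standard_fillings (nats a) [::] | is_ssyct [::] T].

Definition column_of (T : tableau) (m : nat) : nat :=
  (nth (0, 0) (boxes T) (index m [seq entry T b | b <- boxes T])).2.

Definition descents (T : tableau) : seq nat :=
  [seq m <- iota 1 (size (boxes T)).-1 | column_of T m.+1 <= column_of T m].

Definition descent_composition (T : tableau) : composition :=
  composition_of_set (size (boxes T)) (descents T).

(* Column j in increasing order.  The zeros of the inner shape are included
   and come first: top-justifying the columns thus rearranges the inner shape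
   \alpha into \tilde\alpha and puts the entries on top of it. *)
Definition sorted_column (T : tableau) (j : nat) : seq nat :=
  sort leq [seq nth 0 r j | r <- T & j < size r].

Definition rho (T : tableau) : tableau :=
  [seq [seq nth 0 (sorted_column T j) i
       | j <- iota 0 (ncols T) & i < size (sorted_column T j)]
  | i <- iota 0 (size T)].

Definition column_entries (T : tableau) (j : nat) : seq nat :=
  [seq x <- sorted_column T j | x != 0].

(* Put x in column j, in the lowest row whose position in that column is free
   and whose box just to the left holds a value <= x (0 on the inner shape). *)
Definition place (j : nat) (rows : tableau) (x : nat) : tableau :=
  let ok i := (size (nth [::] rows i) == j) && (last 0 (nth [::] rows i) <= x) in
  if [seq i <- iota 0 (size rows) | ok i] is i0 :: s then
    let i := last i0 s in set_nth [::] rows i (rcons (nth [::] rows i) x)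
  else rows.

Definition rho_inv (a : seq nat) (S : tableau) : tableau :=
  foldl (fun rows j => foldl (place j) rows (column_entries S j))
    ([seq nseq p 0 | p <- a] ++ [seq [:: x] | x <- column_entries S 0])
    (iota 1 (ncols S).-1).

Definition SYT (outer inner : seq nat) : seq tableau :=
  if all (in_diagram outer) (cells inner) then
    [seq S <- standard_fillings outer inner
    | all (fun b =>
          (((b.1, b.2.+1) \in boxes S) ==> (entry S b < entry S (b.1, b.2.+1))) &&
          (((b.1.+1, b.2) \in boxes S) ==> (entry S b < entry S (b.1.+1, b.2))))
        (boxes S)]
  else [::].

(* (T_\lambda)_S *)
Definition extend (la : seq nat) (S : tableau) : tableau :=
  [seq nth [::] (row_filling la) i ++
       [seq sumn la + x | x <- nth [::] S i & x != 0]
  | i <- iota 0 (size S)].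

Definition set_entry (T : tableau) (i j x : nat) : tableau :=
  set_nth [::] T i (set_nth 0 (nth [::] T i) j x).

(* Jeu de taquin slide into the hole (i, j): the smaller of the right and lower
   neighbours moves in, until the hole reaches the outer boundary and is deleted.
   A neighbour reading 0 is outside the tableau.  The path visits each box at
   most once, whence the choice of [fuel] in [slide_corner]. *)
Fixpoint slide (fuel : nat) (T : tableau) (i j : nat) : tableau :=
  let right := entry T (i, j.+1) in
  let below := entry T (i.+1, j) in
  if (right == 0) && (below == 0) then
    [seq r <- set_nth [::] T i (take j (nth [::] T i)) | ~~ nilp r]
  else if fuel is f.+1 then
    if (below == 0) || ((right != 0) && (right < below))
    then slide f (set_entry T i j right) i j.+1
    else slide f (set_entry T i j below) i.+1 j
  else T.

(* Slide into the last box of the lowest nonempty row of the inner shape. *)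
Definition slide_corner (T : tableau) : tableau :=
  let i := last 0 [seq i <- iota 0 (size T) | 0 \in nth [::] T i] in
  slide (size (flatten T)) T i (count_mem 0 (nth [::] T i)).-1.

(* The rectification does not depend on the order in which the boxes of the
   inner shape are filled; here they are filled bottom row first. *)
Definition rect (T : tableau) : tableau :=
  iter (count_mem 0 (flatten T)) slide_corner T.

Local Open Scope ring_scope.

Definition lin_ext (k : comNzRingType) (K : choiceType) (V : lmodType k)
    (phi : K -> V) (g : {malg k[K]}) : V :=
  \sum_(x <- msupp g) g@_x *: phi x.

Lemma lin_extEw (k : comNzRingType) (K : choiceType) (V : lmodType k)
    (phi : K -> V) (g : {malg k[K]}) (d : {fset K}) :
  (msupp g `<=` d)%fset -> lin_ext phi g = \sum_(x <- d) g@_x *: phi x.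
Proof.
move=> gd; rewrite /lin_ext (big_fset_incl _ gd) // => x _ xg.
by rewrite mcoeff_outdom ?scale0r.
Qed.

Lemma lin_ext_is_linear (k : comNzRingType) (K : choiceType) (V : lmodType k)
    (phi : K -> V) (c : k) (f g : {malg k[K]}) :
  lin_ext phi (c *: f + g) = c *: lin_ext phi f + lin_ext phi g.
Proof.
have sub : (msupp (c *: f + g) `<=` msupp f `|` msupp g)%fset.
  by apply: (fsubset_trans (msuppD_le _ _)); apply/fsetSU/msuppZ_le.
rewrite (lin_extEw _ sub) (lin_extEw _ (fsubsetUl (msupp f) (msupp g))).
rewrite (lin_extEw _ (fsubsetUr (msupp f) (msupp g))).
rewrite scaler_sumr -big_split; apply: eq_bigr => x _ /=.
by rewrite mcoeffD mcoeffZ scalerDl scalerA.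
Qed.

Lemma lin_extU (k : comNzRingType) (K : choiceType) (V : lmodType k)
    (phi : K -> V) (x : K) : lin_ext phi << x >> = phi x.
Proof. by rewrite (lin_extEw _ msuppU_le) big_seq_fset1 mcoeffUU scale1r. Qed.

(* OQSym in the coordinates of its basis M_\alpha; see [OQSym_in_A] and
   [OQSym_in_A_inj] for its embedding in A_{-1}.  The product of OQSym is not
   needed here. *)
Notation OQSym k := {malg k[composition]}.
Notation OQSym2 k := {malg k[(composition * composition)%type]}.

Definition oqM (k : comNzRingType) (a : composition) : OQSym k := << a >>.

Definition oqF (k : comNzRingType) (a : composition) : OQSym k :=
  \sum_(b <- compositions (weight a) | refines b a) oqM k b.

Definition tensor (k : comNzRingType) (f g : OQSym k) : OQSym2 k :=
  lin_ext (fun a => lin_ext (fun b => << (a, b) >> : OQSym2 k) g) f.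

Definition coproduct (k : comNzRingType) : OQSym k -> OQSym2 k :=
  lin_ext (fun a : composition =>
    \sum_(i < (size a).+1) tensor (oqM k (take i a)) (oqM k (drop i a))).

Lemma tensor_M (k : comNzRingType) a b : tensor (oqM k a) (oqM k b) = << (a, b) >>.
Proof. by rewrite /tensor !lin_extU. Qed.

Notation NSym k := {malg k[{fmonom part}]}.

Definition nsH (k : comNzRingType) (a : composition) : NSym k :=
  \prod_(p <- a) << fmu p >>.

Lemma nsHE (k : comNzRingType) (a : composition) : nsH k a = << FMonom a >>.
Proof.
rewrite /nsH; elim: a => [|p a IHa]; first by rewrite big_nil -fmoneE.
rewrite big_cons IHa malgM_def fgmulUU mulr1; congr << _ >>.
by apply/eqP; rewrite fmP fmM /= fmuE.
Qed.

(* By [nsHE], h@_(FMonom a) is the coordinate of h on H_a. *)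
Definition pairing (k : comNzRingType) (f : OQSym k) (h : NSym k) : k :=
  \sum_(a <- msupp f) f@_a * h@_(FMonom a).

Lemma pairing_MH (k : comNzRingType) (a b : composition) :
  pairing (oqM k a) (nsH k b) = (a == b)%:R.
Proof.
rewrite /pairing /oqM msuppU oner_eq0 big_seq_fset1 mcoeffUU mul1r nsHE mcoeffU1.
by rewrite eq_sym fmP.
Qed.

(* The noncommutative formal power series in x_1, x_2, ..., as functions on
   words; the letter i stands for x_(i.+1). *)
Definition nc_series (k : comNzRingType) := seq nat -> k.

Definition nc_mul (k : comNzRingType) (f g : nc_series k) : nc_series k :=
  fun w => \sum_(i < (size w).+1) f (take i w) * g (drop i w).

Definition word_inv (w : seq nat) : nat :=
  (\sum_(i < size w) \sum_(j < size w | i < j) (nth 0 w j < nth 0 w i))%N.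

(* Equality in A_{-1}: modulo x_i x_j + x_j x_i (i > j), a word equals, up to
   the sign of its inversions, its increasing rearrangement, and the increasing
   words are the normal forms. *)
Definition eqA (k : comNzRingType) (f g : nc_series k) : Prop :=
  forall w : seq nat, sorted leq w ->
    \sum_(u <- permutations w) (-1) ^+ word_inv u * f u =
    \sum_(u <- permutations w) (-1) ^+ word_inv u * g u.

Definition M_series (k : comNzRingType) (a : composition) : nc_series k :=
  fun w => (sorted leq w && ([seq count_mem i w | i <- undup w] == nats a))%:R.

Definition OQSym_in_A (k : comNzRingType) (f : OQSym k) : nc_series k :=
  fun w => \sum_(a <- msupp f) f@_a * M_series k a w.

Lemma OQSym_in_A_inj (k : comNzRingType) (f g : OQSym k) :
  eqA (OQSym_in_A f) (OQSym_in_A g) -> f = g.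
Proof.
move=> fg; apply/malgP => a.
pose fix word n (b : seq nat) :=
  if b is p :: b' then nseq p n ++ word n.+1 b' else [::].
have word_ge n b i : i \in word n b -> (n <= i)%N.
  elim: b n => //= p b IHb n; rewrite mem_cat mem_nseq.
  by case/orP=> [/andP[_ /eqP->]|/IHb/ltnW].
have word_sorted n b : sorted leq (word n b).
  elim: b n => //= p b IHb n.
  rewrite sorted_pairwise; last exact: leq_trans.
  rewrite pairwise_cat -!sorted_pairwise; try exact: leq_trans.
  rewrite IHb andbT; apply/andP; split.
    apply/allrelP => x y; rewrite mem_nseq => /andP[_ /eqP->] /word_ge.
    exact: ltnW.
  by case: p => //= p; elim: p => //= p ->; rewrite leqnn.
have word_runs n (b : composition) :
    [seq count_mem i (word n (nats b)) | i <- undup (word n (nats b))] = nats b.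
  elim: b n => //= p b IHb n; case: p => [[|p] hp] //=.
  have nw : n \notin word n.+1 (nats b).
    by apply/negP => /word_ge; rewrite ltnn.
  have un : undup (n :: (nseq p n ++ word n.+1 (nats b)))
            = n :: undup (word n.+1 (nats b)).
    elim: p {hp} => [|p IHp]; first by rewrite /= (negbTE nw).
    by rewrite -IHp /= inE eqxx.
  rewrite -[if _ then _ else _]/(undup (n :: (nseq p n ++ _))) un /=.
  rewrite eqxx count_cat count_nseq /= eqxx mul1n (count_memPn nw) addn0 add1n.
  congr (_ :: _); rewrite -[RHS](IHb n.+1); apply/eq_in_map => i.
  rewrite mem_undup => /word_ge ni.
  by rewrite (ltn_eqF ni) count_cat count_nseq /= (ltn_eqF ni) mul0n.
pose w := word 0 (nats a); have w_s : sorted leq w := word_sorted _ _.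
have valw (h : OQSym k) : OQSym_in_A h w = h@_a.
  rewrite /OQSym_in_A [in RHS](monalgE h) raddf_sum /=; apply: eq_bigr => b _.
  rewrite /M_series w_s word_runs mcoeffU (inj_eq nats_inj) eq_sym.
  by rewrite mulr_natr.
have sumw (h : OQSym k) : \sum_(u <- permutations w)
    (-1) ^+ word_inv u * OQSym_in_A h u = (-1) ^+ word_inv w * h@_a.
  rewrite (bigD1_seq w) ?permutations_uniq ?mem_permutations //= valw.
  rewrite big1_seq ?addr0 // => u /andP[uw]; rewrite mem_permutations => pw.
  rewrite /OQSym_in_A big1 ?mulr0 // => b _; rewrite /M_series.
  case: (boolP (sorted leq u)) => [us|_]; last by rewrite mulr0.
  by rewrite (sorted_eq leq_trans anti_leq us w_s pw) eqxx in uw.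
by have := fg w w_s; rewrite !sumw => /(can_inj (signrMK _)).
Qed.

Definition odd_schur (k : comNzRingType) (a : composition) : OQSym k :=
  (-1) ^+ NE (sorted_parts a) *:
  \sum_(T <- SYCT a) (-1) ^+ inv_comp T *: oqF k (descent_composition T).

Definition dual_to_odd_schur (k : comNzRingType) (Sstar : composition -> NSym k) : Prop :=
  forall a b : composition, pairing (odd_schur k a) (Sstar b) = (a == b)%:R.

Definition OC (k : comNzRingType) (a b c : composition) : k :=
  let R := rho (row_filling (nats b)) in
  \sum_(S <- SYT (sorted_parts c) (sorted_parts a)
        | [&& Lle (nats a) (nats c), shape (rho_inv (nats a) S) == nats c
            & rect S == R])
    (-1) ^+ (inv_tab (extend (sorted_parts a) S) + inv_tab R).

(* Main.v *)
From HB Require Import structures.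
Require Import Defs.
From mathcomp Require Import all_boot all_order all_algebra finmap zify.

Set Implicit Arguments.
Unset Strict Implicit.
Unset Printing Implicit Defensive.

Import GRing.Theory.

(** * P1 *)

Definition mult (x : nat) (z : seq nat) : nat := count_mem x z.

Lemma mult_cons x c z : mult x (c :: z) = (c == x) + mult x z.
Proof. by []. Qed.

Lemma mult_cat x z z' : mult x (z ++ z') = mult x z + mult x z'.
Proof. exact: count_cat. Qed.

Lemma mult_perm x z z' : perm_eq z z' -> mult x z = mult x z'.
Proof. by move/permP; apply. Qed.

Definition addable (z : seq nat) (c : nat) : bool :=
  (c == 0) || (mult c z < mult c.-1 z).

Fixpoint lat (z w : seq nat) : bool :=
  if w is c :: w' then addable z c && lat (c :: z) w' else true.

Definition ptn (z : seq nat) : Prop :=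
  forall x, mult x.+1 z <= mult x z.

Lemma addable_perm z z' c : perm_eq z z' -> addable z c = addable z' c.
Proof. by move=> pz; rewrite /addable !(mult_perm _ pz). Qed.

Lemma lat_perm z z' w : perm_eq z z' -> lat z w = lat z' w.
Proof.
elim: w z z' => //= c w IHw z z' pz; rewrite (addable_perm _ pz).
by rewrite (IHw _ (c :: z')) ?perm_cons.
Qed.

Lemma ptn_perm z z' : perm_eq z z' -> ptn z -> ptn z'.
Proof. by move=> pz hz x; rewrite -!(mult_perm _ pz). Qed.

Lemma perm_swap2 (c d : nat) z : perm_eq [:: c, d & z] [:: d, c & z].
Proof. exact: (permEl (perm_catCA [:: c] [:: d] z)). Qed.

Lemma perm_catr_cons u (c : nat) z : perm_eq (u ++ c :: z) (c :: u ++ z).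
Proof. by rewrite -cat1s -[_ :: _ ++ _]cat1s perm_catCA. Qed.

Lemma lat_cat z u w : lat z (u ++ w) = lat z u && lat (u ++ z) w.
Proof.
elim: u z => //= c u IHu z; rewrite IHu andbA.
by rewrite (lat_perm _ (perm_catr_cons u c z)).
Qed.

Lemma ptn_nil : ptn [::]. Proof. by []. Qed.

Lemma ptn_cons z c : ptn z -> addable z c -> ptn (c :: z).
Proof.
move=> hz; rewrite /addable => hc x; rewrite !mult_cons; have := hz x.
by case: c hc => [|c] /= hc; [|case: (eqVneq c x) hc => [->|]]; lia.
Qed.

Lemma ptn_lat z w : ptn z -> lat z w -> ptn (w ++ z).
Proof.
elim: w z => //= c w IHw z hz /andP[hc hw].
apply: (ptn_perm (perm_catr_cons w c z)).
by apply: IHw => //; apply: ptn_cons.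
Qed.

Definition sw (z : seq nat) (c d : nat) : nat * nat :=
  if (c != d) && addable z d then (d, c) else (c, d).

Fixpoint push (z : seq nat) (c : nat) (w : seq nat) : seq nat * nat :=
  if w is d :: w' then
    let p := sw z c d in
    let r := push (p.1 :: z) p.2 w' in (p.1 :: r.1, r.2)
  else ([::], c).

Fixpoint rpass (z u : seq nat) (q : nat) : nat * seq nat :=
  if u is c :: u' then
    let r := rpass (c :: z) u' q in
    let p := sw z c r.1 in (p.1, p.2 :: r.2)
  else (q, [::]).

Fixpoint switch (z u w : seq nat) : seq nat * seq nat :=
  if u is c :: u' then
    let r := switch (c :: z) u' w in
    let p := push z c r.1 in (p.1, p.2 :: r.2)
  else (w, [::]).

Lemma sw_perm z z' c d : perm_eq z z' -> sw z c d = sw z' c d.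
Proof. by move=> pz; rewrite /sw (addable_perm _ pz). Qed.

Lemma push_perm z z' c w : perm_eq z z' -> push z c w = push z' c w.
Proof.
elim: w z z' c => //= d w IHw z z' c pz; rewrite (sw_perm _ _ pz).
by rewrite (IHw _ ((sw z' c d).1 :: z')) ?perm_cons.
Qed.

Lemma rpass_perm z z' u q : perm_eq z z' -> rpass z u q = rpass z' u q.
Proof.
elim: u z z' => //= c u IHu z z' pz.
by rewrite (IHu _ (c :: z')) ?perm_cons // (sw_perm _ _ pz).
Qed.

Lemma switch_perm z z' u w : perm_eq z z' -> switch z u w = switch z' u w.
Proof.
elim: u z z' => //= c u IHu z z' pz.
by rewrite (IHu _ (c :: z')) ?perm_cons // (push_perm _ _ pz).
Qed.

Lemma sw_cases z c d :
  (sw z c d = (d, c) /\ c != d /\ addable z d) \/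
  (sw z c d = (c, d) /\ (c = d \/ ~~ addable z d)).
Proof.
rewrite /sw; case: (eqVneq c d) => [->|ne] /=; first by right; split=> //; left.
by case: ifP => hd; [left | right; split=> //; right].
Qed.

Lemma sw_state z c d : perm_eq [:: (sw z c d).2, (sw z c d).1 & z] [:: d, c & z].
Proof.
by case: (sw_cases z c d) => [[-> _]|[-> _]] //=; rewrite perm_swap2.
Qed.

Lemma switch_consr z u q w :
  switch z u (q :: w) =
  let r := rpass z u q in
  let r' := switch (r.1 :: z) r.2 w in (r.1 :: r'.1, r'.2).
Proof.
elim: u z => //= c u IHu z; rewrite IHu /=.
set r0 := rpass (c :: z) u q; set p0 := sw z c r0.1.
by rewrite (switch_perm _ _ (sw_state z c r0.1)).
Qed.

Lemma switch_rcons z u c w :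
  switch z (rcons u c) w =
  let p := push (u ++ z) c w in
  let r := switch z u p.1 in (r.1, rcons r.2 p.2).
Proof.
elim: u z => //= d u IHu z; rewrite IHu /=.
by rewrite (push_perm _ _ (perm_catr_cons u d z)).
Qed.

Lemma sw_lat z c d : lat z [:: c; d] -> lat z [:: (sw z c d).1; (sw z c d).2].
Proof.
case: (sw_cases z c d) => [[-> [/= ne hd]]|[-> _]] //=.
rewrite hd /= !andbT => /andP[hc _].
by move: hc ne; rewrite /addable !mult_cons => hc ne; lia.
Qed.

Lemma push_lat z c w :
  lat z (c :: w) -> lat z (rcons (push z c w).1 (push z c w).2).
Proof.
elim: w z c => //= d w IHw z c /and3P[hc hd hw].
have /andP[h1 /andP[h2 _]] : lat z [:: (sw z c d).1; (sw z c d).2].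
  by apply: sw_lat; rewrite /= hc hd.
rewrite h1 /=; apply: IHw => /=; rewrite h2 /=.
by rewrite (lat_perm _ (sw_state z c d)).
Qed.

Lemma push_content z c w :
  perm_eq (rcons (push z c w).1 (push z c w).2) (c :: w).
Proof.
elim: w z c => //= d w IHw z c.
set p := sw z c d.
apply: (@perm_trans _ (p.1 :: p.2 :: w)); first by rewrite perm_cons IHw.
rewrite -[[:: p.1, p.2 & w]]/([:: p.1; p.2] ++ w) -[[:: c, d & w]]/([:: c; d] ++ w).
rewrite perm_cat2r; case: (sw_cases z c d) => [[h _]|[h _]]; rewrite /p h //.
exact: (perm_swap2 d c [::]).
Qed.

Lemma push_size z c w : size (push z c w).1 = size w.
Proof. by have /perm_size := push_content z c w; rewrite size_rcons => -[]. Qed.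

Lemma rpass_lat z u q :
  lat z (rcons u q) -> lat z ((rpass z u q).1 :: (rpass z u q).2).
Proof.
elim: u z => //= c u IHu z /andP[hc /IHu /= /andP[hq hu]].
set r := rpass (c :: z) u q in hq hu *.
have := @sw_lat z c r.1; rewrite /= hc hq => /(_ isT) /and3P[-> -> _].
by rewrite (lat_perm _ (sw_state z c r.1)).
Qed.

Lemma rpass_content z u q :
  perm_eq ((rpass z u q).1 :: (rpass z u q).2) (rcons u q).
Proof.
elim: u z => //= c u IHu z; set r := rpass (c :: z) u q.
apply: (@perm_trans _ (c :: r.1 :: r.2)); last by rewrite perm_cons IHu.
case: (sw_cases z c r.1) => [[-> _]|[-> _]] //=.
exact: perm_swap2.
Qed.

Lemma switch_lat z u w :
  lat z (u ++ w) -> lat z ((switch z u w).1 ++ (switch z u w).2).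
Proof.
elim: u z => /= [|c u IHu] z; first by rewrite cats0.
case/andP=> hc /IHu; set r := switch (c :: z) u w => h.
move: h; rewrite lat_cat => /andP[h1 h2].
have := @push_lat z c r.1; rewrite /= hc h1 => /(_ isT).
set p := push z c r.1 => hp.
rewrite -cat_rcons lat_cat hp /=.
rewrite (lat_perm _ (_ : perm_eq _ (r.1 ++ c :: z))) //.
rewrite perm_sym (perm_trans (perm_catr_cons _ _ _)) // perm_sym.
by rewrite -cat_cons perm_cat2r push_content.
Qed.

Lemma switch_content z u w :
  perm_eq ((switch z u w).1 ++ (switch z u w).2) (u ++ w).
Proof.
elim: u z => /= [|c u IHu] z; first by rewrite cats0.
set r := switch (c :: z) u w; rewrite -cat_rcons.
apply: (@perm_trans _ ((c :: r.1) ++ r.2)).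
  by rewrite perm_cat2r push_content.
by rewrite /= perm_cons IHu.
Qed.

Lemma switch_size z u w :
  (size (switch z u w).1 = size w) * (size (switch z u w).2 = size u).
Proof.
elim: u z => //= c u IHu z.
by rewrite push_size !(IHu (c :: z)).
Qed.

Lemma sw_invol z c d : lat z [:: c; d] -> sw z (sw z c d).1 (sw z c d).2 = (c, d).
Proof.
case: (sw_cases z c d) => [[-> [ne hd]]|[h _]] /=; last by rewrite h.
by case/and3P=> hc _ _; rewrite /sw eq_sym ne hc.
Qed.

Lemma rpass_push z u q :
  lat z (rcons u q) -> push z (rpass z u q).1 (rpass z u q).2 = (u, q).
Proof.
elim: u z => //= c u IHu z /andP[hc hu].
set r := rpass (c :: z) u q.
have /= /andP[hr _] := rpass_lat hu.
by rewrite sw_invol /= ?hc ?hr // IHu.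
Qed.

Lemma switch_nilr z u : switch z u [::] = ([::], u).
Proof. by elim: u z => //= c u IHu z; rewrite IHu. Qed.

Lemma switch_invol z u w :
  lat z (u ++ w) -> switch z (switch z u w).1 (switch z u w).2 = (u, w).
Proof.
elim: w z u => [|q w IHw] z u.
  by rewrite switch_nilr.
rewrite -cat_rcons lat_cat => /andP[hu hw].
rewrite switch_consr /=; set r := rpass z u q.
have hr : lat (r.1 :: z) (r.2 ++ w).
  have := rpass_lat hu; rewrite -/r lat_cat /= => /andP[_ ->] /=.
  rewrite -(lat_perm _ (_ : perm_eq (rcons u q ++ z) _)) //.
  rewrite perm_sym (perm_trans (perm_catr_cons _ _ _)) //.
  by rewrite -cat_cons perm_cat2r rpass_content.
by rewrite IHw //= rpass_push.
Qed.

(** * P2 *)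

Variant sw_spec z c d : nat * nat -> Prop :=
| SwFree of c <> d & addable z d : sw_spec z c d (d, c)
| SwCol of d = c : sw_spec z c d (c, d)
| SwRow of d = c.+1 & mult c.+1 z = mult c z : sw_spec z c d (c, d).

Lemma swP z c d : ptn z -> lat z [:: c; d] -> sw_spec z c d (sw z c d).
Proof.
move=> hz /and3P[_ hd _]; have [[-> [/eqP ne a]]|[-> h]] := sw_cases z c d.
  exact: SwFree.
case: (eqVneq d c) h => [->|ne] h; first exact: SwCol.
have {h} : ~~ addable z d by case: h => // h; rewrite h eqxx in ne.
move: hd; rewrite /addable !mult_cons => hd nd.
have e : d = c.+1 by case: (eqVneq c d.-1) hd nd ne => [->|]; lia.
apply: SwRow => //; rewrite e /= in hd nd.
by have := hz c; lia.
Qed.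

Lemma ptn_lat_cons z c w : ptn z -> lat z (c :: w) -> ptn (c :: z).
Proof. by move=> hz /andP[hc _]; apply: ptn_cons. Qed.

Lemma ptn_mono z c d : ptn z -> c <= d -> mult d z <= mult c z.
Proof.
move=> hz; elim: d => [|d IHd]; first by rewrite leqn0 => /eqP->.
rewrite leq_eqVlt => /orP[/eqP->//|/IHd]; apply: leq_trans; exact: hz.
Qed.

Definition content (z : seq nat) (c : nat) : int := (c%:Z - (mult c z)%:Z)%R.

Fixpoint contents (z w : seq nat) : seq int :=
  if w is c :: w' then content z c :: contents (c :: z) w' else [::].

Lemma content_inj z c d : ptn z -> content z c = content z d -> c = d.
Proof.
move=> hz; rewrite /content.
by case: (ltngtP c d) => // h; have := ptn_mono hz (ltnW h); lia.
Qed.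

Lemma contents_inj z w w' : ptn z -> lat z w -> lat z w' ->
  contents z w = contents z w' -> w = w'.
Proof.
elim: w z w' => [|c w IHw] z [|d w'] //= hz /andP[hc hw] /andP[hd hw'] [e1 e2].
have e := content_inj hz e1; rewrite -{}e in hd hw' e2 *.
by rewrite (IHw _ _ _ hw hw' e2) //; apply: ptn_cons.
Qed.

Lemma content_perm z z' c : perm_eq z z' -> content z c = content z' c.
Proof. by move=> pz; rewrite /content (mult_perm _ pz). Qed.

Lemma contents_perm z z' w : perm_eq z z' -> contents z w = contents z' w.
Proof.
elim: w z z' => //= c w IHw z z' pz; rewrite (content_perm _ pz).
by rewrite (IHw _ (c :: z')) ?perm_cons.
Qed.

Local Open Scope ring_scope.

Definition near (e f : int) : bool := `|e - f| <= 1.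

Definition csw (e f : int) : int * int := if near e f then (e, f) else (f, e).

Fixpoint crpass (u : seq int) (q : int) : int * seq int :=
  if u is c :: u' then
    let r := crpass u' q in let p := csw c r.1 in (p.1, p.2 :: r.2)
  else (q, [::]).

Lemma far_content z c d : ptn z -> addable z c -> addable z d -> c <> d ->
  ~~ near (content z c) (content (c :: z) d).
Proof.
move=> hz hc hd ne; rewrite /near /content !mult_cons.
have [h1|h2] : (c < d)%N \/ (d < c)%N by lia.
  have := ptn_mono hz (ltnW h1); move: hd {hc}; rewrite /addable.
  by case: (eqVneq c d.-1) => [->|]; lia.
have := ptn_mono hz (ltnW h2); move: hc {hd}; rewrite /addable.
by case: (eqVneq d c.-1) => [->|]; lia.
Qed.

Lemma sw_content z c d : ptn z -> lat z [:: c; d] ->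
  let p := sw z c d in
  csw (content z c) (content (c :: z) d) = (content z p.1, content (p.1 :: z) p.2).
Proof.
move=> hz h; have /and3P[hc hd _] := h; rewrite /csw.
case: (swP hz h) => /= [ne ad|->|-> e].
- rewrite (negbTE (far_content hz hc ad ne)).
  by rewrite /content !mult_cons; congr (_, _); lia.
- by rewrite ifT // /near /content !mult_cons; lia.
- by rewrite ifT // /near /content !mult_cons; lia.
Qed.

Lemma rpass_contents z u q : ptn z -> lat z (rcons u q) ->
  let r := rpass z u q in
  crpass (contents z u) (content (u ++ z) q) =
  (content z r.1, contents (r.1 :: z) r.2).
Proof.
elim: u z => //= c u IHu z hz /andP[hc hu].
rewrite -(content_perm _ (perm_catr_cons u c z)) IHu //; last exact: ptn_cons.
have /= /andP[hr _] := rpass_lat hu.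
rewrite /= -/(csw _ _) sw_content //= ?hc ?hr //.
by rewrite (contents_perm _ (sw_state z c _)).
Qed.

Definition between (a x b : int) : bool := (a < x < b) || (b < x < a).

Definition knuth (s t : seq int) : bool :=
  match s, t with
  | [:: e1; e2; e3], [:: f1; f2; f3] =>
    [&& f1 == e1, f2 == e3, f3 == e2 & between e2 e1 e3] ||
    [&& f1 == e2, f2 == e1, f3 == e3 & between e1 e3 e2]
  | _, _ => false
  end.

Lemma contents_neq2 z c d : ptn z -> lat z [:: c; d] ->
  content (c :: z) d <> content z c.
Proof.
move=> hz h; have /and3P[hc hd _] := h.
case: (swP hz h) => /= [ne ad|->|-> e].
- have := far_content hz hc ad ne; rewrite /near; lia.
- rewrite /content !mult_cons; lia.
- rewrite /content !mult_cons; lia.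
Qed.

Lemma contents_neq3 z c d e : ptn z -> lat z [:: c; d; e] ->
  content [:: d, c & z] e <> content z c.
Proof.
move=> hz h E.
have h1 : lat z [:: c; d] by move: h; rewrite /= => /and4P[-> -> _ _].
have h2 : lat (c :: z) [:: d; e] by case/andP: h.
have hz1 := ptn_lat_cons hz h.
have /and3P[hc hd _] := h1.
case: (swP hz1 h2) => /= [ne ad|ee|ee em].
- have h3 : lat z [:: c; e] by move: h1 => /=; rewrite ad !andbT => /andP[].
  have := contents_neq2 hz h3; rewrite -E /content !mult_cons; lia.
- have /and3P[_ he _] := h2; move: E he; rewrite ee.
  case: (swP hz h1) => [ne ad|->|-> em].
  + have := far_content hz hc ad ne; rewrite /near /content !mult_cons; lia.
  + rewrite /content !mult_cons; lia.
  + by rewrite /addable !mult_cons /=; lia.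
- move: E em; rewrite ee.
  case: (swP hz h1) => [ne ad|->|-> em].
  + have := far_content hz hc ad ne; rewrite /near /content !mult_cons; lia.
  + by rewrite /content !mult_cons; have := hz c; lia.
  + by rewrite /content !mult_cons; lia.
Qed.

Ltac near_lia := repeat match goal with H : is_true _ |- _ => move: H | H : _ = _ |- _ => move: H | H : _ <> _ |- _ => move: H end; rewrite /near /between; clear; lia.
Ltac local_check := first
  [ by split => //; left
  | by split => //; right; apply/orP; left; rewrite !eqxx /=; near_lia
  | by split => //; right; apply/orP; right; rewrite !eqxx /=; near_lia
  | exfalso; near_lia ].

Lemma crpass_knuth_before x a b q : between a x b -> q <> a -> q <> b ->
  ~~ ((q == x) && ~~ (near x a && near x b)) ->
  let r := crpass [:: x; a; b] q in let r' := crpass [:: x; b; a] q in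
  r.1 = r'.1 /\ (r.2 = r'.2 \/ knuth r.2 r'.2).
Proof.
rewrite /between => h1 h2 h3 h4.
have ab : near a b = false by rewrite /near; lia.
have ba : near b a = false by rewrite /near; lia.
case bq : (near b q); case aq : (near a q); case xq : (near x q);
case xa : (near x a); case xb : (near x b).
all: rewrite /= /csw; do 3 rewrite ?(ab, ba, bq, aq, xq, xa, xb) /=.
all: local_check.
Qed.

Lemma crpass_knuth_after x a b q : between a x b -> q <> a -> q <> b -> q <> x ->
  let r := crpass [:: a; b; x] q in let r' := crpass [:: b; a; x] q in
  r.1 = r'.1 /\ (r.2 = r'.2 \/ knuth r.2 r'.2).
Proof.
rewrite /between => h1 h2 h3 h4.
have ab : near a b = false by rewrite /near; lia.
have ba : near b a = false by rewrite /near; lia.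
have sym e f : near e f = near f e by rewrite /near; lia.
case bq : (near b q); case aq : (near a q); case xq : (near x q);
case xa : (near x a); case xb : (near x b).
all: rewrite /= /csw; do 3 rewrite ?(ab, ba, bq, aq, xq, xa, xb, sym a x, sym b x) /=.
all: local_check.
Qed.

Local Close Scope ring_scope.
(** * P3 *)

Lemma contents_four z c1 c2 c3 q (e := content ([:: c1; c2; c3] ++ z) q) :
  ptn z -> lat z [:: c1; c2; c3; q] ->
  [/\ e <> content [:: c2, c1 & z] c3, e <> content (c1 :: z) c2 &
      e = content z c1 -> near (content z c1) (content [:: c2, c1 & z] c3)].
Proof.
move=> hz h.
have h1 : lat (c1 :: z) [:: c2; c3; q] by case/andP: h.
have h2 : lat [:: c2, c1 & z] [:: c3; q] by case/andP: h1.
have ee : e = content [:: c3, c2, c1 & z] q.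
  apply: content_perm; rewrite -[_ :: _ :: _ :: z]/(rev [:: c1; c2; c3] ++ z).
  by rewrite perm_cat2r perm_sym perm_rev.
have hz1 := ptn_lat_cons hz h; have hz2 := ptn_lat_cons hz1 h1.
rewrite {}ee {e}; set e := content _ q.
split; [exact: contents_neq2 | exact: contents_neq3 | move=> ee].
apply/negPn/negP => far; have := sw_content hz2 h2.
rewrite -/e /csw ee ifN; last by move: far; rewrite /near; lia.
set p := sw _ _ _ => -[e1 _]; apply: (@contents_neq3 z c1 c2 p.1) => //.
have /and3P[hp _ _] := sw_lat h2; rewrite -/p in hp.
by move: h; rewrite /= hp => /and3P[-> -> _].
Qed.

Lemma rpass_knuth z t t' q : ptn z -> lat z (rcons t q) -> lat z (rcons t' q) ->
  perm_eq t t' -> knuth (contents z t) (contents z t') ->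
  let r := rpass z t q in let r' := rpass z t' q in
  r.1 = r'.1 /\
  (r.2 = r'.2 \/ knuth (contents (r.1 :: z) r.2) (contents (r'.1 :: z) r'.2)).
Proof.
move=> hz ht ht' pt k /=.
have := rpass_contents hz ht; have := rpass_contents hz ht'.
rewrite -(content_perm q (_ : perm_eq (t ++ z) (t' ++ z))) ?perm_cat2r //=.
have /= /andP[ha hl] := rpass_lat ht; have /= /andP[ha' hl'] := rpass_lat ht'.
set r := rpass z t q; set r' := rpass z t' q; set e := content _ q => E' E.
have step : (crpass (contents z t) e).1 = (crpass (contents z t') e).1 /\
   ((crpass (contents z t) e).2 = (crpass (contents z t') e).2 \/
    knuth (crpass (contents z t) e).2 (crpass (contents z t') e).2).
  have e' : e = content (t' ++ z) q by apply: content_perm; rewrite perm_cat2r.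
  move: t t' ht ht' pt @e e' k {r r' hl hl' ha ha' E E'}.
  case=> [|c1 [|c2 [|c3 [|? ?]]]] [|d1 [|d2 [|d3 [|? ?]]]] // ht ht' pt e e'.
  have [] := contents_four hz ht; have [] := contents_four hz ht'.
  rewrite -e' -/e.
  rewrite /knuth [contents _ _]/= [contents z [:: d1; _; _]]/=.
  move: (content z c1) (content (c1 :: z) c2) (content _ c3) => x1 x2 x3.
  move: (content z d1) (content (d1 :: z) d2) (content _ d3) => y1 y2 y3.
  move=> n1 n2 n3 m1 m2 m3 /orP[]/and4P[/eqP ? /eqP ? /eqP ? bt]; subst.
    apply: crpass_knuth_before => //.
    by apply/negP => /andP[/eqP ee]; rewrite n3 ?m3.
  exact: crpass_knuth_after.
move: step; rewrite E E' /= => -[/(content_inj hz) ee h]; split => //.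
case: h => h; [left|by right].
by apply: (contents_inj _ hl); rewrite ?h ?ee //; apply: ptn_cons.
Qed.

Inductive knuth_step (z : seq nat) : seq nat -> seq nat -> Prop :=
  KnuthStep l t t' r of lat z (l ++ t ++ r) & lat z (l ++ t' ++ r) &
    perm_eq t t' & knuth (contents (l ++ z) t) (contents (l ++ z) t') :
    knuth_step z (l ++ t ++ r) (l ++ t' ++ r).

Inductive keq (z : seq nat) : seq nat -> seq nat -> Prop :=
| KeqRefl u : keq z u u
| KeqStep u v w : knuth_step z u v -> keq z v w -> keq z u w.

Lemma keq_trans z u v w : keq z u v -> keq z v w -> keq z u w.
Proof. by elim=> // u1 u2 u3 h _ IH /IH; apply: KeqStep h. Qed.

Lemma knuth_step_perm z u u' : knuth_step z u u' -> perm_eq u u'.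
Proof. by case=> l t t' r _ _ pt _; rewrite perm_cat2l perm_cat2r. Qed.

Lemma knuth_step_lat z u u' : knuth_step z u u' -> lat z u'.
Proof. by case. Qed.

Lemma rpass_cat z u v q :
  rpass z (u ++ v) q =
  let r := rpass (u ++ z) v q in let s := rpass z u r.1 in (s.1, s.2 ++ r.2).
Proof.
elim: u z => [|c u IHu] z /=; first by case: rpass.
by rewrite IHu /= (rpass_perm _ _ (perm_catr_cons u c z)).
Qed.

Lemma lat_rcons z u q : lat z (rcons u q) = lat z u && addable (u ++ z) q.
Proof. by rewrite -cats1 lat_cat /= andbT. Qed.

Lemma rpass_state z u q :
  perm_eq ((rpass z u q).2 ++ (rpass z u q).1 :: z) (q :: u ++ z).
Proof.
rewrite (perm_trans (perm_catr_cons _ _ _)) // -!cat_cons perm_cat2r.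
by rewrite (perm_trans (rpass_content _ _ _)) // perm_rcons.
Qed.

Lemma knuth_step_rcons z u u' q :
  knuth_step z u u' -> lat z (rcons u q) -> lat z (rcons u' q).
Proof.
move=> st; rewrite !lat_rcons (knuth_step_lat st) => /andP[_].
by rewrite (addable_perm _ (_ : perm_eq _ (u' ++ z))) // perm_cat2r (knuth_step_perm st).
Qed.

Lemma rpass_knuth_step z u u' q : ptn z -> knuth_step z u u' ->
  lat z (rcons u q) ->
  let r := rpass z u q in let r' := rpass z u' q in
  r.1 = r'.1 /\ (r.2 = r'.2 \/ knuth_step (r.1 :: z) r.2 r'.2).
Proof.
move=> hz st hq; have hq' := knuth_step_rcons st hq.
have := rpass_lat hq; have := rpass_lat hq'.
case: st hq hq' => l t t' r _ _ pt k hq hq' /=.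
move: hq hq'; rewrite !rpass_cat /=.
have pt' : perm_eq (t ++ l ++ z) (t' ++ l ++ z) by rewrite perm_cat2r.
rewrite -(rpass_perm r q pt') -!cats1 -!catA.
set R := rpass _ r q => hq hq'.
have lR : lat (t ++ l ++ z) (R.1 :: R.2).
  by apply: rpass_lat; move: hq; rewrite -cats1 2!lat_cat => /and3P[].
have latR (s : seq nat) : lat z (l ++ s ++ r ++ [:: q]) ->
    perm_eq t s -> lat (l ++ z) (rcons s R.1).
  rewrite 2!lat_cat => /and3P[_ hs _] ps; rewrite lat_rcons hs.
  rewrite -(addable_perm _ (_ : perm_eq (t ++ l ++ z) _)) ?perm_cat2r //.
  by case/andP: lR.
have hzl : ptn (l ++ z).
  by apply: ptn_lat => //; move: hq; rewrite lat_cat => /andP[].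
have [e h] := rpass_knuth hzl (latR _ hq (perm_refl _)) (latR _ hq' pt) pt k.
rewrite -e; set T := rpass (l ++ z) t R.1 in e h *.
set T' := rpass (l ++ z) t' R.1 in e h *.
set L := rpass z l T.1 => /andP[_ lr'] /andP[_ lr].
split=> //; case: h => h; [by left; rewrite h | right].
apply: KnuthStep => //.
  have := rpass_content (l ++ z) t R.1; have := rpass_content (l ++ z) t' R.1.
  rewrite -/T -/T' -e => c' c.
  rewrite -(perm_cons T.1) (perm_trans c) // perm_sym (perm_trans c') //.
  by rewrite -!cats1 perm_cat2r perm_sym.
have pL : perm_eq (T.1 :: l ++ z) (L.2 ++ L.1 :: z).
  by rewrite perm_sym rpass_state.
by rewrite -!(contents_perm _ pL) {2}e.
Qed.

Lemma rpass_keq z u u' q : ptn z -> keq z u u' -> lat z (rcons u q) ->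
  let r := rpass z u q in let r' := rpass z u' q in
  r.1 = r'.1 /\ keq (r.1 :: z) r.2 r'.2.
Proof.
move=> hz; elim=> {u u'} [u|u v w st _ IH] hq; first by split=> //; left.
have [/= e1 h] := rpass_knuth_step hz st hq.
have [/= e2 k] := IH (knuth_step_rcons st hq).
rewrite -e2 -e1; split=> //; rewrite -e1 in k.
by case: h => [->//|h]; apply: KeqStep h k.
Qed.

Lemma switch_keq z u u' w : ptn z -> keq z u u' -> lat z (u ++ w) ->
  (switch z u w).1 = (switch z u' w).1.
Proof.
elim: w z u u' => [|q w IHw] z u u' hz k.
  by rewrite !switch_nilr.
rewrite -cat_rcons lat_cat => /andP[hu hw]; rewrite !switch_consr /=.
have [<- k'] := rpass_keq hz k hu; congr (_ :: _).
set r := rpass z u q; have h : lat z (r.1 :: r.2) := rpass_lat hu.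
have h1 : addable z r.1 by case/andP: h.
have h2 : lat (r.1 :: z) r.2 by case/andP: h.
apply: IHw k' _; first exact: ptn_cons.
rewrite lat_cat h2 /= (lat_perm _ (rpass_state z u q)).
move: hw; rewrite (lat_perm _ (_ : perm_eq _ (q :: u ++ z))) //.
by rewrite -cat_cons perm_cat2r perm_rcons.
Qed.

(* connectivity *)

Lemma keq_rcons z u u' q : keq z u u' -> lat z (rcons u q) ->
  keq z (rcons u q) (rcons u' q).
Proof.
elim=> {u u'} [u|u v w st _ IH] hq; first exact: KeqRefl.
have hv := knuth_step_rcons st hq; apply: KeqStep (IH hv).
case: st hq hv => l t t' r _ _ pt k; rewrite -!cats1 -!catA => hq hv.
exact: KnuthStep.
Qed.

Lemma mult_rem x c z : c \in z -> mult x (rem c z) = mult x z - (c == x).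
Proof.
by move=> cz; rewrite (mult_perm x (perm_to_rem cz)) mult_cons addKn.
Qed.

Lemma mult_gt0 x z : (0 < mult x z) = (x \in z).
Proof. by rewrite /mult -has_count has_pred1. Qed.

Lemma ptn_rem c z : ptn z -> mult c.+1 z < mult c z ->
  ptn (rem c z) /\ addable (rem c z) c.
Proof.
move=> hz hc; have cz : c \in z by rewrite -mult_gt0; lia.
split=> [x|]; rewrite /addable ?mult_rem //.
  by have := hz x; case: (c =P x) => [e|_]; case: (c =P x.+1) => [e'|_]; subst; lia.
by case: c hc cz => //= c hc cz; have := hz c; lia.
Qed.

Lemma exists_lat z : ptn z -> exists2 V, lat [::] V & perm_eq V z.
Proof.
elim: {z}(size z) {-2}z (erefl (size z)) => [|n IHn] z sz hz.
  by exists [::] => //; rewrite (size0nil sz).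
have [c cz hc] : exists2 c, c \in z & mult c.+1 z < mult c z.
  have : 0 < mult 0 z.
    case: z sz hz => // c z _ hz.
    by apply: leq_trans (ptn_mono hz (leq0n c)); rewrite mult_gt0 mem_head.
  have [N hN] : exists N, mult N z = 0.
    exists (\max_(i <- z) i).+1; apply/eqP; rewrite -leqn0 leqNgt mult_gt0.
    by apply/negP => h; have := @leq_bigmax_seq _ z xpredT id _ h isT; rewrite ltnn.
  elim: N hN => [|N IHN] hN h0; first lia.
  have [h|h] := posnP (mult N z); first exact: IHN.
  by exists N; [rewrite -mult_gt0 | rewrite hN].
have [hz' ha] := ptn_rem hz hc.
have [|V hV pV] := IHn (rem c z) _ hz'; first by rewrite size_rem // sz.
exists (rcons V c).
  by rewrite lat_rcons hV cats0 (addable_perm _ pV).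
by rewrite perm_rcons perm_sym (perm_trans (perm_to_rem cz)) // perm_cons perm_sym.
Qed.

Lemma lat_last_corner U c : lat [::] (rcons U c) ->
  mult c.+1 (rcons U c) < mult c (rcons U c).
Proof.
rewrite lat_rcons => /andP[hU _]; have hz := ptn_lat ptn_nil hU.
rewrite -cats1 !mult_cat !mult_cons cats0 in hz *; have := hz c; rewrite /mult /=; lia.
Qed.

Lemma corner_between f p p' : p < p' -> f p' < f p ->
  exists x, [/\ p <= x, x < p' & f x.+1 < f x].
Proof.
move=> pp'; rewrite -(subnKC (ltnW pp')); elim: (p' - p) => [|n IHn] h.
  by move: h; rewrite addn0 ltnn.
have [h1|h1] := ltnP (f (p + n)) (f p).
  by have [x [h2 h3 h4]] := IHn h1; exists x; split=> //; lia.
by exists (p + n); split; rewrite ?addnS -?addnS; lia.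
Qed.

Lemma perm_cat_rev3 V (x y t : nat) : perm_eq (V ++ [:: x; y; t]) [:: t, y, x & V].
Proof.
rewrite perm_catC -[[:: t, y, x & V]]/(rev [:: x; y; t] ++ V) perm_cat2r.
by rewrite perm_sym perm_rev.
Qed.

Theorem keq_straight u u' :
  lat [::] u -> lat [::] u' -> perm_eq u u' -> keq [::] u u'.
Proof.
elim: {u}(size u) {-2}u (erefl (size u)) u' => [|n IHn] u su u'.
  by rewrite (size0nil su) perm_sym => _ _ /perm_nilP->; left.
case/lastP: u su => // u p'; rewrite size_rcons => -[su].
case/lastP: u' => [|u' p] hu hu' pu; first by have := perm_size pu; rewrite size_rcons.
have [hU _] : lat [::] u /\ True by move: hu; rewrite lat_rcons => /andP[].
have hU' : lat [::] u' by move: hu'; rewrite lat_rcons => /andP[].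
case: (eqVneq p p') => [e|ne].
  rewrite {}e in hu' pu *; apply: keq_rcons => //; apply: IHn => //.
  by move: pu; rewrite -!cats1 perm_cat2r.
set nu := rcons u p' in pu hu *.
have hnu : ptn nu by rewrite -[nu]cats0; apply: ptn_lat.
have c' := lat_last_corner hu; have := lat_last_corner hu'.
rewrite -!(mult_perm _ pu) => c; rewrite -/nu in c'.
pose lo := minn p p'; pose hi := maxn p p'.
have lohi : lo < hi by rewrite /lo /hi; move: ne; clear; lia.
have clo : mult lo.+1 nu < mult lo nu by rewrite /lo; case: (leqP p p').
have chi : mult hi.+1 nu < mult hi nu by rewrite /hi; case: (leqP p p').
pose nu1 := rem hi nu; have [hn1 a1] := ptn_rem hnu chi; rewrite -/nu1 in hn1 a1.
have hin : hi \in nu by rewrite -mult_gt0 (leq_ltn_trans _ chi).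
have m1 x : mult x nu1 = mult x nu - (hi == x) by rewrite mult_rem.
have clo1 : mult lo.+1 nu1 < mult lo nu1 by rewrite !m1; move: lohi clo; clear; lia.
pose nu2 := rem lo nu1; have [hn2 a2] := ptn_rem hn1 clo1; rewrite -/nu2 in hn2 a2.
have lin : lo \in nu1 by rewrite -mult_gt0 (leq_ltn_trans _ clo1).
have m2 x : mult x nu2 = mult x nu - (hi == x) - (lo == x) by rewrite mult_rem // m1.
have [x [lx xh cx]] : exists x, [/\ lo <= x, x < hi & mult x.+1 nu2 < mult x nu2].
  apply: (@corner_between (mult^~ nu2)) => //; rewrite !m2.
  by have := ptn_mono hnu lohi; move: lohi clo chi; clear; lia.
have [hn3 a3] := ptn_rem hn2 cx.
have [V hV pV] := exists_lat hn3.
have xin : x \in nu2 by rewrite -mult_gt0 (leq_ltn_trans _ cx).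
have p2 : perm_eq (x :: V) nu2.
  by rewrite perm_sym (perm_trans (perm_to_rem xin)) // perm_cons perm_sym.
have p1 : perm_eq (lo :: x :: V) nu1.
  by rewrite perm_sym (perm_trans (perm_to_rem lin)) // perm_cons perm_sym.
have p0 : perm_eq (hi :: lo :: x :: V) nu.
  by rewrite perm_sym (perm_trans (perm_to_rem hin)) // perm_cons perm_sym.
have ahi : addable nu2 hi.
  rewrite /addable !m2; have := hnu hi.-1; case: (eqVneq lo hi.-1) => [e|nlh].
    by move: e lohi clo chi; clear; case: (hi) => // k /= ->; lia.
  by move: nlh lohi clo chi; clear; case: (hi) => //= k; lia.
have alo : addable (hi :: nu2) lo.
  by move: a2; rewrite /addable !mult_cons; move: lohi; clear; lia.
pose A := V ++ [:: x; lo; hi]; pose B := V ++ [:: x; hi; lo].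
have hA : lat [::] A.
  rewrite lat_cat hV cats0 /= (addable_perm _ pV) a3.
  by rewrite (addable_perm _ p2) a2 (addable_perm _ p1) a1.
have hB : lat [::] B.
  rewrite lat_cat hV cats0 /= (addable_perm _ pV) a3.
  rewrite (addable_perm _ p2) ahi (addable_perm _ (_ : perm_eq _ (hi :: nu2))) ?alo //.
  by rewrite perm_cons.
have pA : perm_eq A nu.
  by apply: perm_trans p0; apply: perm_cat_rev3.
have pB : perm_eq B nu.
  by rewrite -(permPr pA) perm_cat2l perm_cons (perm_swap2 hi lo [::]).
have kt : between (content (x :: V) lo) (content V x) (content [:: lo, x & V] hi).
  rewrite /between /content !mult_cons.
  have ptV : ptn V by apply: ptn_perm hn3; rewrite perm_sym.
  by have := ptn_mono ptV lx; have := ptn_mono ptV (ltnW xh); move: lx xh; clear; lia.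
have ehi : content (x :: V) hi = content [:: lo, x & V] hi.
  by rewrite /content !mult_cons; move: lohi; clear; lia.
have elo : content [:: hi, x & V] lo = content (x :: V) lo.
  by rewrite /content !mult_cons; move: lohi; clear; lia.
have stepAB : knuth_step [::] A B.
  apply: (@KnuthStep _ V [:: x; lo; hi] [:: x; hi; lo] [::]) => //.
    by rewrite perm_cons (perm_swap2 lo hi [::]).
  by rewrite cats0 /= ehi elo !eqxx kt.
have stepBA : knuth_step [::] B A.
  apply: (@KnuthStep _ V [:: x; hi; lo] [:: x; lo; hi] [::]) => //.
    by rewrite perm_cons (perm_swap2 hi lo [::]).
  rewrite cats0 /= ehi elo !eqxx /=; by apply/orP; left; move: kt; rewrite /between orbC.
have eA : A = rcons (V ++ [:: x; lo]) hi by rewrite /A -cats1 -catA.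
have eB : B = rcons (V ++ [:: x; hi]) lo by rewrite /B -cats1 -catA.
have join w w' q : size w = n -> lat [::] (rcons w q) -> lat [::] (rcons w' q) ->
    perm_eq (rcons w q) nu -> perm_eq (rcons w' q) nu -> keq [::] (rcons w q) (rcons w' q).
  move=> sw hw hw' pw pw'; apply: keq_rcons => //; apply: IHn => //.
  - by move: hw; rewrite lat_rcons => /andP[].
  - by move: hw'; rewrite lat_rcons => /andP[].
  by move: (pw); rewrite -(permPr pw') -!cats1 perm_cat2r.
have snu : size nu = n.+1 by rewrite size_rcons su.
have sVA : size (V ++ [:: x; hi]) = n.
  by have := perm_size pB; rewrite eB size_rcons snu => -[].
have sVB : size (V ++ [:: x; lo]) = n.
  by have := perm_size pA; rewrite eA size_rcons snu => -[].
have pu' : perm_eq (rcons u' p) nu by rewrite perm_sym.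
have [lt|lt] : p < p' \/ p' < p by move: ne; clear; lia.
- have [el eh] : lo = p /\ hi = p'.
    by split; [apply/minn_idPl | apply/maxn_idPr]; exact: ltnW.
  have enu : nu = rcons u hi by rewrite eh.
  apply: (@keq_trans _ _ A).
    by rewrite enu eA; apply: join; rewrite // -?enu -?eA.
  by apply: KeqStep stepAB _; rewrite eB el; apply: join; rewrite // -el -eB.
- have [el eh] : lo = p' /\ hi = p.
    by split; [apply/minn_idPr | apply/maxn_idPl]; exact: ltnW.
  have enu : nu = rcons u lo by rewrite el.
  apply: (@keq_trans _ _ B).
    by rewrite enu eB; apply: join; rewrite // -?enu -?eB.
  by apply: KeqStep stepBA _; rewrite eA eh; apply: join; rewrite // -eh -eA.
Qed.

(** * P4 *)

Lemma lat_cons z c w : lat z (c :: w) = addable z c && lat (c :: z) w.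
Proof. by []. Qed.

Definition weak_descents (w : seq nat) : seq bool :=
  if w is c :: w' then pairmap (fun x y => y <= x) c w' else [::].

Lemma push_descents z c w : ptn z -> lat z (c :: w) ->
  weak_descents (push z c w).1 = weak_descents w.
Proof.
elim: w z c => [|d [|e w] IHw] z c hz h //=.
have h1 : lat z [:: c; d] by move: h; rewrite /= => /and3P[-> -> _].
have h2 := sw_lat h1; have /and3P[hd' hc' _] := h2.
have hz' : ptn ((sw z c d).1 :: z) by apply: ptn_cons.
have h3 : lat ((sw z c d).1 :: z) [:: (sw z c d).2, e & w].
  rewrite lat_cons hc' (lat_perm (e :: w) (sw_state z c d)).
  by case/and3P: h.
have := IHw _ _ hz' h3; rewrite /= => ->; congr (_ :: _).
have h4 : lat ((sw z c d).1 :: z) [:: (sw z c d).2; e].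
  by move: h3; rewrite /= => /and3P[-> -> _].
case: (swP hz' h4); case: (swP hz h1) => /=; rewrite ?mult_cons.
all: move=> *; subst; try lia.
all: have := hz c; move: h; rewrite !lat_cons /addable !mult_cons /=; last lia.
Qed.

Fixpoint winv (w : seq nat) : nat :=
  if w is c :: w' then count (fun d => d < c) w' + winv w' else 0.

Definition cross (u w : seq nat) : nat :=
  \sum_(c <- u) count (fun d => d < c) w.

Lemma winv_cat u w : winv (u ++ w) = winv u + winv w + cross u w.
Proof.
rewrite /cross; elim: u => [|c u IHu] /=; first by rewrite big_nil addn0.
by rewrite big_cons IHu count_cat; lia.
Qed.

Lemma cross_perm u u' w w' : perm_eq u u' -> perm_eq w w' -> cross u w = cross u' w'.
Proof.
move=> pu /permP pw; rewrite /cross (perm_big _ pu) /=.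
by apply: eq_bigr => c _; apply: pw.
Qed.

Definition parity_at (z : seq nat) (c : nat) : bool := odd (c + mult c z).

Fixpoint word_parity (z w : seq nat) : bool :=
  if w is c :: w' then parity_at z c (+) word_parity (c :: z) w' else false.

Lemma word_parity_perm z z' w : perm_eq z z' -> word_parity z w = word_parity z' w.
Proof.
elim: w z z' => //= c w IHw z z' pz; rewrite /parity_at (mult_perm _ pz).
by rewrite (IHw _ (c :: z')) ?perm_cons.
Qed.

Lemma push_winv z c w : ptn z -> lat z (c :: w) ->
  let p := push z c w in
  odd (winv (c :: w)) (+) odd (winv (rcons p.1 p.2)) =
  odd (size w) (+) parity_at z c (+) parity_at (p.1 ++ z) p.2.
Proof.
elim: w z c => [|d w IHw] z c hz h /=; first by rewrite addbb.
have h1 : lat z [:: c; d] by move: h; rewrite /= => /and3P[-> -> _].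
have h2 := sw_lat h1; have /and3P[hd' hc' _] := h2.
set p := sw z c d in h2 hd' hc' *.
have hz' : ptn (p.1 :: z) by apply: ptn_cons.
have h3 : lat (p.1 :: z) (p.2 :: w).
  rewrite lat_cons hc' (lat_perm w (sw_state z c d)).
  by case/and3P: h.
have := IHw _ _ hz' h3; set r := push (p.1 :: z) p.2 w => /= e.
have -> : parity_at (p.1 :: r.1 ++ z) r.2 = parity_at (r.1 ++ p.1 :: z) r.2.
  by rewrite /parity_at -(mult_perm _ (perm_catr_cons _ _ _)).
have /permP cr : perm_eq (rcons r.1 r.2) (p.2 :: w) := push_content _ _ _.
rewrite cr /= !oddD; move: e; rewrite /= !oddD.
set X := parity_at _ r.2; set Y := odd (winv (rcons _ _)).
rewrite /p; case: (swP hz h1) => /= [ne ad|->|-> em].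
- have -> : parity_at (d :: z) c = parity_at z c.
    by rewrite /parity_at mult_cons; case: eqP => // e; case: ne.
  by case: (ltngtP c d) ne => // _ _ /=; move: Y X; do 2 case;
     move: (odd _) (odd _) (odd _) (odd _) (parity_at _ _); do 5 case.
- have -> : parity_at (c :: z) c = ~~ parity_at z c.
    by rewrite /parity_at mult_cons eqxx add1n addnS.
  by rewrite ltnn /=; move: Y X; do 2 case;
     move: (odd _) (odd _) (odd _) (parity_at _ _); do 4 case.
- have -> : parity_at (c :: z) c.+1 = ~~ parity_at z c.
    by rewrite /parity_at mult_cons em (_ : c == c.+1 = false) // ltn_eqF.
  by rewrite ltnNge leqnSn /=; move: Y X; do 2 case;
     move: (odd _) (odd _) (odd _) (odd _) (parity_at _ _); do 5 case.
Qed.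

Lemma switch_winv z u w : ptn z -> lat z (u ++ w) ->
  let r := switch z u w in
  odd (winv (u ++ w)) (+) odd (winv (r.1 ++ r.2)) =
  odd (size u * size w) (+) word_parity z u (+) word_parity (r.1 ++ z) r.2.
Proof.
elim: u z => [|c u IHu] z hz; first by rewrite /= cats0 addbb.
rewrite cat_cons lat_cons => /andP[hc h].
have hz1 := ptn_cons hz hc; have := IHu _ hz1 h.
have := switch_lat h; have := switch_content (c :: z) u w.
have := switch_size (c :: z) u w.
rewrite [switch z _ _]/=; set r := switch (c :: z) u w => -[s1 s2] pr lr e.
have hp : lat z (c :: r.1) by rewrite lat_cons hc; move: lr; rewrite lat_cat => /andP[].
have := push_winv hz hp; set p := push z c r.1; have := push_content z c r.1.
rewrite -/p => pp e'.
have q1 : odd (winv (c :: u ++ w)) (+) odd (winv (c :: r.1 ++ r.2)) = odd (winv (u ++ w)) (+) odd (winv (r.1 ++ r.2)).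
  rewrite /= !oddD; have /permP -> := pr.
  by rewrite addbACA addbb.
have q2 : odd (winv (c :: r.1 ++ r.2)) (+) odd (winv (p.1 ++ p.2 :: r.2)) =
   odd (winv (c :: r.1)) (+) odd (winv (rcons p.1 p.2)).
  rewrite -cat_cons -cat_rcons !winv_cat (cross_perm pp (perm_refl _)) !oddD.
  by rewrite addbACA addbb addbF addbACA addbb addbF.
have q3 : word_parity (p.1 ++ z) (p.2 :: r.2) =
  parity_at (p.1 ++ z) p.2 (+) word_parity (r.1 ++ c :: z) r.2.
  congr (_ (+) _); apply: word_parity_perm.
  rewrite perm_sym (perm_trans (perm_catr_cons _ _ _)) // -!cat_cons perm_cat2r.
  by rewrite -(permPl pp) perm_rcons.
change (odd (winv (c :: u ++ w)) (+) odd (winv (p.1 ++ p.2 :: r.2)) =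
  odd (size (c :: u) * size w) (+) word_parity z (c :: u) (+)
  word_parity (p.1 ++ z) (p.2 :: r.2)).
rewrite q3 [word_parity z _]/= mulSn oddD.
set A := odd (winv (_ :: _)); set B := odd (winv (_ ++ _)).
set C := odd (winv (c :: r.1 ++ r.2)) in q1 q2.
have -> : A (+) B = (A (+) C) (+) (C (+) B) by rewrite addbA -(addbA A) addbb addbF.
rewrite q1 q2 e e' -s1.
move: (odd _) (odd _) (parity_at _ _) (parity_at _ _) (word_parity _ _) (word_parity _ _).
by do 6 case.
Qed.

Lemma switch_descents z u w : ptn z -> lat z (u ++ w) ->
  weak_descents (switch z u w).1 = weak_descents w.
Proof.
elim: u z => //= c u IHu z hz /andP[hc h].
have hz1 := ptn_cons hz hc; rewrite push_descents ?IHu // lat_cons hc.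
by have := switch_lat h; rewrite lat_cat => /andP[].
Qed.

(** * P5 *)

Fixpoint last_index (c : nat) (s : seq nat) : nat :=
  if s is _ :: s' then if c \in s' then (last_index c s').+1 else 0 else 0.

Definition comp_row (s : seq nat) (c : nat) : nat :=
  if c == 0 then size s else last_index c s.

Definition grow (s : seq nat) (c : nat) : seq nat := incr_nth s (comp_row s c).

Definition colword (s : seq nat) : seq nat := flatten [seq iota 0 p | p <- s].

Lemma last_indexP c s : c \in s ->
  [/\ last_index c s < size s, nth 0 s (last_index c s) = c &
      forall i, last_index c s < i < size s -> nth 0 s i != c].
Proof.
elim: s => //= y s IHs; rewrite inE.
case: ifP => [cs _|/negbT cs]; last first.
  rewrite orbF => /eqP<-; split=> // -[|i] //= hi.
  by apply: contraNneq cs => <-; apply: mem_nth.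
have [h1 h2 h3] := IHs cs; split=> // -[|i] //=; exact: h3.
Qed.

Lemma grow0 s : grow s 0 = rcons s 1.
Proof. by rewrite /grow /comp_row /=; elim: s => //= y s ->. Qed.

Lemma grow_cons y s c : 0 < c ->
  grow (y :: s) c = if c \in s then y :: grow s c else y.+1 :: s.
Proof. by case: c => // c _; rewrite /grow /comp_row /=; case: ifP. Qed.

Lemma mult_colword x s : mult x (colword s) = count (fun p => x < p) s.
Proof.
elim: s => //= p s IHs; rewrite mult_cat IHs; congr (_ + _).
rewrite /mult count_uniq_mem ?iota_uniq // mem_iota; lia.
Qed.

Lemma addable_colword s c : addable (colword s) c = (c == 0) || (c \in s).
Proof.
rewrite /addable !mult_colword; case: c => //= c.
elim: s => //= p s IHs; rewrite inE -IHs.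
have : count (fun q => c.+1 < q) s <= count (fun q => c < q) s.
  by apply: sub_count => q /= /ltnW.
by case: (eqVneq c.+1 p) => [<-|]; lia.
Qed.

Lemma mult_colword_pred s c : 0 < c ->
  mult c.-1 (colword s) = mult c (colword s) + mult c s.
Proof.
case: c => // c _; rewrite !mult_colword; elim: s => // p s IHs.
by rewrite mult_cons /= IHs; case: (eqVneq p c.+1) => [->|]; lia.
Qed.

Lemma count_grow (P : pred nat) s c : (c == 0) || (c \in s) ->
  count P (grow s c) + ((c != 0) && P c) = count P s + P c.+1.
Proof.
case: (posnP c) => [-> _|c0 /=]; first by rewrite grow0 -cats1 count_cat /= !addn0.
elim: s => // y s IHs; rewrite inE grow_cons //=.
case: ifP => [cs _|_]; first by rewrite /= -!addnA IHs ?cs ?orbT.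
by rewrite orbF => /eqP <-; rewrite /=; lia.
Qed.

Lemma colword_grow s c : addable (colword s) c ->
  perm_eq (colword (grow s c)) (c :: colword s).
Proof.
rewrite addable_colword => hc; apply/allP => x _ /=; rewrite -!/(mult x _).
have := count_grow (fun p => x < p) hc.
rewrite !mult_colword; lia.
Qed.

Lemma ptn_colword s : ptn (colword s).
Proof. by move=> x; rewrite !mult_colword; apply: sub_count => p /= /ltnW. Qed.

Lemma grow_positive s c : all (leq 1) s -> addable (colword s) c -> all (leq 1) (grow s c).
Proof.
rewrite addable_colword !all_count => /eqP h hc.
have := count_grow (leq 1) hc; have := count_grow predT hc.
rewrite !count_predT h {h}. move=> e1 e2; apply/eqP; by case: (posnP c) e1 e2 => [->|c0] /=; lia.
Qed.

Fixpoint shift_row (h v : nat) (Y : seq nat) : seq nat :=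
  if Y is y :: Y' then
    if v < y <= h then
      if v == 0 then shift_row h y Y' else v :: shift_row h y Y'
    else y :: shift_row h v Y'
  else [::].

Definition prepend (h : nat) (Y : seq nat) : seq nat := h.+1 :: shift_row h 0 Y.

Lemma count_shift_row x h v Y : 0 < x -> v <= h -> (v == h) || (h \in Y) ->
  count_mem x (shift_row h v Y) + (x == h) = count_mem x Y + (x == v).
Proof.
move=> x0; elim: Y v => [|y Y IHY] v vh /=; first by rewrite orbF => /eqP->.
rewrite inE => hY; case: ifP => [/andP[vy yh]|nrec].
  have h' : (y == h) || (h \in Y).
    by case/or3P: hY => [/eqP e|/eqP->|->]; rewrite ?eqxx ?orbT //; lia.
  have := IHY y yh h'; rewrite (eq_sym y x).
  case: (eqVneq v 0) => [->|v0] /=; last by rewrite (eq_sym v x); lia.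
  by rewrite (_ : (x == 0) = false); lia.
have h' : (v == h) || (h \in Y).
  case/or3P: hY => [->//|/eqP e|->]; rewrite ?orbT //.
  by move: nrec; rewrite -e leqnn andbT => ?; apply/orP; left; apply/eqP; lia.
by have := IHY v vh h' => /=; lia.
Qed.

Lemma shift_row_fix h Y : shift_row h h Y = Y.
Proof. by elim: Y => //= y Y ->; case: ltngtP. Qed.

Lemma shift_row_mem x h v Y : 0 < x -> v <= h -> (v == h) || (h \in Y) ->
  x != h -> x \in Y -> x \in shift_row h v Y.
Proof.
move=> x0 vh hY xh xY; have := count_shift_row x0 vh hY.
by rewrite -has_pred1 has_count; move: xY; rewrite -has_pred1 has_count (negbTE xh); lia.
Qed.

Lemma shift_row_notin x h v Y : 0 < x -> v <= h -> (v == h) || (h \in Y) ->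
  x != v -> x \notin Y -> x \notin shift_row h v Y.
Proof.
move=> x0 vh hY xv; have := count_shift_row x0 vh hY.
by rewrite -!has_pred1 !has_count (negbTE xv); lia.
Qed.

(* the row of length c is the last one; it grows *)
Lemma grow_shift_last h c Y : 0 < c -> c < h -> c \notin Y -> h \in Y ->
  grow (shift_row h c Y) c = shift_row h c.+1 Y.
Proof.
move=> c0 ch; elim: Y => //= y Y IHY; rewrite !inE negb_or => /andP[cy cY] hY.
have [rec|nrec] := boolP (c < y <= h).
  have hY' : (y == h) || (h \in Y) by rewrite eq_sym.
  have [cy' yh] := andP rec; rewrite (gtn_eqF c0) grow_cons //.
  rewrite (negbTE (shift_row_notin _ _ _ _ _)) //.
  case: (ltngtP c.+1 y) => [h1|h1|<-] //; first by rewrite yh.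
  by lia.
have hY' : h \in Y.
  by case/orP: hY nrec => // /eqP <-; rewrite ch leqnn.
rewrite (_ : c.+1 < y <= h = false) ?grow_cons ?IHY //; last by lia.
suff -> : c \in shift_row h c Y by [].
have := count_shift_row c0 (ltnW ch) (_ : (c == h) || (h \in Y)).
by rewrite hY' orbT eqxx (ltn_eqF ch) -has_pred1 has_count => /(_ isT); lia.
Qed.

Lemma grow_shift h c v Y : 0 < c -> c != h -> v <= h -> (v == h) || (h \in Y) ->
  c \in Y -> grow (shift_row h v Y) c = shift_row h v (grow Y c).
Proof.
move=> c0 ch; elim: Y v => // y Y IHY v vh hY cY.
rewrite (grow_cons y) //; case: ifP => [cY'|cY'].
  rewrite /=; case: ifP => [/andP[vy yh]|nrec].
    have h' : (y == h) || (h \in Y).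
      by move: hY; rewrite inE (eq_sym h); case: (eqVneq v h) => //= ?; lia.
    case: ifP => // _; first exact: IHY.
    by rewrite grow_cons // (shift_row_mem c0 _ h') // IHY.
  have h' : (v == h) || (h \in Y).
    move: hY; rewrite inE => /or3P[->//|/eqP e|->]; rewrite ?orbT //.
    by move: nrec; rewrite -e leqnn andbT => ?; apply/orP; left; apply/eqP; lia.
  by rewrite grow_cons // (shift_row_mem c0 _ h') // IHY.
move: cY hY; rewrite !inE cY' orbF => /eqP <- {y} hY /=.
have [hc|hc] := leqP c h; last first.
  have h' : (v == h) || (h \in Y) by move: hY; rewrite (ltn_eqF hc).
  rewrite (leq_gtF (ltnW hc)) !andbF grow_cons //.
  rewrite (negbTE (shift_row_notin _ _ _ _ _)) ?cY' //.
  by rewrite gtn_eqF // (leq_ltn_trans vh).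
have {hc} lch : c < h by rewrite ltn_neqAle ch.
have h' : (v == h) || (h \in Y) by move: hY; rewrite (gtn_eqF lch).
rewrite lch !andbT; case: (ltngtP v c) => [vc|cv|vc].
- have hY' : h \in Y by case/orP: h' => // /eqP e; lia.
  rewrite ltnS (ltnW vc); case: ifP => _.
    by rewrite grow_shift_last ?cY'.
  rewrite grow_cons // ifT ?grow_shift_last ?cY' //.
  have := count_shift_row c0 (ltnW lch) (_ : (c == h) || (h \in Y)).
  by rewrite hY' orbT eqxx (negbTE ch) -has_pred1 has_count => /(_ isT); lia.
- rewrite ltnS leqNgt cv /= grow_cons //.
  by rewrite (negbTE (shift_row_notin _ _ h' _ _)) ?cY' // ltn_eqF.
- subst v; rewrite leqnn (gtn_eqF c0).
  have hY' : h \in Y by case/orP: h' => // /eqP e; lia.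
  rewrite grow_cons // ifT ?grow_shift_last ?cY' //.
  have := count_shift_row c0 (ltnW lch) (_ : (c == h) || (h \in Y)).
  by rewrite hY' orbT eqxx (negbTE ch) -has_pred1 has_count => /(_ isT); lia.
Qed.

Lemma grow_shift_hole h v Y : 0 < h -> v <= h ->
  (v < h -> 1 < count_mem h Y) -> h \in Y ->
  grow (shift_row h v Y) h = shift_row h v (grow Y h).
Proof.
move=> h0; elim: Y v => // y Y IHY v vh hc hY.
move: vh; rewrite leq_eqVlt => /orP[/eqP->|vh]; first by rewrite !shift_row_fix.
have {hc} hc := hc vh; have hY' : h \in Y.
  by rewrite -has_pred1 has_count; move: hc => /=; lia.
rewrite (grow_cons y) // hY' /=; case: ifP => [/andP[vy yh]|nrec].
  case: (ltngtP y h) yh => // [yh|->] _.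
    have cY : 1 < count_mem h Y by move: hc; rewrite /= (ltn_eqF yh).
    rewrite -IHY ?(ltnW yh) //; case: ifP => // _; rewrite grow_cons // ifT //.
    have := count_shift_row h0 (ltnW yh) (_ : (y == h) || (h \in Y)).
    by rewrite hY' orbT eqxx -has_pred1 has_count => /(_ isT); lia.
  by rewrite !shift_row_fix; case: ifP => // _; rewrite grow_cons // hY'.
have yh : y <> h by move=> yh; move: nrec; rewrite yh vh leqnn.
have cY : 1 < count_mem h Y by move: hc => /=; lia.
rewrite -IHY ?(ltnW vh) // grow_cons // ifT //.
have := count_shift_row h0 (ltnW vh) (_ : (v == h) || (h \in Y)).
by rewrite hY' orbT eqxx -has_pred1 has_count => /(_ isT); lia.
Qed.

Lemma shift_row_next h v Y : 0 < h -> v <= h -> h.+1 \notin Y -> h \in Y ->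
  shift_row h.+1 v (grow Y h) = shift_row h v Y.
Proof.
move=> h0; elim: Y v => // y Y IHY v vh; rewrite !inE negb_or => /andP[hy hY] cY.
rewrite grow_cons //; case: ifP => [cY'|cY'].
  rewrite /= (_ : (v < y <= h.+1) = (v < y <= h)); last by lia.
  by case: ifP => [/andP[_ yh]|_]; rewrite !IHY.
move: cY; rewrite cY' orbF => /eqP <- /=; rewrite leqnn ltnS vh leqnn /=.
rewrite !shift_row_fix; case: (ltngtP v h) vh => //= -> _.
by rewrite (gtn_eqF h0) shift_row_fix.
Qed.

Lemma shift_row_rcons h v Y : 0 < h -> v <= h -> (v == h) || (h \in Y) ->
  shift_row h v (rcons Y 1) = rcons (shift_row h v Y) 1.
Proof.
move=> h0; elim: Y v => [|y Y IHY] v vh /=.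
  by rewrite orbF => /eqP ->; rewrite ltnNge h0.
rewrite inE => hY; case: ifP => [/andP[vy yh]|nrec].
  have h' : (y == h) || (h \in Y).
    by move: hY; rewrite (eq_sym h); case: (eqVneq v h) => //= ?; lia.
  by rewrite IHY //; case: ifP.
have h' : (v == h) || (h \in Y).
  case/or3P: hY => [->//|/eqP e|->]; rewrite ?orbT //.
  by move: nrec; rewrite -e leqnn andbT => ?; apply/orP; left; apply/eqP; lia.
by rewrite IHY.
Qed.

Lemma shift_row0 Y : shift_row 0 0 Y = Y.
Proof. exact: shift_row_fix. Qed.

Lemma shift_row1 Y : all (leq 1) Y -> 1 \notin Y -> shift_row 1 0 (rcons Y 1) = Y.
Proof.
elim: Y => //= y Y IHY /andP[y0 hY]; rewrite inE negb_or => /andP[y1 nY].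
by rewrite IHY // ifF //; lia.
Qed.

Lemma grow_prepend z h d Y : perm_eq z (colword Y) -> all (leq 1) Y ->
  lat z [:: h; d] ->
  grow (prepend h Y) d = prepend (sw z h d).2 (grow Y (sw z h d).1).
Proof.
move=> pz Ypos hl; have hz : ptn z by apply: ptn_perm (ptn_colword Y); rewrite perm_sym.
have : addable z h by case/and3P: hl.
rewrite (addable_perm _ pz) addable_colword => hh.
have hY : (0 == h) || (h \in Y) by rewrite eq_sym.
rewrite /prepend; case: (swP hz hl) => [ne ad|e|e em] /=.
- move: ad; rewrite (addable_perm _ pz) addable_colword => /orP[/eqP d0|dY].
    rewrite d0 !grow0 shift_row_rcons //; lia.
  have d0 : 0 < d by apply: (allP Ypos).
  have dh : d != h by apply/eqP/nesym.
  by rewrite grow_cons // (shift_row_mem d0) // grow_shift.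
- rewrite {}e in hl *; case: (posnP h) hh => [-> _|h0]; first by rewrite !grow0 !shift_row0.
  move=> /= hh.
  have c2 : 1 < mult h Y.
    have /and3P[_ h2 _] := hl; move: h2; rewrite /addable (gtn_eqF h0) !mult_cons !(mult_perm _ pz).
    by have := mult_colword_pred Y h0; lia.
  rewrite grow_cons // ifT ?grow_shift_hole //.
  have := count_shift_row h0 (leq0n h) hY.
  by rewrite eqxx (gtn_eqF h0) -has_pred1 has_count; move: c2; rewrite /mult => c2 e; move: c2; rewrite -[X in 1 < X]addn0 -e; lia.
- have nY : h.+1 \notin Y.
    move: em; rewrite !(mult_perm _ pz) => em.
    have := addable_colword Y h.+1; rewrite /addable em ltnn /= => <-.
    by [].
  rewrite e grow_cons // (negbTE (shift_row_notin _ _ hY _ nY)) //.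
  case: (posnP h) hh => [h0 _|h0].
    by rewrite h0 grow0 shift_row0 shift_row1 // -h0.
  by move=> /= hh; rewrite shift_row_next.
Qed.

Theorem push_prepend z h w Y : perm_eq z (colword Y) -> all (leq 1) Y ->
  lat z (h :: w) ->
  foldl grow (prepend h Y) w =
  prepend (push z h w).2 (foldl grow Y (push z h w).1).
Proof.
elim: w z h Y => // d w IHw z h Y pz Ypos; rewrite !lat_cons.
case/and3P=> hh hd hw.
have h1 : lat z [:: h; d] by rewrite !lat_cons hh hd.
have /and3P[hd' hc' _] := sw_lat h1.
rewrite [foldl _ _ _]/= (grow_prepend pz) //; apply: IHw.
- have := hd'; rewrite (addable_perm _ pz) => /colword_grow.
  by rewrite perm_sym; apply: perm_trans; rewrite perm_cons.
- by apply: grow_positive => //; rewrite -(addable_perm _ pz).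
- by rewrite lat_cons hc' (lat_perm _ (sw_state z h d)).
Qed.

(** * P6 *)

Lemma push_cat z c u w :
  push z c (u ++ w) =
  let p := push z c u in let q := push (p.1 ++ z) p.2 w in (p.1 ++ q.1, q.2).
Proof.
elim: u z c => [|d u IHu] z c /=; first by case: push.
by rewrite IHu /= (push_perm _ _ (perm_catr_cons _ _ _)).
Qed.

Fixpoint evac (n : nat) (u : seq nat) : seq nat :=
  if n is m.+1 then
    if u is c :: u' then
      let p := push [::] c u' in rcons (evac m p.1) p.2
    else [::]
  else [::].

Lemma evacP n u : size u = n -> lat [::] u ->
  lat [::] (evac n u) /\ perm_eq (evac n u) u.
Proof.
elim: n u => [|n IHn] [|c u] //= [su] hu.
have := @push_lat [::] c u hu; have := push_content [::] c u.
have := push_size [::] c u; case: push => u' h /= su' pu.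
rewrite !lat_rcons => /andP[hu' hh].
have [h1 h2] := IHn u' (etrans su' su) hu'; split.
  by rewrite h1 (addable_perm _ (_ : perm_eq _ (u' ++ [::]))) // perm_cat2r.
by rewrite -(permPr pu) -!cats1 perm_cat2r.
Qed.

Theorem switch_evac_grow u w w' : let T := evac (size u) u in
  lat [::] (u ++ w) -> lat [::] (u ++ w') ->
  (switch [::] T w).2 = (switch [::] T w').2 ->
  foldl grow [::] (switch [::] T w).1 = foldl grow [::] (switch [::] T w').1 ->
  foldl grow [::] (u ++ w) = foldl grow [::] (u ++ w').
Proof.
move=> T; rewrite {}/T.
elim: {u}(size u) {-2}u (erefl (size u)) w w' => [|n IHn] [|c u] // su w w'.
rewrite /= in su; case: su => su; rewrite !cat_cons => hw hw'.
have c0 : c = 0 by move: hw; rewrite lat_cons => /andP[]; rewrite /addable /= orbF => /eqP.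
rewrite {c}c0 in hw hw' *; rewrite [evac _ _]/= su.
have [] := evacP (etrans (push_size [::] 0 u) su) _.
  have := @push_lat [::] 0 u; rewrite lat_rcons; move: hw.
  by rewrite -cat_cons lat_cat => /andP[hu _] /(_ hu) /andP[].
have := push_cat [::] 0 u w; have := push_cat [::] 0 u w'.
have := @push_lat [::] 0 _ hw; have := @push_lat [::] 0 _ hw'.
have := @push_prepend [::] 0 (u ++ w) [::] isT isT hw.
have := @push_prepend [::] 0 (u ++ w') [::] isT isT hw'.
have := push_size [::] 0 u; case: (push [::] 0 u) => u' h /= su' g' g l' l e' e hT pT.
rewrite !switch_rcons.
have ps : perm_eq (evac n u' ++ [::]) (u' ++ [::]) by rewrite perm_cat2r.
rewrite !(push_perm _ _ ps) /=.
move: e e' g g' l l'; set q := push _ h w; set q' := push _ h w' => -> -> /=.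
rewrite -[grow [::] 0]/(prepend 0 [::]) => -> ->; rewrite !lat_rcons => /andP[l _] /andP[l' _].
by move=> /rcons_inj[e2 ->] e1; rewrite (IHn u' _ q.1 q'.1) ?su' ?su.
Qed.

Lemma rect_indep T T' w : lat [::] T -> lat [::] T' -> perm_eq T T' -> lat T w ->
  (switch [::] T w).1 = (switch [::] T' w).1.
Proof.
move=> hT hT' pT hw; apply: switch_keq; [exact: ptn_nil| exact: keq_straight |].
by rewrite lat_cat hT cats0.
Qed.

Section Transport.
Variables (u v v' : seq nat).
Hypotheses (hu : lat [::] u) (hv : lat [::] v) (hv' : lat [::] v').
Hypothesis vv' : perm_eq v v'.
Hypothesis gvv' : foldl grow [::] v = foldl grow [::] v'.
Let T := evac (size u) u.

Definition transport (x w : seq nat) : seq nat :=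
  (switch [::] x (switch [::] T w).2).2.

Lemma transportP w : lat u w -> (switch [::] T w).1 = v ->
  let w' := transport v' w in
  [/\ lat u w', (switch [::] T w').1 = v', transport v w' = w,
      foldl grow (foldl grow [::] u) w' = foldl grow (foldl grow [::] u) w &
      perm_eq w w' /\ 
      odd (winv w) (+) odd (winv w') = odd (winv v) (+) odd (winv v')].
Proof.
move=> hw ev w'.
have [hT pT] : lat [::] T /\ perm_eq T u by apply: evacP.
have hTw : lat [::] (T ++ w) by rewrite lat_cat hT cats0 (lat_perm _ pT).
have := switch_invol hTw; have := switch_lat hTw; have := switch_content [::] T w.
have /= := switch_winv ptn_nil hTw.
rewrite ev; set T3 := (switch [::] T w).2 => par cont lat3 inv.
have e1 : (switch [::] v' T3).1 = T.
  by rewrite -(@switch_keq [::] v v') ?inv //; exact: keq_straight.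
have lat3' : lat [::] (v' ++ T3).
  by move: lat3; rewrite !lat_cat hv' => /andP[_]; rewrite (lat_perm _ (_ : perm_eq _ (v' ++ [::]))) // perm_cat2r.
have ew' : switch [::] v' T3 = (T, w') by rewrite -e1 /w' /transport -/T3 -surjective_pairing.
have := switch_invol lat3'; have := switch_lat lat3'; have := switch_content [::] v' T3.
rewrite ew' => /= cont' lTw' inv'.
have hw' : lat u w' by move: lTw'; rewrite lat_cat cats0 (lat_perm _ pT) => /andP[].
have pww' : perm_eq w w'.
  rewrite -(perm_cat2l T) -(permPl cont) perm_sym (permPl cont') perm_sym perm_cat2r //.
split=> //.
- by rewrite inv'.
- by rewrite /transport inv' /= inv.
- rewrite -!foldl_cat; apply: switch_evac_grow; rewrite -/T ?inv' /=.
  + by rewrite lat_cat hu cats0.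
  + by rewrite lat_cat hu cats0.
  + by [].
  + by rewrite ev.
split=> //.
have /= := @switch_winv [::] T w' ptn_nil lTw'; rewrite inv' /=.
rewrite -(perm_size pww') -(word_parity_perm T3 (_ : perm_eq (v ++ [::]) (v' ++ [::]))) ?perm_cat2r //.
rewrite -par; rewrite !winv_cat (cross_perm (perm_refl T) pww') (cross_perm vv' (perm_refl T3)) !oddD.
move: (odd (winv T)) (odd (winv T3)) (odd (cross _ _)) (odd (cross _ _)).
move: (odd (winv w)) (odd (winv w')) (odd (winv v)) (odd (winv v')).
by do 8 case.
Qed.

End Transport.

(** * P7 *)

Definition put (r v : nat) (T : tableau) : tableau :=
  set_nth [::] T r (rcons (nth [::] T r) v).

Lemma nth_put r v (T : tableau) i :
  nth [::] (put r v T) i = if i == r then rcons (nth [::] T r) v else nth [::] T i.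
Proof. by rewrite nth_set_nth. Qed.

Lemma entry_put r v T b :
  entry (put r v T) b = if b == (r, size (nth [::] T r)) then v else entry T b.
Proof.
case: b => i j; rewrite /entry /= nth_put xpair_eqE; case: (eqVneq i r) => [->|] //=.
rewrite nth_rcons; case: ltngtP => // h.
by rewrite nth_default // ltnW.
Qed.

Lemma size_put r v (T : tableau) : size (put r v T) = maxn r.+1 (size T).
Proof. by rewrite size_set_nth. Qed.

Lemma nth_shape (T : tableau) i : nth 0 (shape T) i = size (nth [::] T i).
Proof.
have [h|h] := ltnP i (size T); first by rewrite (nth_map [::]).
by rewrite (nth_default 0) ?size_map // (nth_default [::]).
Qed.

Lemma shape_put r v (T : tableau) : r <= size T -> shape (put r v T) = incr_nth (shape T) r.
Proof.
move=> rT; apply: (@eq_from_nth _ 0).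
  by rewrite size_map size_put size_incr_nth size_map; case: ltnP => h; apply/eqP; lia.
move=> i _; rewrite nth_incr_nth.
by rewrite !nth_shape nth_put eq_sym; case: eqP => [->|_]; rewrite ?size_rcons.
Qed.

Lemma cells_uniq s : uniq (cells s).
Proof.
apply: allpairs_uniq_dep => [|x _|]; rewrite ?iota_uniq //.
by move=> [i j] [i' j'] _ _ /= [-> ->].
Qed.

Lemma mem_cells s b : (b \in cells s) = in_diagram s b.
Proof.
case: b => i j; apply/allpairsPdep/idP => [[i' [j' [hi' hj' [-> ->]]]]|h].
  by rewrite mem_iota in hj'.
exists i, j; split=> //; rewrite mem_iota //= add0n.
by rewrite /in_diagram /= in h; rewrite ltnNge; apply: contraL h => h; rewrite nth_default.
Qed.

Lemma entry_neq0 T b : entry T b != 0 -> in_diagram (shape T) b.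
Proof.
rewrite /in_diagram nth_shape /entry => h; rewrite ltnNge; apply: contra h => h.
by rewrite nth_default.
Qed.

Lemma mem_boxes T b : (b \in boxes T) = (entry T b != 0).
Proof.
rewrite mem_filter mem_cells; apply: andb_idr; exact: entry_neq0.
Qed.

Lemma boxes_uniq T : uniq (boxes T).
Proof. by rewrite filter_uniq // cells_uniq. Qed.

Lemma entry_out (T : tableau) i j : size (nth [::] T i) <= j -> entry T (i, j) = 0.
Proof. by move=> h; rewrite /entry nth_default. Qed.

Lemma boxes_put r v (T : tableau) : v != 0 ->
  perm_eq (boxes (put r v T)) ((r, size (nth [::] T r)) :: boxes T).
Proof.
move=> v0; apply: uniq_perm; rewrite /= ?boxes_uniq ?andbT //.
  by rewrite mem_boxes entry_out.
by move=> b; rewrite inE !mem_boxes entry_put; case: (b =P (r, _)).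
Qed.

Lemma map_entry_cells (T : tableau) : [seq entry T b | b <- cells (shape T)] = flatten T.
Proof.
rewrite /cells map_flatten -map_comp; congr flatten.
have sT : size (shape T) = size T by rewrite /shape size_map.
apply: (@eq_from_nth _ [::]) => [|i]; rewrite size_map size_iota sT // => hi.
rewrite (nth_map 0) ?size_iota ?sT // nth_iota ?sT //= add0n -map_comp.
apply: (@eq_from_nth _ 0); rewrite size_map size_iota nth_shape // => j hj.
by rewrite (nth_map 0) ?size_iota // nth_iota.
Qed.

Lemma map_entry_boxes T : [seq entry T b | b <- boxes T] = [seq x <- flatten T | x != 0].
Proof. by rewrite -map_entry_cells filter_map /boxes; congr map; apply: eq_filter. Qed.

(* standard fillings *)
Record std_filling (la : seq nat) (n : nat) (T : tableau) : Prop := StdFilling {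
  std_rows : forall i, i < size T -> 0 < size (nth [::] T i);
  std_zero : forall i j,
    (entry T (i, j) == 0) = (j < nth 0 la i) || (size (nth [::] T i) <= j);
  std_sub : forall i, nth 0 la i <= size (nth [::] T i);
  std_row : forall i j, entry T (i, j.+1) != 0 -> entry T (i, j) < entry T (i, j.+1);
  std_inj : forall b b', entry T b != 0 -> entry T b = entry T b' -> b = b';
  std_max : forall b, entry T b <= n;
  std_surj : forall m, 0 < m <= n -> exists b, entry T b = m }.

Lemma std_put la n T r : std_filling la n T -> r <= size T ->
  std_filling la n.+1 (put r n.+1 T).
Proof.
move=> [h1 h2 h3 h4 h5 h6 h7] rT; split.
- move=> i; rewrite size_put nth_put; case: eqP => [_ _|/eqP ir hi]; first by rewrite size_rcons.
  by apply: h1; lia.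
- move=> i j; rewrite entry_put xpair_eqE nth_put; case: (eqVneq i r) => [->|_] //=.
  rewrite size_rcons; case: (eqVneq j (size (nth [::] T r))) => [->|ne] /=.
    by have := h3 r; case: ltngtP => //; lia.
  by rewrite h2 (leq_eqVlt _ j) eq_sym (negbTE ne).
- move=> i; rewrite nth_put; case: eqP => [->|_] //.
  by rewrite size_rcons leqW.
- move=> i j; rewrite !entry_put !xpair_eqE; case: (eqVneq i r) => [->|_] /=; last exact: h4.
  case: (j.+1 =P _) => [e _|ne]; first by rewrite -e (ltn_eqF (ltnSn j)) ltnS h6.
  case: (j =P _) => [e|_]; last exact: h4.
  by rewrite h2 e leqnSn orbT.
- move=> b b'; rewrite !entry_put; case: (b =P _) => [-> _|_ b0]; case: (b' =P _) => // _.
  + by move=> e; have := h6 b'; rewrite -e ltnn.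
  + by move=> e; have := h6 b; rewrite e ltnn.
  + exact: h5.
- by move=> b; rewrite entry_put; case: eqP => // _; apply: leqW.
- move=> m hm; case: (eqVneq m n.+1) => [->|ne].
    by exists (r, size (nth [::] T r)); rewrite entry_put eqxx.
  have [|b hb] := h7 m; first by lia.
  exists b; rewrite entry_put hb; case: eqP => // e.
  by move: hb; rewrite e entry_out // => m0; lia.
Qed.

Definition zeros (la : seq nat) : tableau := [seq nseq p 0 | p <- la].

Lemma entry_zeros la b : entry (zeros la) b = 0.
Proof.
case: b => i j; rewrite /entry /=.
have [h|h] := ltnP i (size la); last by rewrite (nth_default [::]) ?size_map // nth_nil.
by rewrite (nth_map 0) // nth_nseq; case: ifP.
Qed.

Lemma shape_zeros la : shape (zeros la) = la.
Proof.
by rewrite /shape -map_comp -[RHS]map_id; apply: eq_map => p /=; rewrite size_nseq.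
Qed.

Lemma std_zeros la : all (leq 1) la -> std_filling la 0 (zeros la).
Proof.
move=> la1; split=> [i|i j|i|i j|b b'|b|m].
- rewrite size_map => hi; rewrite -nth_shape shape_zeros.
  by apply: (allP la1); apply: mem_nth.
- by rewrite entry_zeros -nth_shape shape_zeros eqxx; case: ltnP.
- by rewrite -nth_shape shape_zeros.
- by rewrite entry_zeros.
- by rewrite entry_zeros.
- by rewrite entry_zeros.
- by case: m.
Qed.

(** * P8 *)

Lemma uniq_map_inj (A B : eqType) (f : A -> B) s :
  uniq (map f s) -> {in s &, injective f}.
Proof.
elim: s => //= x s IHs /andP[xs us] y z; rewrite !inE.
case/orP=> [/eqP->|ys] /orP[/eqP->|zs] // e; last exact: IHs.
  by move: xs; rewrite e map_f.
by move: xs; rewrite -e map_f.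
Qed.

Definition unput (r : nat) (T : tableau) : tableau :=
  let row := nth [::] T r in
  if size row == 1 then take r T else set_nth [::] T r (take (size row).-1 row).

Section Peel.
Variables (la : seq nat) (n r j : nat) (T : tableau).
Hypotheses (hT : std_filling la n.+1 T) (hr : entry T (r, j) = n.+1).

Lemma peel_last : j.+1 = size (nth [::] T r).
Proof.
have h1 : entry T (r, j) != 0 by rewrite hr.
have h2 : entry T (r, j.+1) == 0.
  by apply/negPn/negP => /(std_row hT); have := std_max hT (r, j.+1); lia.
by move: h1 h2; rewrite !(std_zero hT) negb_or => /andP[]; lia.
Qed.

Hypothesis hj : j = 0 -> r.+1 = size T.

Lemma peel_row_lt : r < size T.
Proof.
by rewrite ltnNge; apply/negP => h; have := peel_last; rewrite nth_default.
Qed.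

Lemma nth_unput i :
  nth [::] (unput r T) i = if i == r then take j (nth [::] T r) else nth [::] T i.
Proof.
rewrite /unput -peel_last eqSS; case: (eqVneq j 0) => [j0|_]; last by rewrite nth_set_nth.
rewrite j0 take0; case: (ltngtP i r) => [h|h|->]; last by rewrite nth_default // size_take; case: ifP; lia.
  by rewrite nth_take.
rewrite nth_default; last by rewrite size_take; case: ifP; lia.
by rewrite nth_default // -hj.
Qed.

Lemma size_unput : size (unput r T) = if j == 0 then r else size T.
Proof.
rewrite /unput -peel_last eqSS; have := peel_row_lt; case: (eqVneq j 0) => _ h.
  by rewrite size_take h.
by rewrite size_set_nth; apply/maxn_idPr.
Qed.

Lemma entry_unput b : entry (unput r T) b = if b == (r, j) then 0 else entry T b.
Proof.
case: b => i k; rewrite /entry /= nth_unput xpair_eqE.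
case: (eqVneq i r) => [->|] //=.
have st : size (take j (nth [::] T r)) = j by rewrite size_take -peel_last ltnSn.
case: (ltngtP k j) => h; first by rewrite nth_take.
  by rewrite (nth_default 0) ?st ?(ltnW h) // nth_default -?peel_last.
by rewrite nth_default // st h.
Qed.

Lemma put_unput : put r n.+1 (unput r T) = T.
Proof.
apply: (@eq_from_nth _ [::]) => [|i _].
  rewrite size_put size_unput; have := peel_row_lt.
  by case: (eqVneq j 0) => [/hj|_]; lia.
rewrite nth_put !nth_unput eqxx; case: (eqVneq i r) => [->|_] //.
by rewrite -hr -take_nth -?peel_last // peel_last take_size.
Qed.

Lemma std_unput : std_filling la n (unput r T).
Proof.
have hla : nth 0 la r <= j.
  have : entry T (r, j) != 0 by rewrite hr.
  by rewrite (std_zero hT) negb_or => /andP[]; lia.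
split.
- move=> i; rewrite size_unput nth_unput; case: (eqVneq i r) => [->|ir].
    by case: (eqVneq j 0) => [_|j0 _]; rewrite ?ltnn // size_take -peel_last ltnSn lt0n.
  case: (eqVneq j 0) => [j0|_] hi; apply: (std_rows hT) => //.
  by apply: leq_trans hi _; rewrite ltnW // peel_row_lt.
- move=> i k; rewrite entry_unput nth_unput xpair_eqE.
  case: (eqVneq i r) => [->|] /=; last by rewrite (std_zero hT).
  rewrite size_take -peel_last ltnSn; case: (eqVneq k j) => [->|kj].
    by rewrite leqnn orbT eqxx.
  by rewrite (std_zero hT) -peel_last (leq_eqVlt j) eq_sym (negbTE kj).
- move=> i; rewrite nth_unput; case: eqP => [->|_]; last exact: (std_sub hT).
  by rewrite size_take -peel_last ltnSn.
- move=> i k; rewrite !entry_unput; case: ((i, k.+1) =P _) => // _ h.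
  have := std_row hT h; case: ((i, k) =P _) => // _.
  by apply: leq_ltn_trans.
- move=> b b'; rewrite !entry_unput; case: (b =P _) => // _ h.
  by case: (b' =P _) => [_ e|_]; [rewrite e in h | apply: (std_inj hT)].
- move=> b; rewrite entry_unput; case: (b =P _) => // ne.
  have := std_max hT b; rewrite leq_eqVlt => /orP[/eqP e|//].
  by case: ne; apply: (std_inj hT); rewrite ?e ?hr.
- move=> m hm; have [|b hb] := std_surj hT (m := m); first by lia.
  exists b; rewrite entry_unput; case: (b =P _) => // e.
  by move: hb hm; rewrite e hr => <-; rewrite ltnn andbF.
Qed.

End Peel.

(* fillings built entry by entry *)
Definition fill (row : seq nat -> nat -> nat) (T : tableau) (l : seq (nat * nat)) :=
  foldl (fun U p => put (row (shape U) p.1) p.2 U) T l.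

Definition numbered (n : nat) (w : seq nat) : seq (nat * nat) :=
  zip w (iota n (size w)).

Lemma numbered_cons n c w : numbered n (c :: w) = (c, n) :: numbered n.+1 w.
Proof. by []. Qed.

Lemma numbered_cat n u w : numbered n (u ++ w) = numbered n u ++ numbered (n + size u) w.
Proof. by rewrite /numbered size_cat iotaD zip_cat ?size_iota. Qed.

Lemma numbered_rcons n w c : numbered n (rcons w c) = rcons (numbered n w) (c, n + size w).
Proof. by rewrite -!cats1 numbered_cat. Qed.

Lemma fill_rcons row T l p : fill row T (rcons l p) =
  let U := fill row T l in put (row (shape U) p.1) p.2 U.
Proof. by rewrite /fill foldl_rcons. Qed.

Lemma fill_cat row T l l' : fill row T (l ++ l') = fill row (fill row T l) l'.
Proof. by rewrite /fill foldl_cat. Qed.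

Definition grow_by (row : seq nat -> nat -> nat) (s : seq nat) (c : nat) :=
  incr_nth s (row s c).

(* a row choice is sound if it returns a row of length c whenever there is one *)
Definition row_choice (row : seq nat -> nat -> nat) (ok : pred (seq nat)) : Prop :=
  forall s c, ok s -> addable (colword s) c ->
  [/\ row s c <= size s, nth 0 s (row s c) = c & ok (grow_by row s c)].

Lemma colword_incr_nth s r : r <= size s ->
  perm_eq (colword (incr_nth s r)) (nth 0 s r :: colword s).
Proof.
move=> hr; apply/allP => x _ /=; apply/eqP; rewrite -!/(mult x _).
rewrite -/(nat_of_bool _) !mult_colword.
elim: s r hr => [|y s IHs] [|r] //=; first by case: x.
  by move=> _; case: (ltngtP x y); lia.
by move=> /IHs ->; lia.
Qed.

Lemma shape_fill row ok T w n : row_choice row ok -> ok (shape T) ->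
  lat (colword (shape T)) w ->
  [/\ shape (fill row T (numbered n w)) = foldl (grow_by row) (shape T) w,
      ok (foldl (grow_by row) (shape T) w) &
      perm_eq (colword (foldl (grow_by row) (shape T) w)) (w ++ colword (shape T))].
Proof.
move=> hrow; elim: w T n => //= c w IHw T n okT /andP[hc hw].
have [h1 h2 h3] := hrow _ _ okT hc; set r := row (shape T) c in h1 h2 h3 *.
have sP : shape (put r n T) = grow_by row (shape T) c.
  by rewrite shape_put //; move: h1; rewrite size_map.
have cw : perm_eq (colword (grow_by row (shape T) c)) (c :: colword (shape T)).
  by rewrite -{2}h2; apply: colword_incr_nth.
rewrite -/(fill _ _ _) -/(numbered _ _); have := IHw (put r n T) n.+1.
rewrite sP (lat_perm _ cw) => /(_ h3 hw) [-> -> pw]; split=> //.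
apply: (perm_trans pw); apply: perm_trans (perm_catr_cons _ _ _).
by rewrite perm_cat2l.
Qed.

Lemma std_fill row ok la T w n m : row_choice row ok -> ok (shape T) ->
  lat (colword (shape T)) w -> std_filling la m T -> n = m.+1 ->
  std_filling la (m + size w) (fill row T (numbered n w)).
Proof.
move=> hrow; elim: w T n m => [|c w IHw] T n m okT /=; first by rewrite addn0.
case/andP=> hc hw sT ->; have [h1 h2 h3] := hrow _ _ okT hc.
set r := row (shape T) c in h1 h2 h3 *.
have rT : r <= size T by move: h1; rewrite size_map.
have sP : shape (put r m.+1 T) = grow_by row (shape T) c by rewrite shape_put.
rewrite -/(fill _ _ _) -/(numbered _ _) addnS -addSn; apply: IHw => //.
- by rewrite sP.
- by rewrite sP (lat_perm _ (_ : perm_eq _ (c :: colword (shape T)))) // /grow_by -{2}h2 colword_incr_nth.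
- exact: std_put.
Qed.

(** * P9 *)

Definition part_row (s : seq nat) (c : nat) : nat := count (fun p => c < p) s.

Definition is_part (s : seq nat) : bool := sorted geq s && all (leq 1) s.

Lemma geq_trans : transitive geq.
Proof. by move=> y x z /= h h'; apply: leq_trans h' h. Qed.

Lemma part_nth s i j : sorted geq s -> i <= j -> nth 0 s j <= nth 0 s i.
Proof.
move=> hs ij; have [h|h] := ltnP j (size s); last by rewrite nth_default.
by apply: (sorted_leq_nth geq_trans leqnn 0 hs) => //; rewrite inE ?(leq_ltn_trans ij).
Qed.

Lemma part_rowP s c i : sorted geq s -> (i < part_row s c) = (c < nth 0 s i).
Proof.
rewrite /part_row; elim: s i => [|y s IHs] i hs; first by rewrite nth_nil !ltn0.
have hs' : sorted geq s by apply: path_sorted hs.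
case: i => [|i] /=; last first.
  case: (ltnP c y) => h; first by rewrite add1n ltnS IHs.
  rewrite add0n IHs //; apply/idP/idP => h'; last first.
    by have := part_nth hs (leq0n i.+1); rewrite /=; lia.
  by rewrite (leq_trans h') // part_nth.
case: (ltnP c y) => h //; rewrite add0n; apply/negbTE; rewrite -eqn0Ngt.
rewrite -leqn0 leqNgt -has_count; apply/hasPn => q qs; rewrite -leqNgt.
apply: leq_trans h; have /(nthP 0)[k hk <-] := qs.
exact: (part_nth hs (leq0n k.+1)).
Qed.

Lemma part_row_choice : row_choice part_row is_part.
Proof.
move=> s c /andP[hs s1] ha; set r := part_row s c.
have rs : r <= size s by apply: count_size.
have e : nth 0 s r = c.
  apply/eqP; rewrite eqn_leq leqNgt -part_rowP // ltnn /=.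
  move: ha; rewrite addable_colword => /orP[/eqP->//|/(nthP 0)[i hi e]].
  by rewrite -{1}e part_nth // leqNgt part_rowP // e ltnn.
split=> //; apply/andP; split.
  apply/(sortedP 0) => i; rewrite !nth_incr_nth -/r => _ /=.
  have := part_nth hs (leqnSn i); case: (eqVneq r i.+1) => [ri|_]; last by lia.
  have : i < r by rewrite ri.
  by rewrite part_rowP // ri -e -ri; lia.
apply/(all_nthP 0) => i; rewrite /grow_by -/r => hi; rewrite nth_incr_nth.
case: (eqVneq r i) => // ri; apply: (allP s1); apply: mem_nth.
move: hi; rewrite size_incr_nth; case: ifP => // h.
have rE : r = size s by apply/eqP; rewrite eqn_leq rs leqNgt h.
by rewrite ltnS leq_eqVlt eq_sym (negbTE ri) -rE.
Qed.

Definition columns_increase (T : tableau) : Prop :=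
  forall i j, entry T (i.+1, j) != 0 -> entry T (i, j) < entry T (i.+1, j).

Lemma columns_put la n T c : std_filling la n T -> is_part (shape T) ->
  addable (colword (shape T)) c -> columns_increase T ->
  columns_increase (put (part_row (shape T) c) n.+1 T).
Proof.
move=> sT hs ha hc i j; have [h1 h2 _] := part_row_choice hs ha.
have srt : sorted geq (shape T) by case/andP: hs.
set r := part_row _ _ in h1 h2 *; have e := h2; rewrite nth_shape in e.
rewrite !entry_put; case: ((i.+1, j) =P _) => [[ri jc] _|ne h].
  by case: (_ =P _) => [[ir _]|_]; [lia | rewrite ltnS (std_max sT)].
case: ((i, j) =P _) => [[ir jc]|_]; last exact: hc.
move: h; rewrite (std_zero sT) negb_or => /andP[_]; rewrite -ltnNge jc e -nth_shape.
have := part_nth srt (leqnSn i); rewrite ir h2; lia.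
Qed.

Lemma columns_peel la n T r j : is_part la -> std_filling la n.+1 T ->
  is_part (shape T) -> columns_increase T -> entry T (r, j) = n.+1 ->
  [/\ j = 0 -> r.+1 = size T, is_part (shape (unput r T)),
      columns_increase (unput r T), addable (colword (shape (unput r T))) j &
      part_row (shape (unput r T)) j = r].
Proof.
move=> hla sT hs hc hr; have hl := peel_last sT hr.
have srt : sorted geq (shape T) by case/andP: hs.
have below : size (nth [::] T r.+1) <= j.
  rewrite leqNgt; apply/negP => h.
  have : entry T (r.+1, j) != 0.
    rewrite (std_zero sT) negb_or -leqNgt -ltnNge h andbT.
    have : entry T (r, j) != 0 by rewrite hr.
    rewrite (std_zero sT) negb_or => /andP[h' _]; rewrite -leqNgt in h'.
    by apply: leq_trans h'; apply: part_nth; [case/andP: hla | apply: leqnSn].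
  by move/hc; have := std_max sT (r.+1, j); rewrite hr; lia.
have hj : j = 0 -> r.+1 = size T.
  move=> j0; have := peel_row_lt sT hr; rewrite leq_eqVlt => /orP[/eqP//|h].
  by have := std_rows sT h; rewrite j0 in below; lia.
have nU i : nth 0 (shape (unput r T)) i = if i == r then j else nth 0 (shape T) i.
  rewrite !nth_shape (nth_unput sT hr hj); case: eqP => // _.
  by rewrite size_take -hl ltnSn.
have sU := size_unput sT hr; have rT := peel_row_lt sT hr.
have hsU : is_part (shape (unput r T)).
  apply/andP; split.
    apply/(sortedP 0) => i hi /=; rewrite !nU.
    have := part_nth srt (leqnSn i); rewrite !nth_shape.
    case: (eqVneq i.+1 r) => [ri|_].
      by rewrite -[in i == r]ri ltn_eqF // ri -hl => h; apply: leq_trans h; rewrite leqnSn.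
    by case: (eqVneq i r) => [->|_].
  apply/(all_nthP 0) => i; rewrite size_map sU nU => hi.
  case: (eqVneq i r) hi => [->|ir].
    by case: (eqVneq j 0) => [_|]; rewrite ?ltnn // lt0n.
  move=> hi; rewrite nth_shape; apply: (std_rows sT).
  by move: hi; case: ifP => // _ h; apply: ltn_trans rT.
split=> //.
- move=> i k; rewrite !(entry_unput sT hr hj); case: ((i.+1, k) =P _) => // _ h.
  have := hc _ _ h; case: ((i, k) =P _) => // _; exact: leq_ltn_trans.
- rewrite addable_colword; case: (eqVneq j 0) => //= j0.
  have <- : nth 0 (shape (unput r T)) r = j by rewrite nU eqxx.
  by rewrite mem_nth // size_map sU (negbTE j0).
have srtU : sorted geq (shape (unput r T)) by case/andP: hsU.
apply/eqP; rewrite eqn_leq leqNgt part_rowP // nU eqxx ltnn /=.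
case: r {below hj} nU hl hr rT sU hsU srtU => // r nU hl hr rT sU hsU srtU.
rewrite part_rowP // nU ltn_eqF // nth_shape.
by have := part_nth srt (leqnSn r); rewrite !nth_shape -hl.
Qed.

Lemma std_filling0 la T : all (leq 1) la -> std_filling la 0 T -> T = zeros la.
Proof.
move=> hla sT; have row i : size (nth [::] T i) = nth 0 la i.
  apply/eqP; rewrite eqn_leq (std_sub sT) andbT leqNgt; apply/negP => h.
  have : entry T (i, nth 0 la i) != 0 by rewrite (std_zero sT) ltnn /= -ltnNge.
  by have := std_max sT (i, nth 0 la i); rewrite leqn0 => ->.
have szT : size T = size la.
  apply/eqP; rewrite eqn_leq; apply/andP; split; rewrite leqNgt; apply/negP => h.
    by have := std_rows sT h; rewrite row nth_default.
  have := allP hla _ (mem_nth 0 h); by rewrite -row nth_default.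
apply: (@eq_from_nth _ [::]) => [|i hi]; first by rewrite size_map.
have hi' : i < size la by rewrite -szT.
apply: (@eq_from_nth _ 0) => [|k hk]; first by rewrite row -!nth_shape shape_zeros.
rewrite -/(entry T (i, k)) -/(entry (zeros la) (i, k)) entry_zeros.
by apply/eqP; rewrite -leqn0 (std_max sT).
Qed.

Theorem part_tableau_word la n T : is_part la -> is_part (shape T) ->
  std_filling la n T -> columns_increase T ->
  exists w, [/\ size w = n, lat (colword la) w &
                T = fill part_row (zeros la) (numbered 1 w)].
Proof.
move=> hla; elim: n T => [|n IHn] T hs sT hc.
  by exists [::]; split=> //=; apply: std_filling0; case/andP: hla.
have [|[r j] hr] := std_surj sT (m := n.+1); first by rewrite ltnS leqnn.
have [hj hsU hcU ha er] := columns_peel hla sT hs hc hr.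
have [w [sw lw eT]] := IHn _ hsU (std_unput sT hr hj) hcU.
have := @shape_fill part_row is_part (zeros la) w 1 part_row_choice.
rewrite shape_zeros => /(_ hla lw)[e1 e2 e3].
exists (rcons w j); split; first by rewrite size_rcons sw.
  rewrite lat_rcons lw -(addable_perm _ e3) -e1 -eT //.
by rewrite numbered_rcons fill_rcons -eT /= er add1n sw (put_unput sT hr hj).
Qed.

Lemma part_fill la w : is_part la -> lat (colword la) w ->
  let T := fill part_row (zeros la) (numbered 1 w) in
  [/\ std_filling la (size w) T, shape T = foldl (grow_by part_row) la w,
      is_part (shape T), columns_increase T &
      perm_eq (colword (shape T)) (w ++ colword la)].
Proof.
move=> hla hw /=.
have := @shape_fill part_row is_part (zeros la) w 1 part_row_choice.
rewrite shape_zeros => /(_ hla hw)[e1 e2 e3]; rewrite e1.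
have sT : std_filling la (0 + size w) (fill part_row (zeros la) (numbered 1 w)).
  apply: (std_fill part_row_choice) => //; rewrite ?shape_zeros //.
  by apply: std_zeros; case/andP: hla.
split=> //.
elim/last_ind: w hw {e1 e2 e3 sT} => [|w c IHw] hw; first by move=> i j; rewrite entry_zeros.
move: hw; rewrite lat_rcons => /andP[hw hc].
have := @shape_fill part_row is_part (zeros la) w 1 part_row_choice.
rewrite shape_zeros => /(_ hla hw)[e1 e2 e3].
rewrite numbered_rcons fill_rcons /= add1n; apply: (@columns_put la).
- rewrite -[size w]add0n; apply: (std_fill part_row_choice) => //; rewrite ?shape_zeros //.
  by apply: std_zeros; case/andP: hla.
- by rewrite e1.
- by rewrite e1 (addable_perm _ e3).
- exact: IHw.
Qed.

Lemma part_colword_inj la mu : is_part la -> is_part mu ->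
  perm_eq (colword la) (colword mu) -> la = mu.
Proof.
move=> /andP[hla la1] /andP[hmu mu1] p.
have row c : part_row la c = part_row mu c by rewrite /part_row -!mult_colword (mult_perm _ p).
have szE s : all (leq 1) s -> size s = part_row s 0.
  by move=> s1; apply/esym/eqP; rewrite -all_count.
apply: (@eq_from_nth _ 0) => [|i _]; first by rewrite !szE.
have lt c : (c < nth 0 la i) = (c < nth 0 mu i) by rewrite -!part_rowP ?row.
by apply/eqP; rewrite eqn_leq; apply/andP; split; rewrite leqNgt; [rewrite lt | rewrite -lt]; rewrite ltnn.
Qed.

(** * P10 *)

Definition nonzero (s : seq nat) : seq nat := [seq x <- s | x != 0].

Definition gaps (outer la : seq nat) : seq nat :=
  [seq nth 0 outer i - nth 0 la i | i <- iota 0 (size outer)].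

Lemma sumn_gaps outer la : (forall i, nth 0 la i <= nth 0 outer i) ->
  size la <= size outer -> sumn (gaps outer la) = sumn outer - sumn la.
Proof.
move=> sub sz; apply/eqP; rewrite -(eqn_add2r (sumn la)) subnK; last first.
  elim: outer la sub sz => [|x s IHs] [|y la] //= sub sz; apply: leq_add.
    exact: (sub 0).
  by apply: IHs => // i; apply: (sub i.+1).
elim: outer la sub sz => [|x s IHs] [|y la] //= sub sz.
  rewrite /gaps /= subn0 (iotaDl 1 0) -map_comp addn0.
  have /eqP : sumn (gaps s [::]) + sumn [::] == sumn s.
    by apply: IHs => // i; rewrite nth_nil.
  rewrite addn0 => <-; apply/eqP; congr (_ + sumn _).
  by apply: eq_map => i /=; rewrite nth_nil.
rewrite /gaps /= (iotaDl 1 0) -map_comp.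
have /eqP <- := IHs la (fun i => sub i.+1) sz.
by rewrite addnACA subnK ?(sub 0).
Qed.

Section Interface.
Variables (outer la : seq nat).
Hypotheses (sub : forall i, nth 0 la i <= nth 0 outer i) (sz : size la <= size outer).

Lemma standard_fillings_size p : p \in permutations (iota 1 (sumn outer - sumn la)) ->
  size p = sumn (gaps outer la).
Proof.
by rewrite mem_permutations => /perm_size; rewrite size_iota sumn_gaps.
Qed.

Lemma mem_standard_fillings T : T \in standard_fillings outer la <->
  [/\ shape T = outer,
      forall i, nth [::] T i = nseq (nth 0 la i) 0 ++ nonzero (nth [::] T i) &
      perm_eq (nonzero (flatten T)) (iota 1 (sumn outer - sumn la))].
Proof.
split=> [/mapP[p pp ->]|[sT rT pT]].
  have szp := standard_fillings_size pp.
  have shp : shape (reshape (gaps outer la) p) = gaps outer la.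
    by rewrite reshapeKl // szp.
  rewrite -/(gaps outer la); set rows := [seq _ | i <- _].
  have szr : size rows = size outer by rewrite size_map size_iota.
  have nr i : i < size outer -> nth [::] rows i =
     nseq (nth 0 la i) 0 ++ nth [::] (reshape (gaps outer la) p) i.
    by move=> hi; rewrite (nth_map 0) ?size_iota // nth_iota.
  have p0 : all (fun x => x != 0) p.
    apply/allP => x; move: pp; rewrite mem_permutations => /perm_mem ->.
    by rewrite mem_iota; case: x.
  have fp : flatten (reshape (gaps outer la) p) = p.
    by rewrite reshapeKr // szp.
  have nz i : all (fun x => x != 0) (nth [::] (reshape (gaps outer la) p) i).
    have [h|h] := ltnP i (size (reshape (gaps outer la) p)); last by rewrite nth_default.
    apply/allP => x xi; apply: (allP p0); rewrite -fp; apply/flattenP.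
    by exists (nth [::] (reshape (gaps outer la) p) i); rewrite ?mem_nth.
  have nzr i : i < size outer -> nonzero (nth [::] rows i) = nth [::] (reshape (gaps outer la) p) i.
    move=> hi; rewrite nr // /nonzero filter_cat (_ : filter _ (nseq _ _) = [::]).
      by apply/all_filterP.
    by apply/eqP; rewrite -size_eq0 size_filter -leqn0 leqNgt -has_count has_nseq andbF.
  split.
  - apply: (@eq_from_nth _ 0); first by rewrite size_map szr.
    move=> i; rewrite size_map szr => hi; rewrite nth_shape nr // size_cat size_nseq.
    rewrite -nth_shape shp /gaps (nth_map 0) ?size_iota // nth_iota // add0n.
    by rewrite subnKC.
  - move=> i; have [h|h] := ltnP i (size outer); first by rewrite nzr // nr.
    by rewrite !nth_default ?szr // (leq_trans sz).
  - suff -> : nonzero (flatten rows) = p by rewrite -mem_permutations.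
    rewrite /nonzero filter_flatten -[RHS]fp; congr flatten.
    apply: (@eq_from_nth _ [::]).
      by rewrite size_map szr size_reshape size_map size_iota.
    rewrite size_map szr => i hi; rewrite (nth_map [::]) ?szr //; exact: nzr.
apply/mapP; exists (nonzero (flatten T)); first by rewrite mem_permutations.
have szT : size T = size outer by rewrite -sT size_map.
have e : reshape (gaps outer la) (nonzero (flatten T)) = map nonzero T.
  rewrite /nonzero filter_flatten -[RHS]flattenK; congr reshape.
  rewrite /gaps -sT; apply: (@eq_from_nth _ 0).
    by rewrite !size_map size_iota.
  move=> i; rewrite size_map size_iota size_map => hi.
  rewrite (nth_map 0) ?size_iota ?size_map // nth_iota ?size_map // add0n.
  rewrite !nth_shape (nth_map [::]) //.
  by rewrite {1}(rT i) size_cat size_nseq addKn.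
rewrite -/(gaps outer la) e; apply: (@eq_from_nth _ [::]).
  by rewrite size_map size_iota szT.
move=> i hi; rewrite (nth_map 0) ?size_iota -?szT // nth_iota // add0n.
by rewrite (nth_map [::]) // rT.
Qed.

Lemma standard_fillings_uniq : uniq (standard_fillings outer la).
Proof.
rewrite map_inj_in_uniq ?permutations_uniq // => p q hp hq e.
have sp := standard_fillings_size hp; have sq := standard_fillings_size hq.
rewrite -(@reshapeKr _ (gaps outer la) p) ?sp // -(@reshapeKr _ (gaps outer la) q) ?sq //.
congr flatten; apply: (@eq_from_nth _ [::]); first by rewrite !size_reshape.
move=> i; rewrite size_reshape size_map size_iota => hi.
have /(congr1 (fun T => nth [::] T i)) := e.
rewrite !(nth_map 0) ?size_iota // nth_iota // add0n -/(gaps _ _).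
by move/eqP; rewrite eqseq_cat // => /andP[_ /eqP].
Qed.

Lemma std_mem_fillings T n : shape T = outer -> n = sumn outer - sumn la ->
  std_filling la n T -> T \in standard_fillings outer la.
Proof.
move=> sT -> hT; apply/mem_standard_fillings; split=> // [i|].
  have tk : take (nth 0 la i) (nth [::] T i) = nseq (nth 0 la i) 0.
    apply: (@eq_from_nth _ 0); rewrite size_takel ?(std_sub hT) ?size_nseq // => j hj.
    rewrite nth_nseq hj nth_take //; apply/eqP.
    by have := std_zero hT i j; rewrite hj.
  have dr : all (fun x => x != 0) (drop (nth 0 la i) (nth [::] T i)).
    apply/(all_nthP 0) => j; rewrite size_drop nth_drop ltn_subRL => hj.
    by have := std_zero hT i (nth 0 la i + j); rewrite /entry /= => ->; lia.
  have rE : nth [::] T i = nseq (nth 0 la i) 0 ++ drop (nth 0 la i) (nth [::] T i).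
    by rewrite -tk cat_take_drop.
  move: rE dr; set d := drop _ _ => -> dr.
  rewrite /nonzero filter_cat (_ : filter _ (nseq _ _) = [::]); last first.
    by apply/eqP; rewrite -size_eq0 size_filter -leqn0 leqNgt -has_count has_nseq andbF.
  by congr (_ ++ _); apply/esym/all_filterP.
rewrite /nonzero -map_entry_boxes; apply: uniq_perm; rewrite ?iota_uniq //.
  rewrite map_inj_in_uniq ?boxes_uniq // => b b'; rewrite mem_boxes => h _.
  exact: (std_inj hT).
move=> m; rewrite mem_iota; apply/mapP/idP => [[b]|].
  rewrite mem_boxes => h ->; have := std_max hT b; lia.
move=> hm; have [|b hb] := std_surj hT (m := m); first by lia.
by exists b => //; rewrite mem_boxes hb; lia.
Qed.

Lemma mem_fillings_std T n : all (leq 1) outer -> n = sumn outer - sumn la ->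
  T \in standard_fillings outer la ->
  (forall i j, entry T (i, j.+1) != 0 -> entry T (i, j) < entry T (i, j.+1)) ->
  std_filling la n T.
Proof.
move=> o1 -> /mem_standard_fillings[sT rT pT] hrow; split=> //.
- move=> i hi; rewrite -nth_shape sT; apply: (allP o1); apply: mem_nth.
  by rewrite -sT size_map.
- move=> i j; rewrite /entry /= rT nth_cat size_nseq size_cat size_nseq.
  case: ltnP => h; first by rewrite nth_nseq h eqxx.
  have [hj|hj] := ltnP (j - nth 0 la i) (size (nonzero (nth [::] T i))).
    have := mem_nth 0 hj; rewrite mem_filter => /andP[/negbTE -> _] /=.
    by rewrite leqNgt -ltn_subLR // hj.
  by rewrite nth_default ?eqxx //= leqNgt -ltn_subLR // -leqNgt hj.
- by move=> i; rewrite rT size_cat size_nseq leq_addr.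
- move=> b b' h e; apply: (@uniq_map_inj _ _ (entry T) (boxes T)); rewrite ?mem_boxes -?e //.
  by rewrite map_entry_boxes (perm_uniq pT) iota_uniq.
- move=> b; case: (posnP (entry T b)) => [->//|h].
  have : entry T b \in [seq entry T b | b <- boxes T] by rewrite map_f // mem_boxes -lt0n.
  by rewrite map_entry_boxes (perm_mem pT) mem_iota; lia.
- move=> m hm; have : m \in [seq entry T b | b <- boxes T].
    by rewrite map_entry_boxes (perm_mem pT) mem_iota; lia.
  by case/mapP=> b _ ->; exists b.
Qed.

End Interface.

(** * P11 *)

Definition addables (z : seq nat) : seq nat :=
  [seq c <- undup (0 :: map S z) | addable z c].

Lemma mem_addables z c : (c \in addables z) = addable z c.
Proof.
rewrite mem_filter mem_undup; apply: andb_idr; rewrite /addable inE.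
case: c => //= c h; have : c \in z by rewrite -mult_gt0; lia.
exact: map_f.
Qed.

Fixpoint words (z : seq nat) (n : nat) : seq (seq nat) :=
  if n is m.+1 then [seq c :: w | c <- addables z, w <- words (c :: z) m]
  else [:: [::]].

Lemma mem_words z n w : (w \in words z n) = (size w == n) && lat z w.
Proof.
elim: n z w => [|n IHn] z w /=; first by case: w.
apply/allpairsPdep/andP => [[c [w' [hc hw ->]]]|[]].
  by move: hw; rewrite IHn mem_addables in hc * => /andP[/eqP <- hw]; rewrite /= hc.
case: w => // c w /eqP[sw] /andP[hc hw]; exists c, w.
by rewrite mem_addables IHn sw eqxx.
Qed.

Lemma words_uniq z n : uniq (words z n).
Proof.
elim: n z => //= n IHn z; apply: allpairs_uniq_dep.
- by rewrite filter_uniq // undup_uniq.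
- by move=> c _; apply: IHn.
- by move=> [c w] [d w'] _ _ /= [-> ->].
Qed.

Lemma words_perm z z' n : perm_eq z z' -> perm_eq (words z n) (words z' n).
Proof.
move=> pz; apply: uniq_perm; rewrite ?words_uniq // => w.
by rewrite !mem_words (lat_perm _ pz).
Qed.

Lemma column_of_entry la n T i j m : std_filling la n T -> 0 < m ->
  entry T (i, j) = m -> column_of T m = j.
Proof.
move=> hT m0 e; have hb : (i, j) \in boxes T by rewrite mem_boxes e -lt0n.
have hm : m \in [seq entry T b | b <- boxes T] by rewrite -e map_f.
rewrite /column_of; set k := index _ _.
have hk : k < size (boxes T) by rewrite -(size_map (entry T)) index_mem.
suff -> : nth (0, 0) (boxes T) k = (i, j) by [].
have ek : entry T (nth (0, 0) (boxes T) k) = m.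
  by rewrite -(nth_map _ 0) // nth_index.
by apply: (std_inj hT); rewrite ek ?e // -lt0n.
Qed.

Lemma fill_entry row ok T n w k : row_choice row ok -> ok (shape T) ->
  lat (colword (shape T)) w -> 0 < n -> k < size w ->
  exists i, entry (fill row T (numbered n w)) (i, nth 0 w k) = n + k.
Proof.
move=> hrow okT + n0; elim/last_ind: w => // w c IHw; rewrite lat_rcons => /andP[hw hc].
have [e1 e2 e3] := shape_fill n hrow okT hw.
have [] := hrow _ c e2; first by rewrite (addable_perm _ e3).
rewrite size_rcons ltnS numbered_rcons fill_rcons /= -e1.
set U := fill _ _ _; set r := row _ _ => h1 h2 h3.
rewrite leq_eqVlt => /orP[/eqP ->|kw].
  by exists r; rewrite nth_rcons ltnn eqxx entry_put -nth_shape h2 eqxx.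
have [i ei] := IHw hw kw; exists i; rewrite nth_rcons kw entry_put -/U ei.
case: eqP => // -[ir e]; move: ei; rewrite e ir entry_out //; lia.
Qed.

Definition word_of (n : nat) (T : tableau) : seq nat :=
  [seq column_of T m | m <- iota 1 n].

Lemma word_of_fill row ok la w : row_choice row ok -> ok la -> all (leq 1) la ->
  lat (colword la) w ->
  word_of (size w) (fill row (zeros la) (numbered 1 w)) = w.
Proof.
move=> hrow okla la1 hw.
have sT : std_filling la (0 + size w) (fill row (zeros la) (numbered 1 w)).
  by apply: (std_fill hrow) => //; rewrite ?shape_zeros //; apply: std_zeros.
apply: (@eq_from_nth _ 0); rewrite size_map size_iota // => k hk.
rewrite (nth_map 0) ?size_iota // nth_iota // add1n.
have := @fill_entry row ok (zeros la) 1 w k hrow.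
rewrite shape_zeros => /(_ okla hw isT hk)[i].
by rewrite add1n; apply: (column_of_entry sT).
Qed.

Lemma size_colword s : size (colword s) = sumn s.
Proof. by rewrite size_flatten /shape -map_comp (eq_map (g := id)) ?map_id // => p /=; rewrite size_iota. Qed.

Theorem SYT_perm nu la : is_part nu -> is_part la ->
  perm_eq (SYT nu la)
    [seq fill part_row (zeros la) (numbered 1 w) |
       w <- words (colword la) (sumn nu - sumn la)
     & perm_eq (w ++ colword la) (colword nu)].
Proof.
move=> hnu hla; have /andP[_ la1] := hla; have /andP[_ nu1] := hnu.
apply: uniq_perm.
- rewrite /SYT; case: ifP => // sub; rewrite filter_uniq //.
  have sub' i : nth 0 la i <= nth 0 nu i.
    rewrite leqNgt; apply/negP => h; have := allP sub (i, nth 0 nu i).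
    by rewrite mem_cells /in_diagram /= h ltnn => /(_ isT).
  apply: standard_fillings_uniq => //.
  rewrite leqNgt; apply/negP => h; have := sub' (size nu).
  by rewrite (nth_default 0 (leqnn _)) leqn0 => /eqP e; have := allP la1 _ (mem_nth 0 h); rewrite e.
- rewrite map_inj_in_uniq ?filter_uniq ?words_uniq // => w w'.
  rewrite !mem_filter !mem_words => /and3P[_ /eqP sw hw] /and3P[_ /eqP sw' hw'] e.
  rewrite -(word_of_fill part_row_choice hla la1 hw) e sw -sw'.
  exact: word_of_fill part_row_choice hla la1 hw'.
move=> T; apply/idP/mapP.
  rewrite /SYT; case: ifP => // sub; rewrite mem_filter => /andP[cond mT].
  have sub' i : nth 0 la i <= nth 0 nu i.
    rewrite leqNgt; apply/negP => h; have := allP sub (i, nth 0 nu i).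
    by rewrite mem_cells /in_diagram /= h ltnn => /(_ isT).
  have szs : size la <= size nu.
    rewrite leqNgt; apply/negP => h; have := sub' (size nu).
    by rewrite (nth_default 0 (leqnn _)) leqn0 => /eqP e; have := allP la1 _ (mem_nth 0 h); rewrite e.
  have sT : std_filling la (sumn nu - sumn la) T.
    apply: mem_fillings_std mT _ => // i j h; case: (posnP (entry T (i, j))) => [->|h0].
      by rewrite lt0n.
    have := allP cond (i, j); rewrite mem_boxes -lt0n h0 => /(_ isT) /andP[+ _].
    by rewrite mem_boxes h.
  have [shT _ _] := (mem_standard_fillings sub' szs T).1 mT.
  have cT : columns_increase T.
    move=> i j h; case: (posnP (entry T (i, j))) => [->|h0]; first by rewrite lt0n.
    have := allP cond (i, j); rewrite mem_boxes -lt0n h0 => /(_ isT) /andP[_].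
    by rewrite mem_boxes h.
  have [|w [sw lw eT]] := part_tableau_word hla _ sT cT; first by rewrite shT.
  exists w => //; rewrite mem_filter mem_words sw eqxx lw !andbT.
  have [_ _ _ _] := part_fill hla lw; rewrite -eT shT perm_sym //.
move=> [w]; rewrite mem_filter mem_words => /and3P[pw /eqP sw hw] ->.
have [h1 h2 h3 h4 h5] := part_fill hla hw; set U := fill _ _ _ in h1 h2 h3 h4 h5 *.
have sU : shape U = nu by apply: part_colword_inj => //; apply: (perm_trans h5).
have sub' i : nth 0 la i <= nth 0 nu i by rewrite -sU nth_shape (std_sub h1).
have szs : size la <= size nu.
  rewrite leqNgt; apply/negP => h; have := sub' (size nu).
  by rewrite (nth_default 0 (leqnn _)) leqn0 => /eqP e; have := allP la1 _ (mem_nth 0 h); rewrite e.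
rewrite /SYT ifT; last first.
  apply/allP => b; rewrite mem_cells /in_diagram => h; exact: leq_trans h (sub' _).
rewrite mem_filter; apply/andP; split; last by apply: std_mem_fillings h1.
apply/allP => -[i j]; rewrite mem_boxes /= => _; rewrite !mem_boxes.
by apply/andP; split; apply/implyP => h; [apply: (std_row h1) | apply: h4].
Qed.

(** * P12 *)

Lemma last_index_eq c s i : i < size s -> nth 0 s i = c ->
  (forall k, i < k < size s -> nth 0 s k != c) -> last_index c s = i.
Proof.
move=> hi ei hlast; have cs : c \in s by rewrite -ei mem_nth.
have [h1 h2 h3] := last_indexP cs.
case: (ltngtP (last_index c s) i) => // h.
  by have := h3 i; rewrite h hi ei eqxx => /(_ isT).
by have := hlast (last_index c s); rewrite h h1 h2 eqxx => /(_ isT).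
Qed.

Lemma comp_row_choice : row_choice comp_row (all (leq 1)).
Proof.
move=> s c s1 ha; have gp := grow_positive s1 ha.
move: ha gp; rewrite addable_colword /comp_row; case: eqP => [-> _|_ /= cs] gp.
  by rewrite leqnn nth_default.
by have [h1 h2 _] := last_indexP cs; rewrite ltnW.
Qed.

Definition first_column_increases (T : tableau) : Prop :=
  forall i, i.+1 < size T -> entry T (i, 0) < entry T (i.+1, 0).

Definition triple_rule (T : tableau) : Prop :=
  forall i j k, j < i -> entry T (j, k.+1) != 0 -> k < size (nth [::] T i) ->
  entry T (i, k) <= entry T (j, k.+1) ->
  (k.+1 < size (nth [::] T i)) && (entry T (i, k.+1) < entry T (j, k.+1)).

Lemma triple_put la n T c : std_filling la n T -> all (leq 1) (shape T) ->
  addable (colword (shape T)) c -> triple_rule T ->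
  triple_rule (put (comp_row (shape T) c) n.+1 T).
Proof.
move=> sT s1 ha ht; have [h1 h2 _] := comp_row_choice s1 ha.
set r := comp_row _ _ in h1 h2 *; set U := put _ _ _.
have eU b : entry U b = if b == (r, c) then n.+1 else entry T b.
  by rewrite entry_put -nth_shape h2.
move=> i j k ji; rewrite (eU (j, k.+1)) nth_put.
case: ((j, k.+1) =P (r, c)) => [[jr kc] _|nj h0].
  have ir : (i == r) = false by rewrite -jr gtn_eqF.
  rewrite ir !eU !xpair_eqE ir /= => ik _.
  rewrite ltnS (std_max sT) andbT ltn_neqAle ik andbT -nth_shape.
  have c0 : (c == 0) = false by rewrite -kc.
  have cs : c \in shape T by move: ha; rewrite addable_colword c0.
  have [_ _ hl] := last_indexP cs; rewrite kc eq_sym; apply: hl.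
  have -> : last_index c (shape T) = r by rewrite /r /comp_row c0.
  rewrite -jr ji size_map ltnNge; apply/negP => h.
  by move: ik; rewrite (nth_default [::]).
rewrite (eU (i, k)); case: ((i, k) =P (r, c)) => [_ _|nik ik le].
  by have := std_max sT (j, k.+1); lia.
have ik' : k < size (nth [::] T i).
  move: ik; case: (eqVneq i r) => // ir; rewrite size_rcons ltnS leq_eqVlt -ir.
  by case/orP=> // /eqP e; case: nik; rewrite e ir -nth_shape h2.
have /andP[h3 h4] := ht _ _ _ ji h0 ik' le.
rewrite eU; case: ((i, k.+1) =P (r, c)) => [[ir kc]|_].
  by move: h3; rewrite ir -nth_shape h2 kc ltnn.
rewrite h4 andbT; case: (eqVneq i r) => // ir.
by rewrite size_rcons -ir leqW.
Qed.

Lemma first_column_put n T c : std_filling [::] n T -> all (leq 1) (shape T) ->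
  addable (colword (shape T)) c -> first_column_increases T ->
  first_column_increases (put (comp_row (shape T) c) n.+1 T).
Proof.
move=> sT s1 ha hf; have [h1 h2 _] := comp_row_choice s1 ha.
set r := comp_row _ _ in h1 h2 *; set U := put _ _ _.
have eU b : entry U b = if b == (r, c) then n.+1 else entry T b.
  by rewrite entry_put -nth_shape h2.
have old b : b != (r, c) -> entry U b = entry T b by move=> /negbTE e; rewrite eU e.
move=> i; rewrite size_put; case: (posnP c) => [c0|c0].
  have rE : r = size T by rewrite /r /comp_row c0 /= size_map.
  rewrite rE (maxn_idPl _) ?ltnS //= leq_eqVlt => /orP[/eqP iE|iT].
    rewrite (eU (i.+1, 0)) c0 rE iE eqxx old ?ltnS ?(std_max sT) //.
    by rewrite xpair_eqE negb_and; apply/orP; left; lia.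
  rewrite !old ?hf // xpair_eqE negb_and; apply/orP; left; lia.
have : r < size T.
  rewrite ltnNge; apply/negP => h; move: h2; rewrite nth_default ?size_map //.
  by move=> e; rewrite -e in c0.
move/maxn_idPr => -> iT.
by rewrite !old ?hf // xpair_eqE negb_and; apply/orP; right; lia.
Qed.

Lemma comp_peel n T r j : std_filling [::] n.+1 T ->
  first_column_increases T -> triple_rule T -> entry T (r, j) = n.+1 ->
  [/\ j = 0 -> r.+1 = size T, first_column_increases (unput r T) /\ triple_rule (unput r T),
      addable (colword (shape (unput r T))) j &
      comp_row (shape (unput r T)) j = r].
Proof.
move=> sT hf ht hr; have hl := peel_last sT hr.
have rT := peel_row_lt sT hr.
have hj : j = 0 -> r.+1 = size T.
  move=> j0; move: (rT); rewrite leq_eqVlt => /orP[/eqP//|h].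
  by have := hf _ h; have := std_max sT (r.+1, 0); rewrite -{2}j0 hr; lia.
have eU := entry_unput sT hr hj; have sU := size_unput sT hr.
have nU i : nth 0 (shape (unput r T)) i = if i == r then j else nth 0 (shape T) i.
  rewrite !nth_shape (nth_unput sT hr hj); case: eqP => // _.
  by rewrite size_take -hl ltnSn.
have old b : entry (unput r T) b != 0 -> entry (unput r T) b = entry T b /\ entry T b <= n.
  rewrite eU; case: (b =P _) => // ne h; split=> //.
  have := std_max sT b; rewrite leq_eqVlt => /orP[/eqP e|//].
  by case: ne; apply: (std_inj sT); rewrite ?e ?hr.
have jsh : 0 < j -> j \in shape (unput r T).
  move=> j0; have <- : nth 0 (shape (unput r T)) r = j by rewrite nU eqxx.
  by rewrite mem_nth // size_map sU gtn_eqF.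
split=> //.
- split=> [i|i j' k ji h1].
    rewrite sU !eU !xpair_eqE; case: (eqVneq j 0) => [j0|j0] iT.
      by rewrite !ltn_eqF ?(ltnW iT) //=; apply: hf; apply: ltn_trans rT.
    by rewrite !andbF; apply: hf.
  have [e1 m1] := old _ h1; rewrite e1 in h1 m1 *.
  rewrite -nth_shape nU (eU (i, k)); case: (eqVneq i r) => [ir kj|ir].
    rewrite ir xpair_eqE (ltn_eqF kj) andbF => le.
    have kT : k < size (nth [::] T r) by rewrite -hl ltnW // ltnS ltnW.
    rewrite -ir in kT le; have /andP[h3 h4] := ht _ _ _ ji h1 kT le.
    rewrite eU; case: ((r, k.+1) =P (r, j)) => [e|ne].
      by move: h4; rewrite ir e hr; lia.
    rewrite -ir h4 andbT; move: h3; rewrite ir -hl ltnS leq_eqVlt => /orP[/eqP e|//].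
    by case: ne; rewrite e.
  rewrite nth_shape xpair_eqE (negbTE ir) => kT le.
  by rewrite eU xpair_eqE (negbTE ir); apply: ht.
- rewrite addable_colword; case: (posnP j) => // j0; exact: jsh.
rewrite /comp_row; case: (eqVneq j 0) => [j0|j0]; first by rewrite size_map sU j0.
apply: last_index_eq; rewrite ?size_map ?sU ?(negbTE j0) // ?nU ?eqxx //.
move=> i /andP[ri iT]; rewrite nU (gtn_eqF ri) nth_shape; apply/negP => /eqP e.
case: j j0 hr e {hl hj eU sU nU old jsh} => // k _ hr e.
have := ht i r k ri; rewrite hr e ltnSn (std_max sT) => /(_ isT isT isT) /andP[].
by rewrite ltnn.
Qed.

Theorem comp_tableau_word n T : std_filling [::] n T ->
  first_column_increases T -> triple_rule T ->
  exists w, [/\ size w = n, lat [::] w & T = fill comp_row [::] (numbered 1 w)].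
Proof.
elim: n T => [|n IHn] T sT hf ht.
  by exists [::]; split=> //=; apply: (std_filling0 (la := [::])).
have [|[r j] hr] := std_surj sT (m := n.+1); first by rewrite ltnS leqnn.
have [hj [hfU htU] ha er] := comp_peel sT hf ht hr.
have [w [sw lw eT]] := IHn _ (std_unput sT hr hj) hfU htU.
have [e1 e2 e3] := @shape_fill comp_row (all (leq 1)) [::] w 1 comp_row_choice isT lw.
exists (rcons w j); split; first by rewrite size_rcons sw.
  by rewrite lat_rcons lw -(addable_perm _ e3) -e1 -eT.
by rewrite numbered_rcons fill_rcons -eT /= er add1n sw (put_unput sT hr hj).
Qed.

Lemma comp_fill la w : all (leq 1) la -> lat (colword la) w ->
  let T := fill comp_row (zeros la) (numbered 1 w) in
  [/\ std_filling la (size w) T, shape T = foldl grow la w,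
      all (leq 1) (shape T), triple_rule T &
      perm_eq (colword (shape T)) (w ++ colword la)].
Proof.
move=> la1 hw /=; set T := fill _ _ _.
have std u : lat (colword la) u ->
    std_filling la (size u) (fill comp_row (zeros la) (numbered 1 u)).
  move=> hu; rewrite -[size u]add0n; apply: (std_fill comp_row_choice) => //.
  - by rewrite shape_zeros.
  - by rewrite shape_zeros.
  - exact: std_zeros.
have := @shape_fill comp_row (all (leq 1)) (zeros la) w 1 comp_row_choice.
rewrite shape_zeros => /(_ la1 hw)[e1 e2 e3]; rewrite -/T in e1.
split; rewrite ?e1 //; first exact: std.
rewrite /T; elim/last_ind: w hw {T e1 e2 e3} => [|w c IHw].
  by move=> _ i j k _; rewrite entry_zeros.
rewrite lat_rcons => /andP[hw hc].
have := @shape_fill comp_row (all (leq 1)) (zeros la) w 1 comp_row_choice.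
rewrite shape_zeros => /(_ la1 hw)[e1 e2 e3].
rewrite numbered_rcons fill_rcons /= add1n; apply: (triple_put (std _ hw)).
- by rewrite e1.
- by rewrite e1 (addable_perm _ e3).
exact: IHw.
Qed.

Lemma first_column_fill w : lat [::] w ->
  first_column_increases (fill comp_row [::] (numbered 1 w)).
Proof.
elim/last_ind: w => // w c IHw; rewrite lat_rcons => /andP[hw hc].
have [e1 e2 e3 _ e4] := @comp_fill [::] w isT hw.
rewrite numbered_rcons fill_rcons /= add1n; apply: first_column_put => //.
- by rewrite (addable_perm _ e4).
exact: IHw.
Qed.

(** * P13 *)

Lemma nats_positive (a : composition) : all (leq 1) (nats a).
Proof. by apply/allP => x /mapP[[p hp] _ ->]. Qed.

Lemma in_diagram_nil b : in_diagram [::] b = false.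
Proof. by rewrite /in_diagram nth_nil. Qed.

Lemma std_diagram n T b : std_filling [::] n T ->
  in_diagram (shape T) b = (entry T b != 0).
Proof.
move=> sT; case: b => i j; rewrite (std_zero sT) nth_nil ltn0 /= -ltnNge.
by rewrite /in_diagram nth_shape.
Qed.

Lemma le_ncols T i : size (nth [::] T i) <= ncols T.
Proof.
rewrite -nth_shape /ncols; elim: (shape T) i => [|x s IHs] [|i] //=.
  exact: leq_maxl.
by rewrite leq_max IHs orbT.
Qed.

Lemma is_ssyctP n T : std_filling [::] n T ->
  reflect (first_column_increases T /\ triple_rule T) (is_ssyct [::] T).
Proof.
move=> sT; have dg b := std_diagram b sT.
have r0 i : i < size T -> entry T (i, 0) != 0.
  by move=> hi; rewrite (std_zero sT) nth_nil ltn0 /= -ltnNge (std_rows sT).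
have nz i k : entry T (i, k) != 0 -> i < size T /\ k < ncols T.
  rewrite (std_zero sT) nth_nil ltn0 /= -ltnNge => h; split.
    by rewrite ltnNge; apply/negP => h'; move: h; rewrite (nth_default [::]).
  exact: leq_trans h (le_ncols T i).
have sz i k : (k < size (nth [::] T i)) = (entry T (i, k) != 0).
  by rewrite (std_zero sT) nth_nil ltn0 /= -ltnNge.
rewrite /is_ssyct; apply: (iffP and5P) => [[_ _ _ hf ht]|[hf ht]].
  split.
    move=> i hi; move: hf.
    rewrite (eq_in_filter (a2 := predT)); last first.
      move=> k; rewrite mem_iota /= => hk.
      by rewrite dg in_diagram_nil r0.
    rewrite filter_predT => /(sortedP 0)/(_ i); rewrite size_map size_iota => /(_ hi).
    by rewrite !(nth_map 0) ?size_iota ?(ltnW hi) // !nth_iota ?(ltnW hi).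
  move=> i j k ji h1; rewrite !sz => h2 le; have [iT _] := nz _ _ h2; have [jT kT] := nz _ _ h1.
  have := allP ht i; rewrite mem_iota /= => /(_ iT).
  move/allP/(_ j); rewrite mem_iota /= => /(_ jT).
  move/allP/(_ k); rewrite mem_iota /= => /(_ (ltnW kT)).
  by rewrite ji !dg !in_diagram_nil h1 h2 le /= andbT.
split=> //.
- by apply/allP => b; rewrite mem_cells dg => /negbTE->; rewrite in_diagram_nil.
- apply/allP => r /(nthP [::])[i hi <-]; apply/(sortedP 0) => j hj.
  have := std_row sT (i := i) (j := j); rewrite /entry /= => /(_ _) /ltnW; apply.
  have := std_zero sT i j.+1; rewrite /entry /= => ->.
  by rewrite nth_nil ltn0 /= -ltnNge.
- rewrite (eq_in_filter (a2 := predT)); last first.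
    move=> k; rewrite mem_iota /= => hk.
    by rewrite dg in_diagram_nil r0.
  rewrite filter_predT; apply/(sortedP 0) => i; rewrite size_map size_iota => hi.
  rewrite !(nth_map 0) ?size_iota ?(ltnW hi) // !nth_iota ?(ltnW hi) //.
  exact: hf.
apply/allP => i _; apply/allP => j _; apply/allP => k _; apply/implyP.
rewrite !dg !in_diagram_nil !andbT /= => /and3P[ji h1 /andP[h2 le]].
by rewrite -sz; apply: ht => //; rewrite sz.
Qed.

Theorem SYCT_perm (a : composition) :
  perm_eq (SYCT a) [seq fill comp_row [::] (numbered 1 w) |
                     w <- words [::] (weight a) & foldl grow [::] w == nats a].
Proof.
have sub i : nth 0 [::] i <= nth 0 (nats a) i by rewrite nth_nil.
apply: uniq_perm.
- by rewrite filter_uniq // standard_fillings_uniq.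
- rewrite map_inj_in_uniq ?filter_uniq ?words_uniq // => w w'.
  rewrite !mem_filter !mem_words => /and3P[_ /eqP sw hw] /and3P[_ /eqP sw' hw'] e.
  rewrite -(@word_of_fill _ _ [::] w comp_row_choice isT isT hw) e sw -sw'.
  exact: (@word_of_fill _ _ [::] w' comp_row_choice isT isT hw').
move=> T; apply/idP/mapP; rewrite mem_filter.
  case/andP=> cond mT; have [shT _ pT] := (mem_standard_fillings sub isT T).1 mT.
  have sT : std_filling [::] (weight a) T.
    apply: mem_fillings_std (mT) _ => //; rewrite ?subn0 ?nats_positive // => i j h.
    case/and5P: cond => _ _ /allP hrow _ _.
    have iT : i < size T by rewrite ltnNge; apply/negP => h'; move: h; rewrite /entry /= (nth_default [::]) ?nth_nil.
    have jT : j.+1 < size (nth [::] T i) by rewrite ltnNge; apply/negP => h'; move: h; rewrite /entry /= nth_default.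
    rewrite ltn_neqAle; apply/andP; split.
      apply/eqP => e; have : (i, j) = (i, j.+1) :> nat * nat.
        apply: (@uniq_map_inj _ _ (entry T) (boxes T)); rewrite ?mem_boxes ?e //.
        by rewrite map_entry_boxes (perm_uniq pT) iota_uniq.
      by case=> /eqP; rewrite ltn_eqF.
    have := hrow _ (mem_nth [::] iT); move/(sortedP 0); exact.
  have [hf ht] := is_ssyctP sT cond.
  have [w [sw lw eT]] := comp_tableau_word sT hf ht.
  exists w => //; rewrite mem_filter mem_words sw eqxx lw !andbT.
  by have [_ <- _ _ _] := @comp_fill [::] w isT lw; rewrite -eT shT.
case=> w; rewrite mem_filter mem_words => /and3P[/eqP ew /eqP sw lw] ->.
have [h1 h2 _ h4 _] := @comp_fill [::] w isT lw; have h3 := first_column_fill lw.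
set U := fill _ _ _ in h1 h2 h3 h4 *.
apply/andP; split; first by apply/(is_ssyctP h1).
by apply: std_mem_fillings h1; rewrite ?h2 ?subn0.
Qed.

(** * P14 *)

Definition positions (j : nat) (w : seq nat) : seq nat :=
  [seq k.+1 | k <- iota 0 (size w) & nth 0 w k == j].

Lemma positions_sorted j w : sorted ltn (positions j w).
Proof.
rewrite sorted_map; apply: sorted_filter; first by move=> a b c /=; apply: ltn_trans.
exact: iota_ltn_sorted.
Qed.

Lemma positions_rcons j w c : positions j (rcons w c) =
  if c == j then rcons (positions j w) (size w).+1 else positions j w.
Proof.
rewrite /positions size_rcons -[in iota 0 _]addn1 iotaD filter_cat map_cat.
rewrite (eq_in_filter (a2 := fun k => nth 0 w k == j)); last first.
  by move=> k; rewrite mem_iota /= add0n nth_rcons => ->.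
by rewrite /= nth_rcons ltnn eqxx; case: (c == j); rewrite /= ?cats1 ?cats0.
Qed.

Lemma column_entriesP la n T j x : std_filling la n T ->
  reflect (x != 0 /\ exists i, entry T (i, j) = x) (x \in column_entries T j).
Proof.
move=> sT; rewrite mem_filter mem_sort; apply: (iffP andP) => [[x0 /mapP[r]]|[x0 [i e]]].
  rewrite mem_filter => /andP[jr /(nthP [::])[i hi er]] xe; split=> //.
  by exists i; rewrite /entry er xe.
split=> //; apply/mapP; exists (nth [::] T i); last by rewrite -e.
have jr : j < size (nth [::] T i).
  by rewrite ltnNge; apply/negP => h; rewrite -e entry_out in x0.
rewrite mem_filter jr mem_nth // ltnNge; apply/negP => h.
by rewrite nth_default in jr.
Qed.

Lemma column_entries_uniq la n T j : std_filling la n T -> uniq (column_entries T j).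
Proof.
move=> sT; rewrite -(perm_uniq (_ : perm_eq (nonzero [seq entry T (i, j) | i <- iota 0 (size T)]) _)).
  rewrite /nonzero filter_map map_inj_in_uniq ?filter_uniq ?iota_uniq // => i i'.
  rewrite !mem_filter /= => /andP[h _] _ e.
  by have [] := std_inj sT h e.
rewrite /column_entries /sorted_column.
have -> : [seq entry T (i, j) | i <- iota 0 (size T)] = [seq nth 0 r j | r <- T].
  by rewrite -[in RHS](mkseq_nth [::] T) /mkseq -map_comp.
have -> : nonzero [seq nth 0 r j | r <- T] = nonzero [seq nth 0 r j | r <- T & j < size r].
  elim: (T) => //= r U IHU; case: ltnP => h /=; first by rewrite IHU.
  by rewrite nth_default //= IHU.
by apply: perm_filter; rewrite perm_sym perm_sort.
Qed.

Theorem column_entries_fill row ok la w j : row_choice row ok -> ok la ->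
  all (leq 1) la -> lat (colword la) w ->
  column_entries (fill row (zeros la) (numbered 1 w)) j = positions j w.
Proof.
move=> hrow okla la1 hw; set T := fill _ _ _.
have sT : std_filling la (0 + size w) T.
  by apply: (std_fill hrow) => //; rewrite ?shape_zeros //; apply: std_zeros.
have ent k : k < size w -> exists i, entry T (i, nth 0 w k) = k.+1.
  move=> hk; have := @fill_entry row ok (zeros la) 1 w k hrow.
  by rewrite shape_zeros -/T => /(_ okla hw isT hk).
apply: (irr_sorted_eq ltn_trans ltnn); rewrite ?positions_sorted //.
  rewrite ltn_sorted_uniq_leq (column_entries_uniq _ sT) /=.
  by apply: sorted_filter; [exact: leq_trans | apply: sort_sorted; exact: leq_total].
move=> x; apply/(column_entriesP _ _ sT)/mapP => [[x0 [i e]]|[k]].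
  have := std_max sT (i, j); rewrite e add0n; case: x x0 e => // k _ e hk.
  exists k => //; rewrite mem_filter mem_iota hk /= andbT.
  have [i' e'] := ent k hk.
  have := std_inj sT (b := (i', nth 0 w k)) (b' := (i, j)).
  by rewrite e e' => /(_ isT erefl) [_ ->].
rewrite mem_filter mem_iota add0n => /andP[/eqP <- hk] ->; split=> //.
exact: ent.
Qed.

(* first column of a composition filling *)
Lemma size_fill_comp la w : all (leq 1) la -> lat (colword la) w ->
  let B := fill comp_row (zeros la) (numbered 1 w) in
  size B = size la + count_mem 0 w /\
  forall i, size la <= i -> entry B (i, 0) = nth 0 (positions 0 w) (i - size la).
Proof.
move=> la1; elim/last_ind: w => [|w c IHw] /=.
  move=> _; rewrite size_map addn0; split=> // i _.
  by rewrite entry_zeros nth_nil.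
rewrite lat_rcons => /andP[hw hc]; have [sB eB] := IHw hw.
have [_ _ s1 _ pc] := comp_fill la1 hw.
rewrite numbered_rcons fill_rcons /= add1n -/(fill _ _ _).
set B := fill _ _ _ in sB eB s1 pc *.
have hc' : addable (colword (shape B)) c by rewrite (addable_perm _ pc).
have [h1 h2 _] := comp_row_choice s1 hc'; set r := comp_row _ _ in h1 h2 *.
have sp : size (positions 0 w) = count_mem 0 w.
  by rewrite size_map size_filter -[in RHS](mkseq_nth 0 w) /mkseq count_map.
have c0r : c = 0 -> r = size B by move=> c0; rewrite /r /comp_row c0 /= size_map.
have rB : 0 < c -> r < size B.
  move=> c0; rewrite -(size_map size B) -/(shape B) ltnNge; apply/negP => h.
  by move: h2 c0; rewrite nth_default // => <-.
split=> [|i hi].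
  rewrite size_put -cats1 count_cat /=; case: (posnP c) => c0.
    by rewrite (c0r c0) (maxn_idPl (leqnSn _)) sB addn0 addnA addn1.
  by rewrite (maxn_idPr (rB c0)) sB !addn0.
rewrite entry_put -nth_shape h2 eB // positions_rcons xpair_eqE.
case: (posnP c) => c0; last first.
  by rewrite (ltn_eqF c0) andbF.
rewrite c0 eqxx andbT nth_rcons sp; case: eqP => [->|ne].
  by rewrite (c0r c0) sB addKn ltnn eqxx.
case: ltngtP => //.
  by move=> h; rewrite nth_default // sp ltnW.
move=> e; case: ne; rewrite (c0r c0) sB -e subnKC //.
Qed.

(** * P15 *)

Lemma filter_iota_last (p : pred nat) N i : i < N -> p i ->
  (forall k, i < k < N -> ~~ p k) ->
  [seq k <- iota 0 N | p k] = rcons [seq k <- iota 0 i | p k] i.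
Proof.
move=> iN pi hp; rewrite -(subnKC (ltnW iN)) iotaD filter_cat add0n -cats1.
have -> : N - i = (N - i.+1).+1 by lia.
rewrite /= pi; congr (_ ++ _ :: _); apply/eqP.
rewrite -size_eq0 size_filter -leqn0 leqNgt -has_count; apply/hasPn => k.
by rewrite mem_iota => hk; apply: hp; lia.
Qed.

Section RhoInv.
Variables (a w : seq nat).
Hypotheses (a1 : all (leq 1) a) (hw : lat (colword a) w).
Let B := fill comp_row (zeros a) (numbered 1 w).

Let kept (j x i : nat) : nat :=
  if (j < size (nth [::] B i)) && (entry B (i, j) < x) then maxn (nth 0 a i) j.+1
  else maxn (nth 0 a i) j.

Let stage (j x : nat) (rows : tableau) : Prop :=
  size rows = size B /\
  forall i, nth [::] rows i = take (kept j x i) (nth [::] B i).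

Let sB : std_filling a (size w) B.
Proof. by have [] := comp_fill a1 hw. Qed.

Let tB : triple_rule B.
Proof. by have [] := comp_fill a1 hw. Qed.

Lemma stage_skip j x rows : (forall i, entry B (i, j) != x) ->
  stage j x rows -> stage j x.+1 rows.
Proof.
move=> hx [h1 h2]; split=> // i; rewrite h2 /kept ltnS (leq_eqVlt (entry _ _)).
by rewrite (negbTE (hx i)).
Qed.

Lemma stage_place j x rows r : 0 < j -> 0 < x -> entry B (r, j) = x ->
  stage j x rows -> stage j x.+1 (place j rows x).
Proof.
move=> j0 x0 er [szr hr].
have nz : entry B (r, j) != 0 by rewrite er -lt0n.
have [ar jr] : nth 0 a r <= j /\ j < size (nth [::] B r).
  by move: nz; rewrite (std_zero sB) negb_or -leqNgt -ltnNge => /andP[].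
have kr : kept j x r = j by rewrite /kept er ltnn andbF; apply/maxn_idPr.
have lastE i : j <= size (nth [::] B i) -> last 0 (take j (nth [::] B i)) = entry B (i, j.-1).
  by move=> h; rewrite (last_nth 0) size_takel // -[in LHS](prednK j0) /= nth_take ?prednK.
have okr : (size (nth [::] rows r) == j) && (last 0 (nth [::] rows r) <= x).
  rewrite hr kr size_takel ?(ltnW jr) // eqxx lastE ?(ltnW jr) //= ltnW //.
  by rewrite -er -[in entry B (r, j)](prednK j0) (std_row sB) // prednK.
have nok i : r < i < size rows ->
    ~~ ((size (nth [::] rows i) == j) && (last 0 (nth [::] rows i) <= x)).
  case/andP=> ri iT; apply/negP; rewrite hr /kept.
  case: ifP => [/andP[h _]|ni].
    have := std_sub sB i; rewrite size_take; case: ifP => h' h2 /andP[/eqP e _]; lia.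
  set L := maxn _ _ => /andP[/eqP e]; have jL : j <= L by apply: leq_maxr.
  have js : j <= size (nth [::] B i).
    by rewrite -e size_take_min geq_minr.
  have -> : take L (nth [::] B i) = take j (nth [::] B i).
    by rewrite -[LHS](take_oversize (n := j)) ?e // take_takel.
  rewrite lastE // => hl; have := tB ri (k := j.-1); rewrite !prednK // er -lt0n x0.
  by rewrite ni => /(_ isT js hl).
have rT : r < size rows.
  rewrite szr ltnNge; apply/negP => h; by rewrite nth_default in jr.
have -> : place j rows x = put r x rows.
  rewrite /place (filter_iota_last rT okr nok).
  by case E : [seq _ <- _ | _] => [|i0 s] //=; rewrite last_rcons.
split; first by rewrite size_put (maxn_idPr rT).
move=> i; rewrite nth_put; case: (eqVneq i r) => [->|ir].
  rewrite hr kr /kept er ltnSn jr /= (maxn_idPr _) ?(leqW ar) //.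
  by rewrite -er (take_nth 0).
rewrite hr /kept ltnS (leq_eqVlt (entry _ _)); case: (entry B (i, j) =P x) => [e|] //.
by have := std_inj sB nz (b' := (i, j)); rewrite er e => /(_ erefl) [ri]; rewrite ri eqxx in ir.
Qed.

Let hentry k : k < size w -> exists i, entry B (i, nth 0 w k) = k.+1.
Proof.
move=> hk; have := @fill_entry comp_row (all (leq 1)) (zeros a) 1 w k comp_row_choice.
by rewrite shape_zeros -/B => /(_ a1 hw isT hk).
Qed.

Lemma stage_column j rows : 0 < j -> stage j 1 rows ->
  stage j.+1 1 (foldl (place j) rows (positions j w)).
Proof.
move=> j0 st0; suff : stage j (size w).+1 (foldl (place j) rows (positions j w)).
  case=> h1 h2; split=> // i; rewrite h2 /kept ltnS (std_max sB) andbT.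
  case: ltnP => h.
    case: ifP => [/andP[h' e]|_] //; rewrite ltnS leqn0 in e.
    move: e; rewrite (std_zero sB) => /orP[e|]; last by rewrite leqNgt h'.
    by rewrite !(maxn_idPl _) // ltnW.
  by rewrite ltnNge (leqW h) /= !take_oversize // leq_max ?h ?(leqW h) orbT.
rewrite /positions; move: (leqnn (size w)); move: {-2}(size w) => m.
elim: m => [|m IHm] hm; first by [].
rewrite -[in iota 0 _]addn1 iotaD filter_cat map_cat foldl_cat add0n /=.
have := IHm (ltnW hm); set rows' := foldl _ _ _ => st.
have [i ei] := hentry hm.
case: (nth 0 w m =P j) => [e|ne] /=.
  by rewrite e in ei; apply: (stage_place _ _ ei).
apply: stage_skip st => i'; apply/eqP => e; apply: ne.
have := std_inj sB (b := (i, nth 0 w m)) (b' := (i', j)).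
by rewrite ei e => /(_ isT erefl) [_ ->].
Qed.

Lemma stage_init : stage 1 1 (zeros a ++ [seq [:: x] | x <- positions 0 w]).
Proof.
have [szB eB] := size_fill_comp a1 hw; rewrite -/B in szB eB.
have sp : size (positions 0 w) = count_mem 0 w.
  by rewrite size_map size_filter -[in RHS](mkseq_nth 0 w) /mkseq count_map.
split; first by rewrite size_cat !size_map -[size (filter _ _)](size_map S) sp szB.
move=> i; rewrite nth_cat size_map; case: ltnP => hi.
  rewrite (nth_map 0) //.
  have ai : 0 < nth 0 a i by apply: (allP a1); apply: mem_nth.
  have zero k : k < nth 0 a i -> entry B (i, k) = 0.
    by move=> hk; apply/eqP; rewrite (std_zero sB) hk.
  have -> : kept 1 1 i = nth 0 a i.
    rewrite /kept (maxn_idPl ai); case: ifP => // /andP[h e]; apply/maxn_idPl.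
    by move: e; rewrite ltnS leqn0 (std_zero sB) => /orP[|] //; rewrite leqNgt h.
  apply: (@eq_from_nth _ 0); rewrite size_nseq; first by rewrite size_takel // (std_sub sB).
  move=> k hk.
  by rewrite nth_nseq hk nth_take // -[RHS]/(entry B (i, k)) zero.
have [h|h] := ltnP (i - size a) (size (positions 0 w)); last first.
  rewrite (nth_default [::]) ?(size_map (fun x => [:: x])) //.
  by rewrite [nth [::] B i]nth_default // szB -sp; move: h; lia.
rewrite (nth_map 0) // -eB // /kept.
have a0 : nth 0 a i = 0 by rewrite nth_default.
have iB : i < size B by rewrite szB -sp; lia.
have r0 := std_rows sB iB.
have -> : (1 < size (nth [::] B i)) && (entry B (i, 1) < 1) = false.
  apply/negP => /andP[h1]; rewrite ltnS leqn0 (std_zero sB) a0 ltn0 /=.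
  by rewrite leqNgt h1.
rewrite a0 max0n /entry /=; case: (nth [::] B i) r0 => //= y s _.
by rewrite take0.
Qed.

Lemma stage_columns J :
  stage J.+1 1 (foldl (fun rows j => foldl (place j) rows (positions j w))
    (zeros a ++ [seq [:: x] | x <- positions 0 w]) (iota 1 J)).
Proof.
elim: J => [|J IHJ]; first exact: stage_init.
have -> : iota 1 J.+1 = iota 1 J ++ [:: J.+1] by rewrite -[in LHS](addn1 J) iotaD add1n.
by rewrite foldl_cat; apply: stage_column.
Qed.

Theorem rho_inv_fill la : is_part la -> perm_eq la a ->
  rho_inv a (fill part_row (zeros la) (numbered 1 w)) = B.
Proof.
move=> hla pla; set S := fill _ _ _.
have pc : perm_eq (colword la) (colword a) by apply: perm_flatten; apply: perm_map.
have hwl : lat (colword la) w by rewrite (lat_perm _ pc).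
have [sS _ _ _ _] := part_fill hla hwl; rewrite -/S in sS.
have ce j : column_entries S j = positions j w.
  by apply: (column_entries_fill _ part_row_choice) => //; case/andP: hla.
have ef l R : foldl (fun rows j => foldl (place j) rows (column_entries S j)) R l =
    foldl (fun rows j => foldl (place j) rows (positions j w)) R l.
  by elim: l R => //= j l IHl R; rewrite ce IHl.
rewrite /rho_inv ce ef; have [h1 h2] := stage_columns (ncols S).-1.
apply: (@eq_from_nth _ [::]) => // i _; rewrite h2 take_oversize //.
set J := (ncols S).-1.+1.
have le : size (nth [::] B i) <= maxn (nth 0 a i) J.
  rewrite leq_max; case: leqP => //= h.
  have : entry B (i, (size (nth [::] B i)).-1) != 0.
    by rewrite (std_zero sB); lia.
  set c := _.-1 => ec; have [m em] : exists m, entry B (i, c) = m.+1.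
    by exists (entry B (i, c)).-1; rewrite prednK // lt0n.
  have hm : m < size w by have := std_max sB (i, c); rewrite em.
  have [i' ei'] := hentry hm.
  have := std_inj sB ec (b' := (i', nth 0 w m)); rewrite em ei' => /(_ erefl)[_ ecm].
  have [i2 e2] : exists i2, entry S (i2, c) = m.+1.
    have := @fill_entry part_row is_part (zeros la) 1 w m part_row_choice.
    by rewrite shape_zeros -/S -ecm => /(_ hla hwl isT hm).
  have : c < size (nth [::] S i2).
    by rewrite ltnNge; apply/negP => h'; move: e2; rewrite entry_out.
  have := le_ncols S i2; rewrite /J /c; lia.
apply: (leq_trans le); rewrite /kept; case: ifP => _ //.
by rewrite geq_max leq_maxl leq_max leqnSn orbT.
Qed.

End RhoInv.

(** * P16 *)

Lemma set_nth_size (A : Type) (x0 : A) s b : set_nth x0 s (size s) b = rcons s b.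
Proof. by elim: s => //= y s ->. Qed.

Lemma set_nth_rcons_size (A : Type) (x0 : A) s a b :
  set_nth x0 (rcons s a) (size s) b = rcons s b.
Proof. by elim: s => //= y s ->. Qed.

Lemma set_nth_rcons (A : Type) (x0 : A) s a j b : j < size s ->
  set_nth x0 (rcons s a) j b = rcons (set_nth x0 s j b) a.
Proof. by elim: s j => // y s IHs [|j] //= /IHs ->. Qed.

Lemma put_comm r v r' v' (T : tableau) : r != r' -> put r v (put r' v' T) = put r' v' (put r v T).
Proof.
move=> ne; apply: (@eq_from_nth _ [::]); first by rewrite !size_put maxnCA.
have ne' : r' != r by rewrite eq_sym.
move=> i _; rewrite !nth_put (negbTE ne) (negbTE ne').
by case: (eqVneq i r) => // ->; rewrite (negbTE ne).
Qed.

Lemma nth_set_entry T i j x k : nth [::] (set_entry T i j x) k =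
  if k == i then set_nth 0 (nth [::] T i) j x else nth [::] T k.
Proof. by rewrite nth_set_nth. Qed.

Lemma entry_in (T : tableau) i j : j < size (nth [::] T i) -> i < size T.
Proof. by move=> h; rewrite ltnNge; apply/negP => h'; rewrite nth_default in h. Qed.

Lemma size_set_entry (T : tableau) i j x : i < size T -> size (set_entry T i j x) = size T.
Proof. by move=> h; rewrite size_set_nth; apply/maxn_idPr. Qed.

Lemma shape_set_entry (T : tableau) i j x : j < size (nth [::] T i) ->
  shape (set_entry T i j x) = shape T.
Proof.
move=> h; have hi := entry_in h.
apply: (@eq_from_nth _ 0); first by rewrite !size_map size_set_entry.
move=> k _; rewrite !nth_shape nth_set_entry; case: eqP => // ->.
by rewrite size_set_nth; apply/maxn_idPr.
Qed.

Lemma set_entry_put_new r v x (T : tableau) : r <= size T ->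
  set_entry (put r v T) r (size (nth [::] T r)) x = put r x T.
Proof.
move=> hr; apply: (@eq_from_nth _ [::]).
  by rewrite size_set_nth !size_put; lia.
move=> k _; rewrite nth_set_entry !nth_put eqxx; case: eqP => // _.
exact: set_nth_rcons_size.
Qed.

Lemma set_entry_put r v (T : tableau) i j x : j < size (nth [::] T i) ->
  set_entry (put r v T) i j x = put r v (set_entry T i j x).
Proof.
move=> h; have hi := entry_in h; apply: (@eq_from_nth _ [::]).
  by rewrite !(size_set_nth, size_put); lia.
move=> k _; rewrite nth_set_entry !nth_put !nth_set_entry.
case: (eqVneq k i) => [->|ki]; last by case: eqP => // kr; rewrite kr in ki *; rewrite (negbTE ki).
case: (eqVneq i r) => [<-|] //; rewrite ?eqxx; exact: set_nth_rcons.
Qed.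

Lemma set_entry_fill row (T : tableau) l i j x : j < size (nth [::] T i) ->
  set_entry (fill row T l) i j x = fill row (set_entry T i j x) l.
Proof.
elim: l T => //= p l IHl T h; rewrite -/(fill _ _ _) IHl.
  by rewrite set_entry_put // -[in row _](shape_set_entry x h).
rewrite nth_put; case: eqP => // <-; rewrite size_rcons; exact: ltnW.
Qed.

Lemma entry_fill row T n w b :
  entry (fill row T (numbered n w)) b = entry T b \/
  ~~ in_diagram (shape T) b /\ n <= entry (fill row T (numbered n w)) b.
Proof.
elim: w T n => [|c w IHw] T n; first by left.
rewrite numbered_cons /= -/(fill _ _ _); set r := row _ _.
have dg : in_diagram (shape T) b -> in_diagram (shape (put r n T)) b.
  rewrite /in_diagram !nth_shape nth_put; case: eqP => [->|_] //.
  by rewrite size_rcons => /ltnW.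
case: (IHw (put r n T) n.+1) => [->|[h1 h2]]; last first.
  right; split; last exact: ltnW.
  by apply: contra h1.
rewrite entry_put; case: eqP => [->|_]; last by left.
by right; rewrite leqnn /in_diagram nth_shape ltnn.
Qed.

Lemma part_row_incr s r c d : r <= size s -> nth 0 s r = c -> 
  part_row (incr_nth s r) d = part_row s d + (c == d).
Proof.
move=> hr hc; rewrite /part_row -!mult_colword (mult_perm _ (colword_incr_nth hr)).
by rewrite hc mult_cons addnC.
Qed.

Lemma slideS f T i j : slide f.+1 T i j =
  let right := entry T (i, j.+1) in
  let below := entry T (i.+1, j) in
  if (right == 0) && (below == 0) then
    [seq r <- set_nth [::] T i (take j (nth [::] T i)) | ~~ nilp r]
  else if (below == 0) || ((right != 0) && (right < below))
    then slide f (set_entry T i j right) i j.+1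
    else slide f (set_entry T i j below) i.+1 j.
Proof. by []. Qed.

Theorem slide_fill la m U h v w f : is_part (shape U) -> std_filling la m U ->
  lat (colword (shape U)) (h :: w) -> size w <= f ->
  slide f (fill part_row U ((h, v) :: numbered m.+1 w)) (part_row (shape U) h) h =
  fill part_row U (numbered m.+1 (push (colword (shape U)) h w).1).
Proof.
elim: w m U h v f => [|d w IHw] m U h v f pU sU hl hf.
  have /andP[ha _] := hl; have [h1 h2 _] := part_row_choice pU ha.
  set r := part_row _ _ in h1 h2 *; rewrite /= -/r.
  have srt : sorted geq (shape U) by case/andP: pU.
  have e1 : entry (put r v U) (r, h.+1) = 0.
    by apply: entry_out; rewrite nth_put eqxx size_rcons -nth_shape h2.
  have e2 : entry (put r v U) (r.+1, h) = 0.
    apply: entry_out; rewrite nth_put gtn_eqF // -nth_shape -h2.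
    exact: part_nth.
  have res : [seq row <- set_nth [::] (put r v U) r (take h (nth [::] (put r v U) r)) | ~~ nilp row] = U.
    rewrite nth_put eqxx; have -> : take h (rcons (nth [::] U r) v) = nth [::] U r.
      by rewrite -h2 nth_shape -cats1 take_cat ltnn subnn take0 cats0.
    rewrite /put set_set_nth eqxx.
    have all_ne : all (fun row : seq nat => ~~ nilp row) U.
      apply/(all_nthP [::]) => i hi; by rewrite /nilp -lt0n; apply: (std_rows sU).
    move: h1; rewrite size_map leq_eqVlt => /orP[/eqP rE|rU].
      have -> : set_nth [::] U r (nth [::] U r) = rcons U [::].
        by rewrite rE nth_default // set_nth_size.
      by rewrite -cats1 filter_cat /= cats0; apply/all_filterP.
    have -> : set_nth [::] U r (nth [::] U r) = U.
      apply: (@eq_from_nth _ [::]); first by rewrite size_set_nth; apply/maxn_idPr.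
      by move=> i _; rewrite nth_set_nth /=; case: eqP => [->|].
    by apply/all_filterP.
  by case: f hf => [|f] _; rewrite /= e1 e2 /= res.
have ha : addable (colword (shape U)) h by case/andP: hl.
have hl2 : lat (colword (shape U)) [:: h; d].
  by move: hl; rewrite !lat_cons => /and3P[-> -> _].
have [h1 h2 h3] := part_row_choice pU ha.
have ptz := ptn_colword (shape U).
have rT : part_row (shape U) h <= size U by move: h1; rewrite size_map.
set r := part_row _ _ in h1 h2 h3 rT *.
rewrite [push _ _ _]/= numbered_cons.
(* the hole and the next entry are neighbours: one step of the slide *)
have shr x : shape (put r x U) = incr_nth (shape U) r by rewrite shape_put.
have cr x : perm_eq (colword (shape (put r x U))) (h :: colword (shape U)).
  by rewrite shr -h2; apply: colword_incr_nth.
have ad' : addable (colword (incr_nth (shape U) r)) d.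
  rewrite -(shr v) (addable_perm _ (cr v)).
  by move: hl; rewrite !lat_cons => /and3P[].
have h3' : is_part (incr_nth (shape U) r) := h3.
have [k1 k2 k3] := part_row_choice h3' ad'.
set rd := part_row _ d in k1 k2 k3.
have sr : size (nth [::] U r) = h by rewrite -nth_shape.
have kT : rd <= size (put r v U) by move: k1; rewrite -(shr v) size_map.
pose T := fill part_row U [:: (h, v), (d, m.+1) & numbered m.+2 w].
pose V := put rd m.+1 (put r v U).
have eT : T = fill part_row V (numbered m.+2 w).
  by rewrite /T /= -/(fill _ _ _) -/r shr.
have eV : entry V (rd, d) = m.+1 by rewrite entry_put -nth_shape shr k2 eqxx.
have dV : in_diagram (shape V) (rd, d).
  by rewrite /in_diagram nth_shape nth_put eqxx size_rcons ltnS -nth_shape shr k2.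
have eTd : entry T (rd, d) = m.+1.
  by rewrite eT; case: (entry_fill part_row V m.+2 w (rd, d)) => [->//|[]]; rewrite dV.
have later b : entry V b = 0 -> entry T b = 0 \/ m.+1 < entry T b.
  by rewrite eT; case: (entry_fill part_row V m.+2 w b) => [->|[_]]; [left | right].
have next f' : size w <= f' -> slide f' (set_entry T r h m.+1) rd d =
   fill part_row U ((h, m.+1) :: numbered m.+2 (push (h :: colword (shape U)) d w).1).
  move=> hf'; have -> : set_entry T r h m.+1 =
      fill part_row (put r m.+1 U) ((d, m.+1) :: numbered m.+2 w).
    have hV : h < size (nth [::] (put r v U) r) by rewrite nth_put eqxx size_rcons sr.
    rewrite eT set_entry_fill; last first.
      by rewrite nth_put; case: eqP => // <-; rewrite size_rcons leqW.
    rewrite /V set_entry_put // -sr set_entry_put_new //.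
    by rewrite /= -/(fill _ _ _) shr.
  have -> : rd = part_row (shape (put r m.+1 U)) d by rewrite shr.
  rewrite (IHw m.+1) ?(push_perm _ _ (cr m.+1)) //.
  - by rewrite shr.
  - exact: std_put.
  by rewrite (lat_perm _ (cr _)); move: hl; rewrite lat_cons => /andP[].
have := sw_lat hl2; have := sw_state (colword (shape U)) h d.
case: (swP ptz hl2) => [ne ad|dh|dh em] st hl2'.
- clear rd k1 k2 k3 kT T V eT eV dV eTd later next.
  have [k1 k2 k3] := part_row_choice pU ad.
  set rd := part_row (shape U) d in k1 k2 k3.
  have kT : rd <= size U by move: k1; rewrite size_map.
  have shd : shape (put rd m.+1 U) = incr_nth (shape U) rd by rewrite shape_put.
  have ner : r != rd by apply/eqP => e; rewrite -/r in h2; rewrite -h2 -k2 e in ne.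
  have -> : fill part_row U [:: (h, v), (d, m.+1) & numbered m.+2 w] =
      fill part_row (put rd m.+1 U) ((h, v) :: numbered m.+2 w).
    rewrite /= -/(fill _ _ _) -/r -/rd; congr fill.
    rewrite shape_put // (part_row_incr _ h1 h2) -/rd.
    rewrite shd (part_row_incr _ k1 k2) -/r.
    have -> : (h == d) = false by apply/eqP.
    have -> : (d == h) = false by apply/eqP/nesym.
    by rewrite !addn0 put_comm // eq_sym.
  have er : r = part_row (shape (put rd m.+1 U)) h.
    rewrite shd (part_row_incr _ k1 k2) -/r.
    by have -> : (d == h) = false by [apply/eqP/nesym]; rewrite addn0.
  have cU : perm_eq (colword (shape (put rd m.+1 U))) (d :: colword (shape U)).
    by rewrite shd -k2; apply: colword_incr_nth.
  rewrite er (IHw m.+1) ?(push_perm _ _ cU) //.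
  + by rewrite shd.
  + exact: std_put.
  + by rewrite !(lat_perm _ cU) lat_cons; move: hl2' hl; rewrite !lat_cons => /and3P[_ -> _] /and3P[_ _]; rewrite (lat_perm _ (perm_swap2 d h _)).
  + exact: ltnW.
- case: f hf => // f hf; rewrite -/T slideS.
  have rdE : rd = r.+1 by rewrite /rd (part_row_incr _ h1 h2) dh eqxx addn1.
  have below : entry T (r.+1, h) = m.+1 by rewrite -rdE -dh.
  have right : entry V (r, h.+1) = 0.
    by rewrite entry_out // nth_put rdE ltn_eqF // nth_put eqxx size_rcons sr.
  have nx := next f hf; rewrite [X in slide _ _ _ X = _]dh rdE in nx.
  rewrite below -nx /= andbF.
  case: (later _ right) => [->//|lt]; rewrite ifF //.
  by apply/negbTE; rewrite negb_and negbK -leqNgt ltnW ?orbT.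
case: f hf => // f hf; rewrite -/T slideS.
have rdE : rd = r.
  rewrite /rd (part_row_incr _ h1 h2) dh ltn_eqF // addn0.
  by rewrite /r /part_row -!mult_colword.
have right : entry T (r, h.+1) = m.+1 by rewrite -{1}rdE -dh.
have below : entry V (r.+1, h) = 0.
  rewrite entry_out // nth_put rdE gtn_eqF // nth_put gtn_eqF // -nth_shape -h2.
  by apply: part_nth => //; case/andP: pU.
have nx := next f hf; rewrite [X in slide _ _ _ X = _]dh rdE in nx.
rewrite right -nx /=; case: (later _ below) => [-> //|lt].
by rewrite lt orbT.
Qed.

Lemma perm_flatten_put r v (T : tableau) : r <= size T ->
  perm_eq (flatten (put r v T)) (v :: flatten T).
Proof.
elim: T r => [|row T IHT] [|r] //= hr.
  by rewrite /put /= cat_rcons perm_catr_cons.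
change (perm_eq (row ++ flatten (put r v T)) (v :: row ++ flatten T)).
have := IHT r hr; rewrite -(perm_cat2l row) => /perm_trans; apply.
exact: perm_catr_cons.
Qed.

Lemma perm_flatten_fill row ok T w n : row_choice row ok -> ok (shape T) ->
  lat (colword (shape T)) w ->
  perm_eq (flatten (fill row T (numbered n w))) (iota n (size w) ++ flatten T).
Proof.
move=> hrow; elim: w T n => //= c w IHw T n okT /andP[hc hw].
have [h1 h2 h3] := hrow _ _ okT hc; set r := row _ _ in h1 h2 h3 *.
have rT : r <= size T by move: h1; rewrite size_map.
have sP : shape (put r n T) = incr_nth (shape T) r by rewrite shape_put.
rewrite -/(fill _ _ _) -/(numbered _ _).
have := IHw (put r n T) n.+1; rewrite sP => /(_ h3).
rewrite (lat_perm _ (colword_incr_nth h1)) h2 => /(_ hw) /perm_trans; apply.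
have := perm_flatten_put n rT; rewrite -(perm_cat2l (iota n.+1 (size w))).
by move/perm_trans; apply; apply: perm_catr_cons.
Qed.

(* removing the last box of the last row *)
Definition shrink (s : seq nat) (p : nat) : seq nat :=
  if p == 0 then s else rcons s p.

Lemma colword_rcons s p : colword (rcons s p.+1) = rcons (colword (shrink s p)) p.
Proof.
have cwr t q : colword (rcons t q) = colword t ++ iota 0 q.
  by rewrite /colword map_rcons flatten_rcons.
rewrite cwr /shrink -[in iota 0 _]addn1 iotaD /= add0n -cats1 catA.
by case: eqP => [->|_]; rewrite ?cwr //= cats0.
Qed.

Lemma is_part_shrink s p : is_part (rcons s p.+1) ->
  is_part (shrink s p) /\ part_row (shrink s p) p = size s.
Proof.
case/andP=> srt; rewrite all_rcons => /andP[_ s1].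
have hs i : i < size s -> p < nth 0 s i.
  move=> hi; have := part_nth srt (ltnW hi : i <= size s).
  by rewrite !nth_rcons ltnn eqxx hi.
have srt' : sorted geq s by move: srt; rewrite -cats1 => /cat_sorted2[].
have cs : count (fun q => p < q) s = size s.
  apply/eqP; rewrite -all_count; apply/(all_nthP 0); exact: hs.
split; last by rewrite /shrink /part_row; case: eqP => _ //; rewrite -cats1 count_cat /= ltnn cs !addn0.
rewrite /shrink; case: eqP => [_|/eqP p0]; first by rewrite /is_part srt' s1.
rewrite /is_part all_rcons s1 lt0n p0 !andbT.
apply/(sortedP 0) => i; rewrite size_rcons ltnS => hi /=.
rewrite !nth_rcons (hi : i < size s); case: ltngtP => // h.
  exact: part_nth.
exact: ltnW (hs i hi).
Qed.

Lemma zeros_shrink s p :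
  put (size s) 0 (zeros (shrink s p)) = zeros (rcons s p.+1).
Proof.
rewrite /shrink /zeros; case: eqP => [->|_]; rewrite !map_rcons /put.
  by rewrite nth_default ?size_map // -(size_map (fun q => nseq q 0)) set_nth_size.
rewrite -(size_map (fun q => nseq q 0)) nth_rcons ltnn eqxx set_nth_rcons_size.
by congr (rcons _ _); elim: p => //= p ->.
Qed.

Lemma zero_rows la n (T : tableau) : size la <= size T ->
  n = sumn (shape T) - sumn la -> std_filling la n T ->
  forall i, nth [::] T i = nseq (nth 0 la i) 0 ++ nonzero (nth [::] T i).
Proof.
move=> sz nE sT.
have sub i : nth 0 la i <= nth 0 (shape T) i by rewrite nth_shape (std_sub sT).
have sz' : size la <= size (shape T) by rewrite size_map.
have := std_mem_fillings sub sz' erefl nE sT.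
by rewrite (mem_standard_fillings sub sz') => -[].
Qed.

Lemma lat_shrink s p w :
  lat (colword (rcons s p.+1)) w -> lat (colword (shrink s p)) (p :: w).
Proof.
move=> hw; rewrite lat_cons addable_colword /shrink.
apply/andP; split; first by case: eqP => //= _; rewrite mem_rcons mem_head.
move: hw; rewrite colword_rcons => hw.
by rewrite (lat_perm _ (_ : perm_eq _ (rcons (colword (shrink s p)) p))) // perm_sym perm_rcons.
Qed.

Lemma slide_corner_fill s p w : is_part (rcons s p.+1) ->
  lat (colword (rcons s p.+1)) w ->
  slide_corner (fill part_row (zeros (rcons s p.+1)) (numbered 1 w)) =
  fill part_row (zeros (shrink s p)) (numbered 1 (push (colword (shrink s p)) p w).1).
Proof.
move=> hla hw; have [hs hr] := is_part_shrink hla.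
set la := rcons s p.+1 in hla hw *; set T := fill _ _ _.
have [sT shT pT cT pc] := part_fill hla hw; rewrite -/T in sT pT cT pc.
have sumE : sumn (shape T) = size w + sumn la.
  by rewrite -!size_colword (perm_size pc) size_cat.
have szla : size la <= size T.
  have la1 : all (leq 1) la by case/andP: hla.
  rewrite leqNgt; apply/negP => h; have := std_sub sT (size T).
  rewrite (nth_default [::] (leqnn _)) leqn0 => /eqP e.
  by have := allP la1 _ (mem_nth 0 h); rewrite e.
have rows := zero_rows szla _ sT; rewrite sumE addnK in rows; have {}rows := rows erefl.
have nz (r : seq nat) : 0 \in nonzero r = false by rewrite mem_filter.
have has0 i : (0 \in nth [::] T i) = (i < size la).
  rewrite rows mem_cat nz orbF mem_nseq andbT.
  have [h|h] := ltnP i (size la); last by rewrite nth_default.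
  by apply: (allP (proj2 (andP hla))); apply: mem_nth.
have szs : size la = (size s).+1 by rewrite size_rcons.
have sT' : size s < size T by rewrite -szs.
rewrite /slide_corner (@filter_iota_last _ _ (size s)) //; last 2 first.
- by rewrite has0 szs.
- by move=> k /andP[k1 _]; rewrite has0 szs -leqNgt.
rewrite last_rcons.
have -> : (count_mem 0 (nth [::] T (size s))).-1 = p.
  rewrite rows count_cat count_nseq /= mul1n nth_rcons ltnn eqxx.
  by rewrite (count_memPn (negbT (nz _))) addn0.
have eT : T = fill part_row (zeros (shrink s p)) ((p, 0) :: numbered 1 w).
  by rewrite /= -/(fill _ _ _) shape_zeros hr zeros_shrink.
rewrite eT -hr -[X in part_row X p](shape_zeros (shrink s p)).
have shp1 : all (leq 1) (shrink s p) by case/andP: hs.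
rewrite (@slide_fill (shrink s p) 0) ?shape_zeros //.
- exact: std_zeros.
- exact: lat_shrink.
rewrite -eT size_flatten sumE; exact: leq_addr.
Qed.

Theorem rect_fill la w : is_part la -> lat (colword la) w ->
  rect (fill part_row (zeros la) (numbered 1 w)) =
  fill part_row [::] (numbered 1 (switch [::] (colword la) w).1).
Proof.
move=> hla hw; rewrite /rect.
have -> : count_mem 0 (flatten (fill part_row (zeros la) (numbered 1 w))) = sumn la.
  have := @perm_flatten_fill part_row is_part (zeros la) w 1 part_row_choice.
  rewrite shape_zeros => /(_ hla hw) /permP ->; rewrite count_cat.
  rewrite (count_memPn _) ?mem_iota // add0n.
  by elim: (la) => //= p s IHs; rewrite count_cat count_nseq /= mul1n IHs.
move en : (sumn la) => n; elim: n la en w hla hw => [|n IHn] la sla w hla hw.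
  case: la sla hla hw => [|p la] //= sla /andP[_ /andP[p0 _]]; lia.
case/lastP: la sla hla hw => // s [|p] sla hla hw; first by case/andP: hla; rewrite all_rcons.
have [hs _] := is_part_shrink hla.
rewrite iterSr slide_corner_fill // IHn //.
- rewrite colword_rcons switch_rcons /=.
  by rewrite (push_perm _ _ (_ : perm_eq _ (colword (shrink s p)))) ?cats0.
- by move: sla; rewrite -!size_colword colword_rcons size_rcons => -[].
by have := push_lat (lat_shrink hw); rewrite lat_rcons => /andP[].
Qed.

(** * P17 *)

Lemma iota_rcons n p : iota n p.+1 = rcons (iota n p) (n + p).
Proof. by rewrite -cats1 -(addn1 p) iotaD. Qed.

Lemma size_positions j w : size (positions j w) = mult j w.
Proof.
by rewrite /mult size_map size_filter -[in RHS](mkseq_nth 0 w) /mkseq count_map.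
Qed.

Lemma part_fill_entry w i j : lat [::] w ->
  entry (fill part_row [::] (numbered 1 w)) (i, j) = nth 0 (positions j w) i.
Proof.
elim/last_ind: w => [|w c IHw]; first by rewrite /entry !nth_nil.
rewrite lat_rcons => /andP[hw hc].
have [sT _ pT _ pc] := @part_fill [::] w isT hw.
rewrite numbered_rcons fill_rcons /= add1n entry_put.
set T := fill _ _ _ in sT pT pc *.
have ha : addable (colword (shape T)) c by rewrite (addable_perm _ pc).
have [h1 h2 _] := part_row_choice pT ha.
have er : part_row (shape T) c = size (positions c w).
  by rewrite size_positions /part_row -mult_colword (mult_perm _ pc) cats0.
rewrite -nth_shape h2 er xpair_eqE positions_rcons IHw //.
case: (eqVneq j c) => [->|jc]; last by rewrite andbF.
rewrite andbT nth_rcons; case: ltngtP => // h.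
by rewrite nth_default // ltnW.
Qed.

Theorem rho_fill w : lat [::] w ->
  rho (fill comp_row [::] (numbered 1 w)) = fill part_row [::] (numbered 1 w).
Proof.
move=> hw; set C := fill comp_row _ _; set P := fill part_row _ _.
have [sC _ _ _ _] := @comp_fill [::] w isT hw; rewrite -/C in sC.
have [sP shP pP _ pcP] := @part_fill [::] w isT hw; rewrite -/P in sP shP pP pcP.
have col j : sorted_column C j = positions j w.
  rewrite -(@column_entries_fill comp_row (all (leq 1)) [::] w j comp_row_choice) // -/C.
  apply/esym/all_filterP/allP => x; rewrite mem_sort => /mapP[r].
  rewrite mem_filter => /andP[jr /(nthP [::])[i hi er]] ->.
  have := std_zero sC i j; rewrite nth_nil ltn0 /= /entry /= er => ->.
  by rewrite -ltnNge.
have eP i j : entry P (i, j) = nth 0 (positions j w) i by exact: part_fill_entry.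
have posP j x : x \in positions j w -> x != 0 by case/mapP=> k _ ->.
have inP i j : (j < size (nth [::] P i)) = (i < size (positions j w)).
  have : (entry P (i, j) != 0) = (i < size (positions j w)).
    rewrite eP; case: ltnP => h; last by rewrite nth_default.
    by apply: (posP j); apply: mem_nth.
  by rewrite (std_zero sP) nth_nil ltn0 /= -ltnNge.
have szC : size C = size P.
  have [e _] := @size_fill_comp [::] w isT hw; rewrite -/C /= add0n in e.
  rewrite e -(size_map size P) -/(shape P).
  have : size (shape P) = mult 0 (colword (shape P)).
    by rewrite mult_colword; apply/esym/eqP; rewrite -all_count; case/andP: pP.
  by move=> ->; rewrite (mult_perm _ pcP) cats0.
rewrite /rho; apply: (@eq_from_nth _ [::]); rewrite size_map size_iota // => i hi.
rewrite (nth_map 0) ?size_iota // nth_iota // add0n.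
set k := size (nth [::] P i).
have kC : k <= ncols C.
  rewrite leqNgt; apply/negP => hk.
  have k0 : 0 < k by apply: leq_ltn_trans hk.
  have : i < size (positions k.-1 w) by rewrite -inP -/k prednK.
  move=> h; have := mem_nth 0 h.
  rewrite -(@column_entries_fill comp_row (all (leq 1)) [::] w _ comp_row_choice) //.
  case/(column_entriesP _ _ sC) => x0 [i' e'].
  have : k.-1 < size (nth [::] C i').
    rewrite ltnNge; apply/negP => h'; move: x0; rewrite -e' entry_out //.
  by have := le_ncols C i'; lia.
rewrite (eq_filter (a2 := fun j => j < 0 + k)); last first.
  by move=> j; rewrite col -inP.
rewrite filter_iota_ltn //.
rewrite -[RHS](mkseq_nth 0) /mkseq -/k; apply: eq_map => j.
by rewrite col -eP.
Qed.

Lemma fill_new_row row n p (T : tableau) :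
  (forall q, q < p -> row (if q == 0 then shape T else rcons (shape T) q) q = size T) ->
  0 < p -> fill row T (numbered n (iota 0 p)) = rcons T (iota n p).
Proof.
move=> hrow; elim: p hrow => // p IHp hrow _.
rewrite !iota_rcons add0n.
rewrite numbered_rcons fill_rcons size_iota /=.
have := hrow p (ltnSn p); case: (posnP p) => [->|p0] hp.
  by rewrite /= hp /put nth_default // -{1}(size_map id T) map_id set_nth_size addn0.
rewrite IHp //; last by move=> q hq; apply: hrow; apply: ltnW.
rewrite /shape map_rcons size_iota -/(shape T) hp /put nth_rcons ltnn eqxx.
by rewrite set_nth_rcons_size.
Qed.

Lemma row_filling_rcons s p :
  row_filling (rcons s p) = rcons (row_filling s) (iota (1 + sumn s) p).
Proof.
rewrite /row_filling sumn_rcons iotaD; elim: s 1 => [|q s IHs] m /=.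
  by rewrite take_oversize ?size_iota.
rewrite addnA iotaD -catA !take_size_cat ?size_iota // !drop_size_cat ?size_iota //.
by rewrite IHs.
Qed.

Lemma row_filling_shape s : shape (row_filling s) = s.
Proof. by rewrite reshapeKl // size_iota. Qed.

Lemma row_filling_comp s : all (leq 1) s ->
  row_filling s = fill comp_row [::] (numbered 1 (colword s)).
Proof.
elim/last_ind: s => // s p IHs; rewrite all_rcons => /andP[p0 s1].
have -> : colword (rcons s p) = colword s ++ iota 0 p.
  by rewrite /colword map_rcons flatten_rcons.
rewrite numbered_cat fill_cat -IHs // size_colword row_filling_rcons fill_new_row //.
move=> q hq; rewrite /comp_row row_filling_shape; case: (eqVneq q 0) => [_|q0].
  by rewrite -{1}(row_filling_shape s) size_map.
have e : size s = size (row_filling s) by rewrite -{1}(row_filling_shape s) size_map.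
apply: last_index_eq; rewrite ?size_rcons ?e // ?nth_rcons -?e ?ltnn ?eqxx //.
by move=> k; lia.
Qed.

Lemma row_filling_part s : is_part s ->
  row_filling s = fill part_row [::] (numbered 1 (colword s)).
Proof.
elim/last_ind: s => // s p IHs hs.
have p0 : 0 < p by case/andP: hs => _; rewrite all_rcons => /andP[].
have hs' : is_part s.
  case/andP: hs => srt; rewrite all_rcons => /andP[_ s1].
  by rewrite /is_part s1 andbT; move: srt; rewrite -cats1 => /cat_sorted2[].
have -> : colword (rcons s p) = colword s ++ iota 0 p.
  by rewrite /colword map_rcons flatten_rcons.
rewrite numbered_cat fill_cat -IHs // size_colword row_filling_rcons fill_new_row //.
move=> q hq; rewrite row_filling_shape.
have e : size (row_filling s) = size s by rewrite -{2}(row_filling_shape s) size_map.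
have cs : part_row s q = size s.
  apply/eqP; rewrite -all_count; apply/(all_nthP 0) => i hi.
  have := @part_nth (rcons s p) i (size s); case/andP: hs => srt _ => /(_ srt (ltnW hi)).
  by rewrite !nth_rcons ltnn eqxx hi; apply: leq_trans.
by rewrite e; case: eqP => _ //; rewrite /part_row -cats1 count_cat /= ltnn !addn0.
Qed.

Lemma lat_colword s : all (leq 1) s -> lat [::] (colword s).
Proof.
elim/last_ind: s => // s p IHs; rewrite all_rcons => /andP[p0 s1].
have -> : colword (rcons s p) = colword s ++ iota 0 p.
  by rewrite /colword map_rcons flatten_rcons.
rewrite lat_cat IHs // cats0 andTb; move: (colword s) (ptn_colword s) => z hz.
elim: p {p0} => // p IHp.
rewrite iota_rcons add0n.
rewrite lat_rcons IHp /addable !mult_cat; case: p {IHp} => // p.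
have m k n : mult k (iota 0 n) = (k < n) by rewrite /mult count_uniq_mem ?iota_uniq // mem_iota.
by rewrite !m ltnn leqnn /=; have := hz p; lia.
Qed.

Lemma grow_colword s : all (leq 1) s -> foldl grow [::] (colword s) = s.
Proof.
move=> s1; have [_ <- _ _ _] := @comp_fill [::] _ isT (lat_colword s1).
by rewrite -row_filling_comp // row_filling_shape.
Qed.

(** * P18 *)

Lemma count_pairsE (P : rel (nat * nat)) B :
  count_pairs P B = \sum_(b <- B) count (P b) B.
Proof.
rewrite /count_pairs; rewrite count_flatten sumnE !big_map.
by apply: eq_bigr => b _; rewrite count_map.
Qed.

Lemma count_pairs_cons (P : rel (nat * nat)) b B :
  count_pairs P (b :: B) =
  P b b + count (P b) B + count (P^~ b) B + count_pairs P B.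
Proof.
rewrite !count_pairsE big_cons /= big_split /= -!addnA; do 2 congr (_ + _).
by congr (_ + _); elim: (B) => [|b' B' IHB]; rewrite ?big_nil ?big_cons //= IHB.
Qed.

Lemma count_pairs_perm (P : rel (nat * nat)) B B' :
  perm_eq B B' -> count_pairs P B = count_pairs P B'.
Proof.
move=> pB; rewrite !count_pairsE (perm_big _ pB) /=.
by apply: eq_bigr => b _; apply/permP.
Qed.

Lemma eq_in_count_pairs (P Q : rel (nat * nat)) B :
  {in B &, forall b b', P b b' = Q b b'} -> count_pairs P B = count_pairs Q B.
Proof.
move=> PQ; rewrite !count_pairsE; apply: eq_big_seq => b bB.
by apply: eq_in_count => b' b'B; apply: PQ.
Qed.

Lemma winv_rcons w c : winv (rcons w c) = winv w + count (fun d => c < d) w.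
Proof.
rewrite -cats1 winv_cat /= !addn0 /cross; congr (_ + _).
by elim: w => [|d w IHw]; rewrite ?big_nil ?big_cons //= IHw addn0.
Qed.

Lemma entry_put_old la n (T : tableau) r x : std_filling la n T ->
  x \in boxes T -> entry (put r n.+1 T) x = entry T x /\ entry T x <= n.
Proof.
move=> sT; rewrite mem_boxes => x0; split; last exact: (std_max sT).
by rewrite entry_put; case: eqP => // e; move: x0; rewrite e entry_out.
Qed.

Lemma boxes_columns row ok w : row_choice row ok -> ok [::] -> lat [::] w ->
  perm_eq [seq b.2 | b <- boxes (fill row [::] (numbered 1 w))] w.
Proof.
move=> hrow ok0; elim/last_ind: w => // w c IHw; rewrite lat_rcons => /andP[hw hc].
have [e1 e2 e3] := @shape_fill row ok [::] w 1 hrow ok0 hw.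
have [h1 h2 _] := hrow _ c e2 (etrans (addable_perm _ e3) hc).
rewrite numbered_rcons fill_rcons /= e1.
apply: perm_trans (perm_map snd (boxes_put _ _ _)) _ => //=.
by rewrite -nth_shape e1 h2 perm_sym perm_rcons perm_cons perm_sym IHw.
Qed.

Theorem inv_comp_fill w : lat [::] w ->
  inv_comp (fill comp_row [::] (numbered 1 w)) = winv w.
Proof.
elim/last_ind: w => // w c IHw; rewrite lat_rcons => /andP[hw hc].
have [sT shT s1 _ pc] := @comp_fill [::] w isT hw.
have cols := boxes_columns comp_row_choice isT hw.
rewrite numbered_rcons fill_rcons /= add1n winv_rcons -(IHw hw).
set T := fill _ _ _ in sT shT s1 pc cols *.
have ha : addable (colword (shape T)) c by rewrite (addable_perm _ pc).
have [h1 h2 _] := comp_row_choice s1 ha; set r := comp_row _ _ in h1 h2 *.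
have old x := @entry_put_old _ _ _ r x sT.
have new : entry (put r (size w).+1 T) (r, c) = (size w).+1.
  by rewrite entry_put -nth_shape h2 eqxx.
rewrite /inv_comp (count_pairs_perm _ (boxes_put _ _ _)) // -nth_shape h2.
rewrite count_pairs_cons /= ltnn add0n addnC; congr (_ + _).
  by apply: eq_in_count_pairs => b b' /old[-> _] /old[-> _].
rewrite -[RHS]addn0; congr (_ + _).
  move/permP: cols => <-; rewrite count_map; apply: eq_in_count => b /= hb.
  by have [-> le] := old b hb; rewrite new ltnS le andbT.
apply/eqP; rewrite -leqn0 leqNgt -has_count; apply/hasPn => b hb /=.
by have [-> le] := old b hb; rewrite new; lia.
Qed.

Theorem NE_fill w : lat [::] w -> let P := fill part_row [::] (numbered 1 w) in
  NE (shape P) = inv_tab P + winv w.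
Proof.
move=> + /=; elim/last_ind: w => // w c IHw; rewrite lat_rcons => /andP[hw hc].
have [sT shT pT _ pc] := @part_fill [::] w isT hw.
have cols := boxes_columns part_row_choice isT hw.
have full n (U : tableau) : std_filling [::] n U -> perm_eq (cells (shape U)) (boxes U).
  move=> sU; apply: uniq_perm; rewrite ?cells_uniq ?boxes_uniq // => b.
  by rewrite mem_cells mem_boxes (std_diagram _ sU).
have {}IHw := IHw hw.
rewrite numbered_rcons fill_rcons /= add1n winv_rcons.
set T := fill _ _ _ in sT shT pT pc cols IHw *.
have ha : addable (colword (shape T)) c by rewrite (addable_perm _ pc).
have [h1 h2 _] := part_row_choice pT ha; set r := part_row _ _ in h1 h2 *.
have srt : sorted geq (shape T) by case/andP: pT.
have rT : r <= size T by move: h1; rewrite size_map.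
have old x := @entry_put_old _ _ _ r x sT.
have new : entry (put r (size w).+1 T) (r, c) = (size w).+1.
  by rewrite entry_put -nth_shape h2 eqxx.
have dg b : b \in boxes T -> b.2 < nth 0 (shape T) b.1.
  by rewrite mem_boxes => /entry_neq0.
rewrite /NE (count_pairs_perm _ (full _ _ (std_put sT rT))).
rewrite (count_pairs_perm _ (boxes_put _ _ _)) // -nth_shape h2 count_pairs_cons /= ltnn add0n.
rewrite -(count_pairs_perm _ (full _ _ sT)) -/(NE _) IHw.
have -> : inv_tab (put r (size w).+1 T) = inv_tab T + count (fun b => r < b.1) (boxes T).
  rewrite /inv_tab (count_pairs_perm _ (boxes_put _ _ _)) // -nth_shape h2.
  rewrite count_pairs_cons /= ltnn add0n addnC; congr (_ + _).
    by apply: eq_in_count_pairs => b b' /old[-> _] /old[-> _].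
  rewrite -[RHS]addn0; congr (_ + _).
    apply: eq_in_count => b /= hb.
    by have [-> le] := old b hb; rewrite new leqW // andbT.
  apply/eqP; rewrite -leqn0 leqNgt -has_count; apply/hasPn => b hb /=.
  by have [-> le] := old b hb; rewrite new; lia.
have -> : count (fun d => c < d) w = count (fun b => (b.1 < r) && (c < b.2)) (boxes T).
  move/permP: cols => <-; rewrite count_map; apply: eq_in_count => b /= hb.
  case: ltnP => h; rewrite ?andbF ?andbT //; apply/esym; rewrite ltnNge.
  apply/negP => h'; have := leq_trans (dg b hb) (part_nth srt h').
  by rewrite h2 ltnNge ltnW.
have -> : count (fun b => r < b.1) (boxes T) = count (fun b => (r < b.1) && (b.2 < c)) (boxes T).
  apply: eq_in_count => b hb; case: ltnP => h //=; apply/esym.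
  by have := leq_trans (dg b hb) (part_nth srt (ltnW h)); rewrite h2.
by move: (count _ _) (count _ _) (inv_tab T) (winv w) => *; lia.
Qed.

Theorem extend_fill la w : is_part la -> lat (colword la) w ->
  extend la (fill part_row (zeros la) (numbered 1 w)) =
  fill part_row [::] (numbered 1 (colword la ++ w)).
Proof.
move=> hla; have /andP[_ la1] := hla.
elim/last_ind: w => [_|w c IHw].
  rewrite cats0 -row_filling_part // /extend /=.
  have sR : shape (row_filling la) = la by apply: row_filling_shape.
  have e : size (row_filling la) = size la by rewrite -[in RHS]sR size_map.
  apply: (@eq_from_nth _ [::]); rewrite size_map size_iota size_map // => i hi.
  rewrite (nth_map 0) ?size_iota ?size_map // nth_iota ?size_map //= add0n.
  rewrite (nth_map 0) // [filter _ _](_ : _ = [::]) ?cats0 //.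
  by apply/eqP; rewrite -size_eq0 size_filter; elim: (nth 0 la i).
rewrite lat_rcons => /andP[hw hc].
have [sT shT pT _ pc] := part_fill hla hw.
have lw : lat [::] (colword la ++ w) by rewrite lat_cat cats0 lat_colword.
have [_ shE pE _ pcE] := @part_fill [::] (colword la ++ w) isT lw.
rewrite -rcons_cat !numbered_rcons !fill_rcons /= -(IHw hw).
rewrite -(IHw hw) in shE pE pcE.
set T := fill _ _ _ in sT shT pT pc shE pE pcE *.
have shEq : shape (extend la T) = shape T.
  apply: part_colword_inj => //; apply: perm_trans pcE _; rewrite cats0.
  by rewrite perm_sym; apply: perm_trans pc _; rewrite perm_catC.
rewrite shEq size_cat size_colword add1n addnA add1n.
have ha : addable (colword (shape T)) c by rewrite (addable_perm _ pc).
have [h1 h2 _] := part_row_choice pT ha; set r := part_row _ _ in h1 h2 *.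
have rT : r <= size T by move: h1; rewrite size_map.
apply: (@eq_from_nth _ [::]) => [|i].
  by rewrite size_put !size_map !size_iota size_put.
rewrite size_map size_iota => hi.
rewrite (nth_map 0) ?size_iota // nth_iota // add0n !nth_put.
have szE : size (extend la T) = size T by rewrite size_map size_iota.
case: (eqVneq i r) => [->|ir].
  have [h|h] := ltnP r (size T).
    rewrite (nth_map 0) ?size_iota // nth_iota // add0n filter_rcons /= map_rcons rcons_cat.
    by rewrite addnS addSn.
  rewrite [nth [::] (extend _ _) _]nth_default ?szE // (nth_default _ h).
  rewrite nth_default /= ?addnS ?addSn //; apply: leq_trans h.
  rewrite -(size_map size) -/(shape _) row_filling_shape leqNgt.
  apply/negP => h; have := std_sub sT (size T).
  by rewrite (nth_default [::]) // leqNgt (allP la1) // mem_nth.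
have {}hi : i < size T.
  by move: hi ir rT; rewrite size_put; clear; lia.
by rewrite (nth_map 0) ?size_iota // nth_iota // add0n.
Qed.

(** * P19 *)

Definition descent_positions (w : seq nat) : seq nat :=
  [seq m <- iota 1 (size w).-1 | nth 0 w m <= nth 0 w m.-1].

Definition word_composition (w : seq nat) : composition :=
  composition_of_set (size w) (descent_positions w).

Lemma descent_composition_fill w : lat [::] w ->
  descent_composition (fill comp_row [::] (numbered 1 w)) = word_composition w.
Proof.
move=> hw; have sB : size (boxes (fill comp_row [::] (numbered 1 w))) = size w.
  by have /perm_size := boxes_columns comp_row_choice isT hw; rewrite size_map.
have wE := @word_of_fill comp_row (all (leq 1)) [::] w comp_row_choice isT isT hw.
rewrite /descent_composition /descents sB; congr composition_of_set.
have col m : m < size w ->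
    column_of (fill comp_row [::] (numbered 1 w)) m.+1 = nth 0 w m.
  by move=> hm; rewrite -[in RHS]wE (nth_map 0) ?size_iota // nth_iota // add1n.
apply: eq_in_filter => -[|m]; rewrite mem_iota //= => hm.
by rewrite !col //; move: hm; clear; lia.
Qed.

Lemma descent_positions_mem w m :
  (m \in descent_positions w) = [&& 0 < m, m < size w & nth 0 w m <= nth 0 w m.-1].
Proof.
by rewrite mem_filter mem_iota andbC; case: m => [|m] //=; case: (size w).
Qed.

Lemma scanl_pairmap x (D : seq nat) : path ltn x D ->
  scanl addn x (nats (pmap insub (pairmap (fun y z => z - y) x D))) = D.
Proof.
elim: D x => //= y D IHD x /andP[xy hD].
case: insubP => [p _ ep|]; last by rewrite subn_gt0 xy.
by rewrite /= ep subnKC ?(ltnW xy) // IHD.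
Qed.

Lemma partial_sums_of_set n (D : seq nat) : path ltn 0 (rcons D n) ->
  partial_sums (composition_of_set n D) = rcons D n.
Proof. exact: scanl_pairmap. Qed.

Lemma sumn_mem_partial (b : composition) x : b != [::] ->
  x + weight b \in scanl addn x (nats b).
Proof.
rewrite /weight; elim: b x => //= p b IHb x _.
rewrite inE; case: b IHb => [|q b] IHb; first by rewrite /= addn0 eqxx.
by rewrite addnA IHb // orbT.
Qed.

Lemma weight_composition_of_set n D : path ltn 0 (rcons D n) ->
  weight (composition_of_set n D) = n.
Proof.
move=> hD; have := partial_sums_of_set hD; rewrite /partial_sums.
set c := composition_of_set n D => e; rewrite -[LHS]add0n.
have : last 0 (scanl addn 0 (nats c)) = n by rewrite e last_rcons.
move=> <-; rewrite /weight; move: (nats c) => l; move: 0 => x.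
by elim: l x => /= [|p l IHl] x; rewrite ?addn0 // addnA IHl.
Qed.

Lemma descents_path w : w != [::] -> path ltn 0 (rcons (descent_positions w) (size w)).
Proof.
move=> w0; have := iota_ltn_sorted 0 (size w).+1.
rewrite iota_rcons add0n [iota 0 _](_ : _ = 0 :: iota 1 (size w).-1); last by case: w w0.
rewrite /= !rcons_path => /andP[h1 h2].
have hs : subseq (descent_positions w) (iota 1 (size w).-1) by apply: filter_subseq.
apply/andP; split; first exact: (subseq_path ltn_trans hs).
case/lastP: (descent_positions w) hs => [|D x] hs; first by case: w w0 {h1 h2 hs}.
have : x \in rcons D x by rewrite mem_rcons mem_head.
move/(mem_subseq hs); rewrite mem_iota last_rcons => /andP[_].
by case: w w0 {h1 h2 hs}.
Qed.

Lemma scanl_addn x s : scanl addn x s = map (addn x) (scanl addn 0 s).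
Proof.
elim: s x => //= p s IHs x; rewrite IHs (IHs (0 + p)) -map_comp; congr (_ :: _).
by apply: eq_map => y /=; rewrite addnA.
Qed.

Lemma increasing_blocks b w : all (leq 1) b -> size w = sumn b ->
  (all (sorted ltn) (reshape b w) <->
   (forall m, 0 < m < size w -> nth 0 w m <= nth 0 w m.-1 -> m \in scanl addn 0 b)).
Proof.
elim: b w => [|p b IHb] w /=; first by move=> _ /size0nil ->; split=> // _ [].
move=> /andP[p0 b1] sw; have sd : size (drop p w) = sumn b by rewrite size_drop sw addKn.
have st : size (take p w) = p by rewrite size_take sw; case: ltngtP; lia.
rewrite add0n (scanl_addn p); split=> [/andP[/(sortedP 0) h1 /IHb h2] m hm dm|h].
  rewrite inE; case: (ltngtP m p) => //= mp.
    have := h1 m.-1; rewrite prednK ?st; last by case/andP: hm.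
    by rewrite !nth_take ?(leq_ltn_trans (leq_pred _) mp) // => /(_ mp) /=; rewrite ltnNge dm.
  apply/mapP; exists (m - p); last by rewrite subnKC // ltnW.
  apply: h2 => //; first by rewrite size_drop; lia.
  by rewrite !nth_drop -subnS; congr (_ <= _): dm; congr nth; lia.
apply/andP; split.
  apply/(sortedP 0) => i hi; rewrite st in hi; rewrite !nth_take ?(ltnW hi) //= ltnNge.
  apply/negP => di; have := h i.+1; rewrite /= di => /(_ _ isT).
  rewrite inE (ltn_eqF hi) /= sw => /(_ _)/mapP[|y _ e]; first by lia.
  by move: hi; rewrite e ltnNge leq_addr.
apply/(IHb _ b1 sd) => m /andP[m0 mw]; rewrite !nth_drop => dm.
have hm : 0 < p + m < size w by move: mw; rewrite size_drop; lia.
have e : p + m.-1 = (p + m).-1 by lia.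
rewrite e in dm; have := h _ hm dm.
by rewrite inE => /orP[/eqP|/mapP[y hy /addnI->//]]; lia.
Qed.

Definition increasing_cut (w : seq nat) (b : composition) : bool :=
  (weight b == size w) && all (sorted ltn) (reshape (nats b) w).

Lemma composition_of_nothing : composition_of_set 0 [::] = [::].
Proof. by rewrite /composition_of_set /= insubF. Qed.

Lemma refines_word w b : refines b (word_composition w) = increasing_cut w b.
Proof.
rewrite /refines /increasing_cut /word_composition.
case: (eqVneq w [::]) => [->|w0].
  by rewrite composition_of_nothing; case: b => [|[[|p] hp] b].
have hp := descents_path w0; rewrite weight_composition_of_set // partial_sums_of_set //.
case: eqP => //= hw; have [h1 h2] := increasing_blocks (nats_positive b) (esym hw).
rewrite all_rcons /=; have -> /= : size w \in partial_sums b.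
  by rewrite -hw -[weight b]add0n sumn_mem_partial //; case: (b) hw => // /esym/size0nil e; rewrite e in w0.
apply/allP/idP => [h|/h1 h m].
  by apply: h2 => m hm dm; apply: h; rewrite descent_positions_mem andbA hm.
by rewrite descent_positions_mem andbA => /andP[]; apply: h.
Qed.

Lemma weight_word_composition w : weight (word_composition w) = size w.
Proof.
case: (eqVneq w [::]) => [->|w0]; first by rewrite /word_composition composition_of_nothing.
by rewrite weight_composition_of_set // descents_path.
Qed.

Lemma weight_cat (a b : composition) : weight (a ++ b) = weight a + weight b.
Proof. by rewrite /weight /nats map_cat sumn_cat. Qed.

Lemma increasing_cut_cat w a b :
  increasing_cut w (a ++ b) = (weight a + weight b == size w) &&
    (increasing_cut (take (weight a) w) a && increasing_cut (drop (weight a) w) b).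
Proof.
rewrite /increasing_cut weight_cat; case: eqP => //= hw.
rewrite size_drop size_takel -?hw ?leq_addr // addKn !eqxx /=.
rewrite /nats map_cat -/(nats a) -/(nats b).
rewrite /weight; elim: (nats a) w {hw} => [|p l IHl] w /=; first by rewrite drop0.
by rewrite IHl take_drop drop_drop (addnC p) take_takel ?leq_addl //; exact: andbA.
Qed.

Lemma word_composition_descents w w' : size w = size w' ->
  weak_descents w = weak_descents w' -> word_composition w = word_composition w'.
Proof.
move=> sw dw; rewrite /word_composition sw; congr composition_of_set.
rewrite /descent_positions sw; apply: eq_in_filter => m; rewrite mem_iota.
have nthD u : 0 < m < size u -> (nth 0 u m <= nth 0 u m.-1) = nth false (weak_descents u) m.-1.
  case: u => [|c u]; first by rewrite ltn0 andbF.
  by case: m => //= m hm; rewrite (nth_pairmap 0).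
move=> hm; rewrite !nthD ?dw //; rewrite ?sw; by move: hm; clear; lia.
Qed.

(** * P21 *)

Lemma sorted_parts_is_part (a : composition) : is_part (sorted_parts a).
Proof.
rewrite /is_part sort_sorted; last by move=> x y; apply: leq_total.
by rewrite (perm_all _ (permEl (perm_sort _ _))) nats_positive.
Qed.

Lemma perm_colword s t : perm_eq s t -> perm_eq (colword s) (colword t).
Proof. by move=> p; apply: perm_flatten; apply: perm_map. Qed.

Lemma colword_sorted_parts a : perm_eq (colword (sorted_parts a)) (colword (nats a)).
Proof. by apply: perm_colword; apply: permEl (perm_sort _ _). Qed.

Lemma sumn_sorted_parts a : sumn (sorted_parts a) = weight a.
Proof. by rewrite -size_colword (perm_size (colword_sorted_parts a)) size_colword. Qed.

Lemma grow_word s w : all (leq 1) s -> lat (colword s) w ->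
  all (leq 1) (foldl grow s w) /\ perm_eq (colword (foldl grow s w)) (w ++ colword s).
Proof. by move=> s1 hw; have [_ <- ? _ ?] := comp_fill s1 hw. Qed.

Lemma sumn_grow s w : all (leq 1) s -> lat (colword s) w ->
  sumn (foldl grow s w) = size w + sumn s.
Proof.
move=> s1 hw; have [_ p] := grow_word s1 hw.
by rewrite -!size_colword (perm_size p) size_cat.
Qed.

Lemma grow_covers s c : addable (colword s) c -> grow s c \in Lcovers s.
Proof.
rewrite addable_colword /Lcovers inE; case: (eqVneq c 0) => [-> _|c0 /= cs].
  by rewrite grow0 eqxx.
have [h1 h2 h3] := last_indexP cs; apply/orP; right.
rewrite /grow /comp_row (negbTE c0); apply: map_f.
rewrite mem_filter mem_iota h1 leq0n !andbT h2; apply/negP => /(nthP 0) [i hi].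
rewrite nth_drop => /eqP; apply/negP/h3.
by move: hi; rewrite size_drop; clear; lia.
Qed.

Lemma Lle_grow s w : all (leq 1) s -> lat (colword s) w -> Lle s (foldl grow s w).
Proof.
move=> s1 hw; rewrite /Lle sumn_grow // addnK.
elim/last_ind: w hw => [|w c IHw]; first by rewrite inE.
rewrite lat_rcons => /andP[hw hc]; rewrite size_rcons foldl_rcons /=.
apply/flatten_mapP; exists (foldl grow s w); first exact: IHw.
have [_ p] := grow_word s1 hw; by apply: grow_covers; rewrite (addable_perm _ p).
Qed.

Lemma inv_row_filling s : inv_tab (row_filling s) = 0.
Proof.
have ent r j : entry (row_filling s) (r, j) != 0 ->
   j < nth 0 s r /\ entry (row_filling s) (r, j) = (sumn (take r s) + j).+1.
  move=> h; have := entry_neq0 h; rewrite row_filling_shape /in_diagram /= => hj.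
  split=> //; move: h; rewrite /entry /= nth_reshape.
  have hr : r < size s by rewrite ltnNge; apply/negP => h; rewrite nth_default in hj.
  have le : sumn (take r s) + nth 0 s r <= sumn s.
    rewrite -[in leqRHS](cat_take_drop r s) sumn_cat leq_add2l.
    by rewrite (drop_nth 0 hr) /= leq_addr.
  rewrite nth_take // nth_drop nth_iota //; last by move: le hj; clear; lia.
rewrite /inv_tab count_pairsE big_seq big1 // => -[r j] hb.
apply/eqP; rewrite -leqn0 leqNgt -has_count; apply/hasPn => -[r' j'] hb' /=.
move: hb hb'; rewrite !mem_boxes => /ent[h ->] /ent[h' ->]; case: ltnP => //= rr'.
have le : sumn (take r s) + nth 0 s r <= sumn (take r' s).
  have hr : r < size s by rewrite ltnNge; apply/negP => h1; rewrite nth_default in h.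
  rewrite -(subnKC rr') takeD sumn_cat (take_nth 0 hr) sumn_rcons leq_addr //.
by rewrite -ltnNge; move: le h; clear; lia.
Qed.

Lemma NE_part s : is_part s -> NE s = winv (colword s).
Proof.
move=> hs; have /andP[_ s1] := hs; have /= := NE_fill (lat_colword s1).
by rewrite -row_filling_part // row_filling_shape inv_row_filling.
Qed.

Lemma fill_part_inj v w : lat [::] v -> lat [::] w ->
  fill part_row [::] (numbered 1 v) = fill part_row [::] (numbered 1 w) -> v = w.
Proof.
move=> hv hw eq; have e : size v = size w.
  rewrite -(perm_size (boxes_columns part_row_choice isT hv)) eq.
  by rewrite (perm_size (boxes_columns part_row_choice isT hw)).
rewrite -(@word_of_fill _ _ [::] v part_row_choice isT isT hv) eq e.
exact: (@word_of_fill _ _ [::] w part_row_choice isT isT hw).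
Qed.

Lemma inv_fill (c : composition) w : lat [::] w -> perm_eq w (colword (nats c)) ->
  (inv_tab (fill part_row [::] (numbered 1 w)) + winv w = NE (sorted_parts c))%N.
Proof.
move=> hw pw; have /= <- := NE_fill hw; congr NE.
have [_ _ h _ p] := @part_fill [::] w isT hw.
apply: part_colword_inj => //; first exact: sorted_parts_is_part.
rewrite (permPr (colword_sorted_parts c)); apply: perm_trans pw.
by rewrite cats0 in p.
Qed.

(** * P22 *)

Lemma words_split m n : m <= n ->
  perm_eq [seq u ++ x | u <- words [::] m, x <- words u (n - m)] (words [::] n).
Proof.
move=> mn; apply: uniq_perm; rewrite ?words_uniq //.
  apply: allpairs_uniq_dep => [|u _|]; rewrite ?words_uniq //.
  move=> [u x] [u' x'] /allpairsPdep[u0 [x0 [h0 _ [-> ->]]]].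
  move=> /allpairsPdep[u1 [x1 [h1 _ [-> ->]]]] /= /eqP.
  move: h0 h1; rewrite !mem_words => /andP[/eqP s0 _] /andP[/eqP s1 _].
  by rewrite eqseq_cat ?s0 ?s1 // => /andP[/eqP -> /eqP ->].
move=> w; rewrite mem_words; apply/allpairsPdep/andP => [[u [x [hu hx ->]]]|[/eqP sw hw]].
  move: hu hx; rewrite !mem_words => /andP[/eqP su hu] /andP[/eqP sx hx].
  by rewrite size_cat su sx subnKC // eqxx lat_cat hu cats0.
exists (take m w), (drop m w); rewrite cat_take_drop !mem_words size_drop size_takel sw //.
by move: hw; rewrite -{1}(cat_take_drop m w) lat_cat cats0 !eqxx => /andP[-> ->].
Qed.

Lemma composition_exists s : all (leq 1) s -> exists a : composition, nats a = s.
Proof.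
move=> s1; exists (pmap insub s); rewrite /nats -[RHS](all_filterP s1).
by elim: (s) => //= p l IHl; case: insubP => [q hq e|/negbTE->] //=; rewrite hq IHl e.
Qed.

Local Open Scope ring_scope.
(** * P19r *)

HB.instance Definition _ (k : comNzRingType) (K : choiceType) (V : lmodType k)
  (phi : K -> V) :=
  GRing.isLinear.Build k {malg k[K]} V *:%R (lin_ext phi) (lin_ext_is_linear phi).

(** * P20r *)

Section Tensor.
Variable k : comNzRingType.
Implicit Types f g : OQSym k.

Lemma tensor_suml (I : Type) (r : seq I) (P : pred I) (F : I -> OQSym k) g :
  tensor (\sum_(i <- r | P i) F i) g = \sum_(i <- r | P i) tensor (F i) g.
Proof. by rewrite /tensor linear_sum. Qed.

Lemma tensor_sumr (I : Type) (r : seq I) (P : pred I) (F : I -> OQSym k) f :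
  tensor f (\sum_(i <- r | P i) F i) = \sum_(i <- r | P i) tensor f (F i).
Proof.
rewrite [LHS]/tensor {1}/lin_ext exchange_big; apply: eq_bigr => x _ /=.
by rewrite -scaler_sumr; congr (_ *: _); apply: linear_sum.
Qed.

Lemma tensorZl c f g : tensor (c *: f) g = c *: tensor f g.
Proof. by rewrite /tensor linearZ. Qed.

Lemma tensorZr c f g : tensor f (c *: g) = c *: tensor f g.
Proof.
rewrite /tensor {1 3}/lin_ext scaler_sumr; apply: eq_bigr => x _.
by rewrite [in LHS]linearZ /= !scalerA mulrC.
Qed.

Definition word_F (w : seq nat) : OQSym k :=
  \sum_(b <- compositions (size w) | increasing_cut w b) oqM k b.

Lemma oqF_word w : oqF k (word_composition w) = word_F w.
Proof.
rewrite /oqF weight_word_composition; apply: eq_bigl => b; exact: refines_word.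
Qed.

Theorem coproduct_word_F w : coproduct (word_F w) =
  \sum_(m < (size w).+1) tensor (word_F (take m w)) (word_F (drop m w)).
Proof.
rewrite /coproduct /word_F linear_sum /=.
under eq_bigr => b _ do rewrite lin_extU.
pose l1 := [seq (take i b, drop i b) | b <- [seq b <- compositions (size w) | increasing_cut w b],
    i <- iota 0 (size b).+1].
pose l2 := [seq p | m <- iota 0 (size w).+1, 
   p <- [seq (a, b) | a <- [seq a <- compositions m | increasing_cut (take m w) a],
      b <- [seq b <- compositions (size w - m) | increasing_cut (drop m w) b]]].
transitivity (\sum_(p <- l1) (<< p >> : OQSym2 k)).
  rewrite big_allpairs_dep big_filter; apply: eq_bigr => b _.
  by rewrite -/(index_iota 0 (size b).+1) big_mkord; apply: eq_bigr => i _; rewrite tensor_M.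
transitivity (\sum_(p <- l2) (<< p >> : OQSym2 k)); last first.
  rewrite big_allpairs_dep -/(index_iota 0 (size w).+1) big_mkord; apply: eq_bigr => m _.
  rewrite tensor_suml big_allpairs_dep big_filter size_takel -1?ltnS //.
  apply: eq_bigr => a _; rewrite big_filter size_drop tensor_sumr.
  by apply: eq_bigr => b _; rewrite tensor_M.
apply: perm_big; apply: uniq_perm.
- apply: allpairs_uniq_dep; rewrite ?filter_uniq ?compositions_uniq //.
    by move=> b _; apply: iota_uniq.
  move=> [b i] [b' i'] /allpairsPdep[b0 [i0 [_ hi [-> ->]]]].
  move=> /allpairsPdep[b1 [i1 [_ hi1 [-> ->]]]] /= [e1 e2].
  have e : b0 = b1 by rewrite -(cat_take_drop i0 b0) e1 e2 cat_take_drop.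
  rewrite e in hi e1 *; congr existT; move/(congr1 size): e1.
  by rewrite !size_takel // -ltnS; move: hi hi1; rewrite !mem_iota.
- apply: allpairs_uniq_dep; rewrite ?iota_uniq //.
    move=> m _; apply: allpairs_uniq_dep; rewrite ?filter_uniq ?compositions_uniq //.
    by move=> [a b] [a' b'] _ _ /= [-> ->].
  move=> [m p] [m' p'] /allpairsPdep[m0 [p0 [_ h0 [-> ->]]]].
  move=> /allpairsPdep[m1 [p1 [_ h1 [-> ->]]]] /= e.
  rewrite -e in h1 *; congr existT; move: h0 h1.
  move=> /allpairsPdep[a [b [ha _ ->]]] /allpairsPdep[a' [b' [ha' _ [ea _]]]].
  move: ha ha'; rewrite -ea !mem_filter !mem_compositions.
  by move=> /andP[_ /eqP <-] /andP[_ /eqP <-].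
move=> [a b]; apply/allpairsPdep/allpairsPdep.
  move=> [c [i [hc hi [-> ->]]]]; exists (weight (take i c)), (take i c, drop i c).
  move: hc; rewrite mem_filter mem_compositions -{1 2}(cat_take_drop i c).
  rewrite increasing_cut_cat weight_cat => /andP[/and3P[_ h1 h2] /eqP hw].
  split=> //; first by rewrite mem_iota /= add0n ltnS -hw leq_addr.
  apply/allpairsPdep; exists (take i c), (drop i c).
  by rewrite !mem_filter h1 h2 !mem_compositions -hw addKn !eqxx.
move=> [m [p [hm /allpairsPdep[a' [b' [ha hb ->]]] [-> ->]]]].
move: ha hb; rewrite !mem_filter !mem_compositions => /andP[h1 /eqP e1] /andP[h2 /eqP e2].
have hw : (weight a' + weight b' == size w)%N.
  by rewrite e1 e2 subnKC // -ltnS; move: hm; rewrite mem_iota.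
exists (a' ++ b'), (size a'); rewrite take_size_cat // drop_size_cat // mem_iota size_cat.
rewrite add0n ltnS leq_addr mem_filter mem_compositions weight_cat hw increasing_cut_cat hw.
by rewrite e1 h1 h2 leq_addr.
Qed.

End Tensor.
(** * P21r *)

Theorem odd_schur_words (k : comNzRingType) (a : composition) :
  odd_schur k a = (-1) ^+ NE (sorted_parts a) *:
    \sum_(w <- words [::] (weight a) | foldl grow [::] w == nats a)
       (-1) ^+ winv w *: word_F k w.
Proof.
rewrite /odd_schur (perm_big _ (SYCT_perm a)) big_map big_filter; congr (_ *: _).
rewrite big_seq_cond [RHS]big_seq_cond; apply: eq_bigr => w /andP[].
rewrite mem_words => /andP[_ hw] _.
by rewrite inv_comp_fill // descent_composition_fill // oqF_word.
Qed.

Theorem OC_words (k : comNzRingType) (a b c : composition) :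
  let la := sorted_parts a in
  OC k a b c = \sum_(w <- words (colword la) (weight c - weight a)
     | (foldl grow (nats a) w == nats c) &&
       ((switch [::] (colword la) w).1 == colword (nats b)))
   (-1) ^+ (NE (sorted_parts c) + winv (colword la ++ w) +
            (NE (sorted_parts b) + winv (colword (nats b)))).
Proof.
move=> la; have hla : is_part la := sorted_parts_is_part a.
have hc := sorted_parts_is_part c; have /andP[_ la1] := hla.
have a1 := nats_positive a; have pa : perm_eq (colword la) (colword (nats a)) := colword_sorted_parts a.
rewrite /OC (perm_big _ (SYT_perm hc hla)) big_map big_filter_cond !sumn_sorted_parts.
have hb := lat_colword (nats_positive b).
rewrite row_filling_comp ?nats_positive // rho_fill //.
rewrite big_seq_cond [RHS]big_seq_cond; apply: congr_big => // w.
  case: (boolP (w \in _)) => //=; rewrite mem_words => /andP[_ hw].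
  have hwa : lat (colword (nats a)) w by rewrite -(lat_perm _ pa).
  have [sh1 sh2] := grow_word a1 hwa.
  rewrite rho_inv_fill //; last by apply: permEl (perm_sort _ _).
  have [_ -> _ _ _] := comp_fill a1 hwa.
  case: (foldl grow (nats a) w =P nats c) => [ec|_]; last by rewrite !andbF.
  rewrite -ec Lle_grow // -/la (permPr (colword_sorted_parts c)) -ec.
  rewrite (perm_trans (_ : perm_eq _ (w ++ colword (nats a)))) ?perm_cat2l //=; last by rewrite perm_sym.
  rewrite rect_fill //; apply/eqP/eqP => [|->//].
  apply: fill_part_inj => //.
  have hl : lat [::] (colword la ++ w) by rewrite lat_cat lat_colword // cats0.
  by have := switch_lat hl; rewrite lat_cat => /andP[].
rewrite mem_words => /andP[/andP[_ hw] /andP[pw _]].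
have hl : lat [::] (colword la ++ w) by rewrite lat_cat lat_colword // cats0.
rewrite extend_fill // -(inv_fill (c := c) hl); last first.
  by rewrite -(permPr (colword_sorted_parts c)) -(permPr pw) perm_catC.
rewrite -(inv_fill (c := b) hb) // -!addnA.
rewrite -[LHS]signr_odd -[RHS]signr_odd !oddD; congr (_ ^+ nat_of_bool _).
by do 4 case: (odd _).
Qed.
(** * P22r *)

Lemma sum_by_shape (V : nmodType) m (f : seq nat -> V) :
  \sum_(u <- words [::] m) f u =
  \sum_(a <- compositions m) \sum_(u <- words [::] m | foldl grow [::] u == nats a) f u.
Proof.
rewrite (exchange_big_dep predT) //=; rewrite big_seq [RHS]big_seq.
apply: eq_bigr => u; rewrite mem_words => /andP[/eqP su hu].
have [s1 _] := @grow_word [::] u isT hu; have [a ea] := composition_exists s1.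
have wa : a \in compositions m.
  by rewrite mem_compositions /weight ea sumn_grow // addn0 su.
rewrite -ea; under eq_bigl => b do rewrite (inj_eq nats_inj) eq_sym.
by rewrite -big_filter filter_pred1_uniq ?compositions_uniq // big_seq1.
Qed.

Lemma sum_transport (V : nmodType) (u v v' s : seq nat) n (g : seq nat -> V) :
  lat [::] u -> lat [::] v -> lat [::] v' -> perm_eq v v' ->
  foldl grow [::] v = foldl grow [::] v' ->
  let rec x := (switch [::] (evac (size u) u) x).1 in
  let A x := foldl grow (foldl grow [::] u) x == s in
  \sum_(x <- words u n | A x && (rec x == v)) g x =
  \sum_(x <- words u n | A x && (rec x == v')) g (transport u v x).
Proof.
move=> hu hv hv' pv gv rec A.
have pv' : perm_eq v' v by rewrite perm_sym.
have T1 x := @transportP u v v' hu hv hv' pv gv x.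
have T2 x := @transportP u v' v hu hv' hv pv' (esym gv) x.
rewrite -big_filter -[RHS]big_filter -(big_map (transport u v) predT g).
apply: perm_big; apply: uniq_perm; rewrite ?filter_uniq ?words_uniq //.
  rewrite map_inj_in_uniq ?filter_uniq ?words_uniq // => x y.
  rewrite !mem_filter !mem_words => /and3P[/andP[_ /eqP ex] _ hx] /and3P[/andP[_ /eqP ey] _ hy] e.
  have [_ _ <- _ _] := T2 x hx ex; rewrite e.
  by have [_ _ -> _ _] := T2 y hy ey.
move=> x; apply/idP/mapP => [|[y + ->]]; rewrite !mem_filter !mem_words.
  move=> /and3P[/andP[Ax /eqP ex] /eqP sx hx]; have [h1 h2 h3 h4 [h5 _]] := T1 x hx ex.
  exists (transport u v' x); last by rewrite h3.
  by rewrite mem_filter mem_words /A h4 /rec h2 eqxx -(perm_size h5) sx eqxx h1 !andbT.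
move=> /and3P[/andP[Ay /eqP ey] /eqP sy hy]; have [h1 h2 h3 h4 [h5 _]] := T2 y hy ey.
by rewrite /A h4 /rec h2 eqxx -(perm_size h5) sy eqxx h1 !andbT.
Qed.

Section Coproduct.
Variables (k : comNzRingType) (a c : composition) (u : seq nat) (n : nat).
Hypotheses (hu : lat [::] u) (gu : foldl grow [::] u = nats a).
Hypothesis hn : (weight c - weight a)%N = n.

Local Notation rec x := (switch [::] (evac (size u) u) x).1.
Local Notation A x := (foldl grow (nats a) x == nats c).

Lemma perm_colword_shape : perm_eq (colword (nats a)) u.
Proof. by have [_] := @grow_word [::] u isT hu; rewrite gu cats0. Qed.

Lemma OC_along b : OC k a b c =
  \sum_(x <- words u n | A x && (rec x == colword (nats b)))
    (-1) ^+ (NE (sorted_parts c) + winv (u ++ x) + winv u + NE (sorted_parts a) +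
             NE (sorted_parts b) + winv (colword (nats b))).
Proof.
have hla := sorted_parts_is_part a; have /andP[_ la1] := hla.
have pu : perm_eq (colword (sorted_parts a)) u.
  exact: perm_trans (colword_sorted_parts a) perm_colword_shape.
rewrite OC_words hn (perm_big _ (words_perm n pu)).
have [hT pT] := evacP erefl hu.
rewrite big_seq_cond [RHS]big_seq_cond; apply: congr_big => // x.
  case: (boolP (x \in _)) => //=; rewrite mem_words => /andP[_ hx].
  rewrite (@rect_indep _ (evac (size u) u)) ?lat_colword //.
    by apply: perm_trans pu _; rewrite perm_sym.
  by rewrite (lat_perm _ pu).
move=> _; rewrite (NE_part hla) !winv_cat (cross_perm pu (perm_refl x)).
rewrite -[LHS]signr_odd -[RHS]signr_odd !oddD; congr (_ ^+ nat_of_bool _).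
by do 7 case: (odd _).
Qed.

Lemma rec_lat x : lat u x -> lat [::] (rec x) /\ weak_descents (rec x) = weak_descents x.
Proof.
move=> hx; have [hT pT] := evacP erefl hu.
have h : lat [::] (evac (size u) u ++ x) by rewrite lat_cat hT cats0 (lat_perm _ pT).
split; last exact: switch_descents.
by have := switch_lat h; rewrite lat_cat => /andP[].
Qed.

Lemma word_F_rec x : lat u x -> word_F k (rec x) = word_F k x.
Proof.
move=> hx; have [_ d] := rec_lat hx.
by rewrite -!oqF_word (word_composition_descents _ d) // switch_size.
Qed.

Lemma coproduct_along :
  (-1) ^+ NE (sorted_parts c) *:
    \sum_(x <- words u n | A x) (-1) ^+ winv (u ++ x) *: tensor (word_F k u) (word_F k x) =
  \sum_(b <- compositions n) OC k a b c *:
    (((-1) ^+ NE (sorted_parts a) * (-1) ^+ NE (sorted_parts b)) *: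
     \sum_(v <- words [::] n | foldl grow [::] v == nats b)
       ((-1) ^+ winv u * (-1) ^+ winv v) *: tensor (word_F k u) (word_F k v)).
Proof.
transitivity (\sum_(v <- words [::] n) \sum_(x <- words u n | A x && (rec x == v))
   ((-1) ^+ NE (sorted_parts c) * (-1) ^+ winv (u ++ x)) *: tensor (word_F k u) (word_F k v)).
  rewrite scaler_sumr (exchange_big_dep (fun x => A x)) /=; last by move=> v x _ /andP[].
  rewrite big_seq_cond [RHS]big_seq_cond; apply: eq_bigr => x /andP[].
  rewrite mem_words => /andP[/eqP sx hx] Ax; have [hr _] := rec_lat hx.
  rewrite -big_filter (eq_filter (_ : _ =1 pred1 (rec x))); last by move=> v; rewrite /= Ax eq_sym.
  rewrite filter_pred1_uniq ?words_uniq ?big_seq1 ?scalerA ?word_F_rec //.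
  by rewrite mem_words hr switch_size sx eqxx.
rewrite sum_by_shape; apply: eq_bigr => b _; rewrite OC_along scaler_suml.
rewrite scaler_sumr.
under [RHS]eq_bigr => x _ do rewrite scaler_sumr.
rewrite exchange_big /= big_seq_cond [RHS]big_seq_cond; apply: eq_bigr => v /andP[].
rewrite mem_words => /andP[/eqP sv hv] /eqP gv.
have b1 := nats_positive b; have hb := lat_colword b1.
have pv : perm_eq v (colword (nats b)).
  by have [_] := @grow_word [::] v isT hv; rewrite gv cats0 perm_sym.
have gvb : foldl grow [::] v = foldl grow [::] (colword (nats b)) by rewrite grow_colword.
rewrite -gu (sum_transport _ _ _ hu hv hb pv gvb).
rewrite big_seq_cond [RHS]big_seq_cond; apply: eq_bigr => x /and3P[].
rewrite mem_words => /andP[_ hx] _ /eqP ex.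
have pv' : perm_eq (colword (nats b)) v by rewrite perm_sym.
have [_ _ _ _ [px par]] := @transportP u _ v hu hb hv pv' (esym gvb) x hx ex.
rewrite !scalerA -!exprD; congr (_ *: _); rewrite -signr_odd -[RHS]signr_odd.
congr (_ ^+ nat_of_bool _); rewrite !winv_cat -(cross_perm (perm_refl u) px) !oddD.
move: par; move: (odd (winv x)) (odd (winv (transport u v x))) (odd (winv v)).
move: (odd (winv (colword _))) (odd (winv u)) (odd (cross u x)).
move: (odd (NE (sorted_parts a))) (odd (NE (sorted_parts b))) (odd (NE (sorted_parts c))).
by do 9 case.
Qed.

End Coproduct.

Lemma tensor_odd_schur (k : comNzRingType) (a b : composition) :
  tensor (odd_schur k a) (odd_schur k b) =
  \sum_(u <- words [::] (weight a) | foldl grow [::] u == nats a)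
    ((-1) ^+ NE (sorted_parts a) * (-1) ^+ NE (sorted_parts b)) *:
     \sum_(v <- words [::] (weight b) | foldl grow [::] v == nats b)
       ((-1) ^+ winv u * (-1) ^+ winv v) *: tensor (word_F k u) (word_F k v).
Proof.
rewrite !odd_schur_words tensorZl tensorZr scalerA tensor_suml scaler_sumr.
apply: eq_bigr => u _; congr (_ *: _); rewrite tensorZl tensor_sumr scaler_sumr.
by apply: eq_bigr => v _; rewrite tensorZr scalerA.
Qed.

Theorem coproduct_odd_schur (k : comNzRingType) (c : composition) :
  coproduct (odd_schur k c) =
    \sum_(m < (weight c).+1)
      \sum_(a <- compositions m) \sum_(b <- compositions (weight c - m))
         OC k a b c *: tensor (odd_schur k a) (odd_schur k b).
Proof.
rewrite odd_schur_words [LHS]linearZ /= [X in _ *: X]linear_sum /=.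
transitivity (\sum_(m < (weight c).+1) (-1) ^+ NE (sorted_parts c) *:
   \sum_(w <- words [::] (weight c) | foldl grow [::] w == nats c)
      (-1) ^+ winv w *: tensor (word_F k (take m w)) (word_F k (drop m w))).
  rewrite -scaler_sumr exchange_big big_seq_cond [in RHS]big_seq_cond; congr (_ *: _).
  apply: eq_bigr => w /andP[]; rewrite mem_words => /andP[/eqP sw _] _.
  by rewrite [LHS]linearZ /= -scaler_sumr -sw -coproduct_word_F.
apply: eq_bigr => m _; have hm : (m <= weight c)%N by rewrite -ltnS.
rewrite -(perm_big _ (words_split hm)) big_mkcond big_allpairs_dep /= sum_by_shape.
rewrite scaler_sumr big_seq [RHS]big_seq; apply: eq_bigr => a.
rewrite mem_compositions => /eqP wa.
transitivity (\sum_(b <- compositions (weight c - m)) \sum_(u <- words [::] m | foldl grow [::] u == nats a)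
   OC k a b c *:  (((-1) ^+ NE (sorted_parts a) * (-1) ^+ NE (sorted_parts b)) *:
     \sum_(v <- words [::] (weight c - m) | foldl grow [::] v == nats b)
       ((-1) ^+ winv u * (-1) ^+ winv v) *: tensor (word_F k u) (word_F k v))); last first.
  rewrite big_seq [RHS]big_seq; apply: eq_bigr => b; rewrite mem_compositions => /eqP wb.
  by rewrite -scaler_sumr tensor_odd_schur wa wb.
rewrite exchange_big /= scaler_sumr big_seq_cond [RHS]big_seq_cond; apply: eq_bigr => u /andP[].
rewrite mem_words => /andP[/eqP su hu] /eqP gu.
rewrite -(coproduct_along k hu gu); last by rewrite wa.
congr (_ *: _).
rewrite -big_mkcond; apply: eq_big => x; first by rewrite foldl_cat gu.
by move=> _; rewrite -su take_cat drop_cat ltnn subnn take0 drop0 cats0.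
Qed.
(** * P23r *)

Section Duality.
Variable k : comNzRingType.
Implicit Types (f g : OQSym k) (h : NSym k).

Definition word_coef h (a : composition) : k^o := h@_(FMonom a).

Lemma pairingE f h : pairing f h = lin_ext (word_coef h) f.
Proof. by []. Qed.

Lemma pairing_sumr (I : Type) (r : seq I) (c : I -> k) (h : I -> NSym k) f :
  pairing f (\sum_(i <- r) c i *: h i) = \sum_(i <- r) c i * pairing f (h i).
Proof.
rewrite /pairing; under [RHS]eq_bigr => i _ do rewrite mulr_sumr.
rewrite exchange_big; apply: eq_bigr => x _; rewrite raddf_sum mulr_sumr.
by apply: eq_bigr => i _; rewrite /= mcoeffZ mulrCA.
Qed.

Definition pairing2 (h1 h2 : NSym k) (G : OQSym2 k) : k^o :=
  lin_ext (fun p : composition * composition => word_coef h1 p.1 * word_coef h2 p.2 : k^o) G.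

HB.instance Definition _ h1 h2 := GRing.Linear.copy (pairing2 h1 h2)
  (lin_ext (fun p : composition * composition => word_coef h1 p.1 * word_coef h2 p.2 : k^o)).

Lemma pairing2_tensor h1 h2 f g :
  pairing2 h1 h2 (tensor f g) = pairing f h1 * pairing g h2.
Proof.
rewrite /tensor /lin_ext linear_sum /pairing mulr_suml; apply: eq_bigr => x _.
rewrite linearZ linear_sum /= mulr_sumr scaler_sumr; apply: eq_bigr => y _.
rewrite linearZ /= /pairing2 lin_extU /= /word_coef.
by rewrite -!mulrA; congr (_ * _); rewrite mulrCA.
Qed.

Lemma coef_mul h1 h2 (a : composition) :
  (h1 * h2)@_(FMonom a) =
  \sum_(i < (size a).+1) word_coef h1 (take i a) * word_coef h2 (drop i a).
Proof.
have coefE h x : h@_x = \sum_(y <- msupp h) h@_y *+ (y == x).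
  by rewrite [in LHS](monalgE h) raddf_sum /=; apply: eq_bigr => y _; rewrite mcoeffU.
rewrite mcoeffMl; apply/esym.
under eq_bigr => i _ do rewrite /word_coef [h1@__]coefE [h2@__]coefE big_distrlr /=.
rewrite exchange_big; apply: eq_bigr => x _; rewrite exchange_big; apply: eq_bigr => y _ /=.
under eq_bigr => i _ do rewrite mulrnAl mulrnAr -mulrnA mulnb.
rewrite sumrMnr; congr (_ *+ _).
rewrite fmP fmM /=; under eq_bigr => i _ do rewrite !fmP /=.
case: (fmonom_val x ++ fmonom_val y =P a) => [e|ne].
  have hx : (size x < (size a).+1)%N by rewrite -e size_cat ltnS leq_addr.
  have ex : take (size x) a = x by rewrite -e take_size_cat.
  have ey : drop (size x) a = y by rewrite -e drop_size_cat.
  rewrite (bigD1 (Ordinal hx)) //= ex ey !eqxx.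
  rewrite big1 ?addn0 // => i hi; apply/eqP; rewrite eqb0; apply: contraNN hi.
  move=> /andP[_ /eqP xi]; apply/eqP/val_inj => /=; rewrite xi size_takel //.
  by rewrite -ltnS.
rewrite big1 // => i _; apply/eqP; rewrite eqb0; apply/negP => /andP[/eqP e2 /eqP e1].
by case: ne; rewrite e1 e2 cat_take_drop.
Qed.

Lemma pairing_mul f h1 h2 :
  pairing f (h1 * h2) = pairing2 h1 h2 (coproduct f).
Proof.
have cutE (a : composition) : word_coef (h1 * h2) a =
    pairing2 h1 h2 (\sum_(i < (size a).+1) tensor (oqM k (take i a)) (oqM k (drop i a))).
  rewrite linear_sum [LHS]coef_mul; apply: eq_bigr => i _.
  by rewrite /= tensor_M /pairing2 lin_extU.
rewrite pairingE /coproduct {2}/lin_ext linear_sum; apply: eq_bigr => x _.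
by rewrite linearZ /= cutE.
Qed.

Lemma pairing_homogeneous n f h : (forall a, weight a != n -> f@_a = 0) ->
  pairing f h = \sum_(a <- compositions n) f@_a * h@_(FMonom a).
Proof.
move=> hf; have e : f = \sum_(a <- compositions n) f@_a *: oqM k a.
  apply/malgP => b; rewrite raddf_sum /=.
  under eq_bigr => a _ do rewrite mcoeffZ /oqM mcoeffU mulrnAr mulr1 mulrb.
  rewrite -big_mkcond /= -big_filter; case: (eqVneq (weight b) n) => [hb|hb].
    by rewrite filter_pred1_uniq ?compositions_uniq ?mem_compositions ?hb // big_seq1.
  rewrite big_filter big_seq_cond big1 ?hf // => a /andP[+ /eqP e].
  by rewrite e mem_compositions (negbTE hb).
rewrite pairingE [in LHS]e linear_sum; apply: eq_bigr => a _.
by rewrite linearZ /= /oqM lin_extU.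
Qed.

Lemma odd_schur_homogeneous (c a : composition) :
  weight a != weight c -> (odd_schur k c)@_a = 0.
Proof.
move=> ac; rewrite odd_schur_words mcoeffZ raddf_sum big_seq_cond big1 ?mulr0 // => w.
rewrite mem_words => /andP[/andP[/eqP sw _] _]; rewrite /= mcoeffZ /word_F raddf_sum.
rewrite big_seq_cond big1 ?mulr0 // => b /andP[].
rewrite mem_compositions sw /oqM /= mcoeffU => /eqP wb _.
by case: (b =P a) => // e; rewrite -e wb eqxx in ac.
Qed.

Variable Sstar : composition -> NSym k.
Hypothesis dual : dual_to_odd_schur Sstar.

Lemma pairing_odd_schur_inj h h' :
  (forall c, pairing (odd_schur k c) h = pairing (odd_schur k c) h') -> h = h'.
Proof.
move=> hh; apply/malgP => -[b]; set n := weight b.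
pose C (i : 'I_(size (compositions n))) : composition := tnth (in_tuple (compositions n)) i.
pose P : 'M[k]_(size (compositions n)) := \matrix_(i, j) (odd_schur k (C i))@_(C j).
pose Q : 'M[k]_(size (compositions n)) := \matrix_(i, j) (Sstar (C j))@_(FMonom (C i)).
have injC : injective C by apply/(@tuple_uniqP _ _ (in_tuple _)); apply: compositions_uniq.
have wC i : weight (C i) = n.
  by apply/eqP; rewrite -mem_compositions mem_tnth.
have PE i x : pairing (odd_schur k (C i)) x = \sum_j P i j * x@_(FMonom (C j)).
  rewrite (@pairing_homogeneous n) => [|a ha]; last by rewrite odd_schur_homogeneous ?wC.
  by rewrite big_tnth; apply: eq_bigr => j _; rewrite mxE.
have PQ : P *m Q = 1%:M.
  apply/matrixP => i j; rewrite !mxE.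
  transitivity (pairing (odd_schur k (C i)) (Sstar (C j))).
    by rewrite PE; apply: eq_bigr => l _; rewrite !mxE.
  by rewrite dual (inj_eq injC).
pose v (x : NSym k) : 'cV[k]_(size (compositions n)) := \col_i x@_(FMonom (C i)).
have vE x : v x = Q *m (P *m v x) by rewrite mulmxA (mulmx1C PQ) mul1mx.
have vv : v h = v h'.
  rewrite vE [in RHS]vE; congr (_ *m _); apply/colP => i; rewrite !mxE.
  have := hh (C i); rewrite !PE => e.
  under eq_bigr => j _ do rewrite [v h _ _]mxE.
  by under [RHS]eq_bigr => j _ do rewrite [v h' _ _]mxE.
have /tnthP[i ->] : b \in in_tuple (compositions n) by rewrite mem_compositions.
by move/colP/(_ i): vv; rewrite !mxE.
Qed.

Lemma dual_product (a b : composition) : Sstar a * Sstar b =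
  \sum_(c <- compositions (weight a + weight b)) OC k a b c *: Sstar c.
Proof.
apply: pairing_odd_schur_inj => c; rewrite pairing_sumr pairing_mul coproduct_odd_schur.
transitivity (\sum_(m < (weight c).+1) \sum_(a' <- compositions m)
   \sum_(b' <- compositions (weight c - m)) OC k a' b' c * ((a' == a)%:R * (b' == b)%:R)).
  rewrite linear_sum; apply: eq_bigr => m _; rewrite linear_sum; apply: eq_bigr => a' _.
  rewrite linear_sum; apply: eq_bigr => b' _.
  by rewrite linearZ /= pairing2_tensor !dual.
have pick n (x : composition) (F : composition -> k) :
    \sum_(y <- compositions n) F y * (y == x)%:R = if weight x == n then F x else 0.
  under eq_bigr => y _ do rewrite mulr_natr mulrb.
  rewrite -big_mkcond /= -big_filter -mem_compositions; case: (boolP (x \in _)) => hx.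
    by rewrite filter_pred1_uniq ?compositions_uniq // big_seq1.
  rewrite big_filter big_seq_cond big1 // => y /andP[+ /eqP e].
  by rewrite e (negbTE hx).
under [RHS]eq_bigr => c' _ do rewrite dual eq_sym.
rewrite pick.
transitivity (\sum_(m < (weight c).+1) if weight a == m then
   if weight b == (weight c - m)%N then OC k a b c else 0 else 0).
  apply: eq_bigr => m _; rewrite -(pick _ a (fun a' => if _ == _ then OC k a' b c else 0)).
  apply: eq_bigr => a' _; rewrite -(pick _ b (fun b' => OC k a' b' c)) mulr_suml.
  by apply: eq_bigr => b' _; rewrite -mulrA [(b' == b)%:R * _]mulrC.
rewrite -big_mkcond /=.
case: (leqP (weight a) (weight c)) => ac; last first.
  rewrite big1 => [|m /eqP e]; first by rewrite ltn_eqF // ltn_addr.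
  by move: (ltn_ord m); rewrite -e ltnS leqNgt ac.
have hm : (weight a < (weight c).+1)%N by [].
rewrite (big_pred1 (Ordinal hm)) /=; last by move=> i; rewrite /= -val_eqE eq_sym.
by rewrite -(eqn_add2l (weight a)) subnKC // eq_sym.
Qed.

End Duality.

Theorem theorem6p13 (k : comNzRingType) :
  (forall Sstar : composition -> NSym k, dual_to_odd_schur Sstar ->
     forall a b : composition,
       Sstar a * Sstar b =
         \sum_(c <- compositions (weight a + weight b)) OC k a b c *: Sstar c)
  /\
  (forall c : composition,
     coproduct (odd_schur k c) =
       \sum_(m < (weight c).+1)
         \sum_(a <- compositions m) \sum_(b <- compositions (weight c - m))
           OC k a b c *: tensor (odd_schur k a) (odd_schur k b)).
Proof.
split=> [Sstar dual a b|c]; last exact: coproduct_odd_schur.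
exact: dual_product.
Qed.
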